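(* The space of symmetric functions $\Lambda$ equipped with the operations $(\#,\Delta)$ is a cocommutative Hopf algebra, and the map $\pi:\Sigma\to\Lambda$ is a morphism of Hopf algebras from $(\Sigma,\#,\Delta)$ to $(\Lambda,\#,\Delta)$.
   Context: Let $\Bbbk$ be a field of characteristic zero. For compositions $\alpha=(a_1,\dots,a_r)$ of $p$, $\beta=(b_1,\dots,b_s)$ of $q$ and $\max(p,q)\le n\le p+q$, $\mathcal M^n_{\alpha,\beta}$ is the set of matrices $M=(m_{ij})_{0\le i\le s,\,0\le j\le r}$ of non-negative integers with $m_{00}=0$, column sums $(n-p,a_1,\dots,a_r)$ and row sums $(n-q,b_1,\dots,b_s)$; $c(M)$ is the composition of non-zero entries of $M$ read left to right, top to bottom, and $p(M)$ the partition formed by the non-zero entries. $\Lambda$ is the space of symmetric functions over $\Bbbk$, with $h_\alpha=h_{a_1}\cdots h_{a_r}$ the complete homogeneous symmetric functions. Its Heisenberg product is given by $h_\alpha\#h_\beta=\sum_{n=\max(p,q)}^{p+q}\sum_{M\in\mathcal M^n_{\alpha,\beta}}h_{p(M)}$, with unit $1$, and its coproduct $\Delta$ is the morphism of algebras for ordinary multiplication with $\Delta(h_a)=\sum_{i+j=a}h_i\otimes h_j$ ($h_0=1$), with the counit vanishing in positive degrees. $\Sigma=\bigoplus_n\Sigma_n$, $\Sigma_n\subseteq\Bbbk S_n$ with basis $X_\alpha=\sum_{\mathrm{Des}(\sigma)\subseteq\{a_1,a_1+a_2,\dots,a_1+\cdots+a_{r-1}\}}\sigma$ ($\alpha=(a_1,\dots,a_r)$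 a composition of $n$, $\mathrm{Des}(\sigma)=\{i:\sigma(i)>\sigma(i+1)\}$). Its Heisenberg product is given by $X_\alpha\#X_\beta=\sum_{n=\max(p,q)}^{p+q}\sum_{M\in\mathcal M^n_{\alpha,\beta}}X_{c(M)}$, with unit $X_{()}$, and its coproduct by $\Delta(X_{(a_1,\dots,a_r)})=\sum_{b_i+c_i=a_i,\ b_i,c_i\ge0}X_{(b_1,\dots,b_r)^\wedge}\otimes X_{(c_1,\dots,c_r)^\wedge}$, where $^\wedge$ means omitting zero parts. $\pi:\Sigma\to\Lambda$ is the linear map $\pi(X_\alpha)=h_{\alpha}$. *)

(* Defs.v *)
From HB Require Import structures.
From mathcomp Require Import all_boot all_order all_algebra all_fingroup.
From mathcomp Require Import finmap.
From mathcomp Require Import boolp classical_sets functions cardinality fsbigop.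
From mathcomp Require Import generic_quotient ring_quotient.
From mathcomp Require Import monalg.

Set Implicit Arguments.
Unset Strict Implicit.
Unset Printing Implicit Defensive.

Import GRing.Theory.
Local Open Scope ring_scope.
Local Open Scope quotient_scope.

Definition malg_lift (k : fieldType) (K : choiceType) (U : lmodType k)
    (f : K -> U) (x : {malg k[K]}) : U :=
  \sum_(z <- msupp x) x@_z *: f z.

Section MalgLift.
Context (k : fieldType) (K : choiceType) (U : lmodType k) (f : K -> U).

Fact malg_liftEw (x : {malg k[K]}) (d : {fset K}) : (msupp x `<=` d)%fset ->
  malg_lift f x = \sum_(z <- d) x@_z *: f z.
Proof.
move=> xd; rewrite /malg_lift (big_fset_incl _ xd) // => z _ /mcoeff_outdom ->.
by rewrite scale0r.
Qed.

Fact malg_lift_linear : linear (malg_lift f).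
Proof.
move=> a x y; pose d := (msupp (a *: x + y) `|` (msupp x `|` msupp y))%fset.
have xd : (msupp x `<=` d)%fset by rewrite fsubsetU ?fsubsetUl ?orbT.
have yd : (msupp y `<=` d)%fset by rewrite fsubsetU ?fsubsetUr ?orbT.
rewrite (malg_liftEw (fsubsetUl _ _ : _ `<=` d)%fset).
rewrite (malg_liftEw xd) (malg_liftEw yd).
rewrite scaler_sumr -big_split /=; apply: eq_bigr => z _.
by rewrite mcoeffD mcoeffZ scalerDl scalerA.
Qed.

HB.instance Definition _ := GRing.isLinear.Build k {malg k[K]} U *:%R
  (malg_lift f) malg_lift_linear.

Fact malg_liftU (z : K) : malg_lift f << z >> = f z.
Proof. by rewrite /malg_lift msuppU oner_eq0 big_seq_fset1 mcoeffUU scale1r. Qed.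

End MalgLift.

Definition bilin (k : fieldType) (U V W : lmodType k) (B : U -> V -> W) : Prop :=
  (forall v, linear (B^~ v)) /\ (forall u, linear (B u)).

Definition tens_gen (k : fieldType) (V W : lmodType k) (v : V) (w : W) :
  {malg k[(V * W)%type]} := << (v, w) : (V * W)%type >>.

(* The smallest subspace of the free vector space on V * W containing the
   bilinearity relators. *)
Inductive tens_null (k : fieldType) (V W : lmodType k) :
    {malg k[(V * W)%type]} -> Prop :=
| tens_null0 : tens_null 0
| tens_nullP a x y : tens_null x -> tens_null y -> tens_null (a *: x + y)
| tens_nullL a v1 v2 w :
    tens_null (tens_gen (a *: v1 + v2) w - (a *: tens_gen v1 w + tens_gen v2 w))
| tens_nullR a v w1 w2 :
    tens_null (tens_gen v (a *: w1 + w2) - (a *: tens_gen v w1 + tens_gen v w2)).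

Definition tens_ideal (k : fieldType) (V W : lmodType k) :
  {pred {malg k[(V * W)%type]}} := fun x => `[< tens_null x >].

Section TensorSpace.
Context (k : fieldType) (V W : lmodType k).
Local Notation F := {malg k[(V * W)%type]}.
Local Notation I := (@tens_ideal k V W).

Fact tens_ideal_closed : submod_closed I.
Proof.
split; first exact/asboolP/tens_null0.
by move=> a x y /asboolP xI /asboolP yI; apply/asboolP/tens_nullP.
Qed.
HB.instance Definition _ := GRing.isSubmodClosed.Build k F I tens_ideal_closed.

Definition tens := (Quotient.quot I).
HB.instance Definition _ := Choice.on tens.
HB.instance Definition _ := GRing.Zmodule.on tens.
HB.instance Definition _ := EqQuotient.on tens.
HB.instance Definition _ := ZmodQuotient.on tens.

Fact tens_piB (x y : F) : (x - y \in I) = (\pi_tens x == \pi_tens y).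
Proof. exact: Quotient.idealrBE. Qed.

Definition tens_scale (a : k) (x : tens) : tens := \pi_tens (a *: repr x).

Fact tens_scale_pi a (x : F) : tens_scale a (\pi_tens x) = \pi_tens (a *: x).
Proof.
apply/eqP; rewrite -tens_piB -scalerBr; apply: rpredZ.
by rewrite tens_piB reprK.
Qed.

Fact tens_scaleA a b x : tens_scale a (tens_scale b x) = tens_scale (a * b) x.
Proof. by rewrite -[x]reprK (tens_scale_pi b) !tens_scale_pi scalerA. Qed.
Fact tens_scale1 : left_id 1 tens_scale.
Proof. by move=> x; rewrite -[x]reprK tens_scale_pi scale1r. Qed.
Fact tens_scaleDr : right_distributive tens_scale +%R.
Proof.
move=> a x y; rewrite -[x]reprK -[y]reprK -raddfD !tens_scale_pi.
by rewrite scalerDr raddfD.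
Qed.
Fact tens_scaleDl x : {morph tens_scale^~ x : a b / a + b}.
Proof.
by move=> a b; rewrite -[x]reprK !tens_scale_pi scalerDl raddfD.
Qed.
HB.instance Definition _ := GRing.Zmodule_isLmodule.Build k tens
  tens_scaleA tens_scale1 tens_scaleDr tens_scaleDl.

Definition tpure (v : V) (w : W) : tens := \pi_tens (tens_gen v w).

(* The linear map on [tens] induced by B; it is only meaningful when B is
   bilinear, in which case [tlift_pure] holds. *)
Definition tlift (U : lmodType k) (B : V -> W -> U) (t : tens) : U :=
  malg_lift (fun p => B p.1 p.2) (repr t).

End TensorSpace.

Notation "v ⊗ w" := (tpure v w) (at level 40, left associativity) : ring_scope.

Section TensorTheory.
Context (k : fieldType) (V W : lmodType k).
Local Notation F := {malg k[(V * W)%type]}.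

Lemma tpure_bilin : bilin (@tpure k V W).
Proof.
have E (x y : F) a : \pi_(tens V W) (a *: x + y)
    = a *: \pi_(tens V W) x + \pi_(tens V W) y.
  by rewrite raddfD; congr (_ + _); exact/esym/tens_scale_pi.
split=> [w|v] a x y; rewrite /tpure -E; apply/eqP;
  rewrite -tens_piB; apply/asboolP;
  [exact: tens_nullL | exact: tens_nullR].
Qed.

Lemma tlift_pi (U : lmodType k) (B : V -> W -> U) : bilin B ->
  forall x : F, tlift B (\pi_(tens V W) x) = malg_lift (fun p => B p.1 p.2) x.
Proof.
move=> [Bl Br] x; rewrite /tlift; set f := fun p : V * W => B p.1 p.2.
apply/eqP; rewrite -subr_eq0 -raddfB; apply/eqP.
have : tens_null (repr (\pi_(tens V W) x) - x).
  by apply/asboolP; rewrite -[asbool _]/(_ \in @tens_ideal k V W)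
    tens_piB reprK.
have LU v w : malg_lift f (tens_gen v w) = B v w by exact: malg_liftU.
elim=> [|a u v _ u0 _ v0|a v1 v2 w|a v w1 w2].
- exact: raddf0.
- by rewrite [LHS](malg_lift_linear f a u v) u0 v0 scaler0 addr0.
- rewrite [LHS]raddfB [X in _ - X](malg_lift_linear f).
  by rewrite [X in X - _]LU !LU (Bl w) subrr.
- rewrite [LHS]raddfB [X in _ - X](malg_lift_linear f).
  by rewrite [X in X - _]LU !LU (Br v) subrr.
Qed.

Lemma tlift_linear (U : lmodType k) (B : V -> W -> U) :
  bilin B -> linear (tlift B).
Proof.
move=> bB a x y; rewrite -[x]reprK -[y]reprK.
rewrite [a *: _]tens_scale_pi -raddfD !tlift_pi //.
exact: malg_lift_linear.
Qed.

Lemma tlift_pure (U : lmodType k) (B : V -> W -> U) :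
  bilin B -> forall v w, tlift B (v ⊗ w) = B v w.
Proof. by move=> bB v w; rewrite /tpure tlift_pi // malg_liftU. Qed.

Lemma tens_span (t : tens V W) :
  exists s : seq (k * (V * W)), t = \sum_(p <- s) p.1 *: (p.2.1 ⊗ p.2.2).
Proof.
exists [seq ((repr t)@_z, z) | z <- msupp (repr t)].
rewrite big_map -{1}[t]reprK [X in \pi X]monalgE raddf_sum.
apply: eq_bigr => -[v w] _ /=; rewrite /tpure [RHS]tens_scale_pi; congr (\pi _).
by apply/malgP => z; rewrite mcoeffZ !mcoeffU mulrnAr mulr1.
Qed.

End TensorTheory.

Definition tmap (k : fieldType) (V W V' W' : lmodType k) (f : V -> V')
    (g : W -> W') : tens V W -> tens V' W' :=
  tlift (fun v w => f v ⊗ g w).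

Definition tassoc (k : fieldType) (U V W : lmodType k) :
    tens (tens U V) W -> tens U (tens V W) :=
  tlift (fun t w => tlift (fun u v => u ⊗ (v ⊗ w)) t).

Definition tswap (k : fieldType) (V W : lmodType k) : tens V W -> tens W V :=
  tlift (fun v w => w ⊗ v).

(* (a ⊗ b)(c ⊗ d) = (a c) ⊗ (b d) *)
Definition tmul (k : fieldType) (V : lmodType k) (m : V -> V -> V)
    (x y : tens V V) : tens V V :=
  tlift (fun a b => tlift (fun c d => m a c ⊗ m b d) y) x.

Record hopf_data (k : fieldType) := HopfData {
  hcarrier :> lmodType k;
  hmul : hcarrier -> hcarrier -> hcarrier;
  hone : hcarrier;
  hcomul : hcarrier -> tens hcarrier hcarrier;
  hcounit : hcarrier -> k
}.
Arguments hone {k}.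

Record is_bialgebra (k : fieldType) (H : hopf_data k) : Prop := IsBialgebra {
  hmul_bilin : bilin (@hmul k H);
  hmulA : associative (@hmul k H);
  hmul1l : left_id (hone H) (@hmul k H);
  hmul1r : right_id (hone H) (@hmul k H);
  hcomul_linear : linear (@hcomul k H);
  hcounit_linear : scalar (@hcounit k H);
  hcomulA : forall x : H,
    tassoc (tmap (@hcomul k H) id (hcomul x)) = tmap id (@hcomul k H) (hcomul x);
  hcounit_l : forall x : H, tlift (fun a b => hcounit a *: b) (hcomul x) = x;
  hcounit_r : forall x : H, tlift (fun a b => hcounit b *: a) (hcomul x) = x;
  hcomulM : forall x y : H,
    hcomul (hmul x y) = tmul (@hmul k H) (hcomul x) (hcomul y);
  hcomul1 : hcomul (hone H) = hone H ⊗ hone H;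
  hcounitM : forall x y : H, hcounit (hmul x y) = hcounit x * hcounit y;
  hcounit1 : hcounit (hone H) = 1
}.

Record is_antipode (k : fieldType) (H : hopf_data k) (S : H -> H) : Prop :=
  IsAntipode {
    antipode_linear : linear S;
    antipode_l : forall x : H,
      tlift (@hmul k H) (tmap S id (hcomul x)) = hcounit x *: hone H;
    antipode_r : forall x : H,
      tlift (@hmul k H) (tmap id S (hcomul x)) = hcounit x *: hone H
  }.

Definition is_hopf (k : fieldType) (H : hopf_data k) : Prop :=
  is_bialgebra H /\ exists S : H -> H, is_antipode S.

Definition cocommutative (k : fieldType) (H : hopf_data k) : Prop :=
  forall x : H, tswap (hcomul x) = hcomul x.

Record is_hopf_morphism (k : fieldType) (H K : hopf_data k) (f : H -> K) :
    Prop := IsHopfMorphism {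
  hopf_source : is_hopf H;
  hopf_target : is_hopf K;
  hmorph_linear : linear f;
  hmorphM : forall x y : H, f (hmul x y) = hmul (f x) (f y);
  hmorph1 : f (hone H) = hone K;
  hmorph_comul : forall x : H, hcomul (f x) = tmap f f (hcomul x);
  hmorph_counit : forall x : H, hcounit (f x) = hcounit x;
  hmorph_antipode : forall (S : H -> H) (T : K -> K),
    is_antipode S -> is_antipode T -> forall x : H, f (S x) = T (f x)
}.

Record composition := Composition {
  parts :> seq nat;
  _ : all (ltn 0) parts
}.
HB.instance Definition _ := [isSub for parts].
HB.instance Definition _ := [Countable of composition by <:].

Definition hat (s : seq nat) : composition :=
  @Composition [seq a <- s | (0 < a)%N] (filter_all _ _).

(* Row and column 0 carry the excesses n - q and n - p.  Every entry is at
   most a row sum, hence at most n as soon as q <= n, so restricting the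
   entries to 'I_n.+1 loses nothing in the range where the set is used. *)
Definition heis_mx (n : nat) (al be : composition) :
    {set 'M['I_n.+1]_((size be).+1, (size al).+1)} :=
  [set M : 'M['I_n.+1]_((size be).+1, (size al).+1) |
    [&& M ord0 ord0 == 0%N :> nat,
        [forall j, \sum_i (M i j : nat)
                   == nth 0 ((n - sumn al)%N :: al) j]%N
      & [forall i, \sum_j (M i j : nat)
                   == nth 0 ((n - sumn be)%N :: be) i]%N]].

Definition mx_comp (n s r : nat) (M : 'M['I_n]_(s, r)) : composition :=
  hat [seq (M i j : nat) | i <- enum 'I_s, j <- enum 'I_r].

Definition mx_part (n s r : nat) (M : 'M['I_n]_(s, r)) : seq nat :=
  sort geq (mx_comp M).

(* Symmetric functions: power series of bounded degree in x_0, x_1, ...,    *)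
(* invariant under all permutations of the variables                        *)

Local Notation mon := {cmonom nat}.

Definition symmetric_series (k : fieldType) (f : mon -> k^o) : Prop :=
  forall (s : nat -> nat) (m m' : mon),
    bijective s -> (forall i, m' i = m (s i)) -> f m' = f m.

Definition bounded_series (k : fieldType) (f : mon -> k^o) : Prop :=
  exists d : nat, forall m : mon, (d < mdeg m)%N -> f m = 0.

Definition symf_pred (k : fieldType) : {pred mon -> k^o} :=
  fun f => `[< symmetric_series f /\ bounded_series f >].

Section SymFun.
Context (k : fieldType).

Fact symf_closed : submod_closed (@symf_pred k).
Proof.
split; first by apply/asboolP; split=> //; exists 0%N.
move=> a f g /asboolP[fS [d fd]] /asboolP[gS [e ge]]; apply/asboolP; split.
  by move=> s m m' sb mE; rewrite !fctE (fS s m) // (gS s m).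
exists (maxn d e) => m; rewrite gtn_max => /andP[dm em].
by rewrite !fctE fd // ge // scaler0 addr0.
Qed.
HB.instance Definition _ :=
  GRing.isSubmodClosed.Build k (mon -> k^o) (@symf_pred k) symf_closed.

Record symf := Symf { series :> mon -> k^o; _ : series \in @symf_pred k }.
HB.instance Definition _ := [isSub for series].
HB.instance Definition _ := [Choice of symf by <:].
HB.instance Definition _ := [SubChoice_isSubLmodule of symf by <:].

Fact symfP (f : symf) : symmetric_series f /\ bounded_series f.
Proof. by case: f => f /= /asboolP. Qed.

Definition mon_perm (s t : nat -> nat) (m : mon) : mon :=
  [cmonom m (s i) | i in [fset t j | j in finsupp m]%fset]%M.

Fact mon_permE s t m i : cancel s t -> mon_perm s t m i = m (s i).
Proof.
move=> sK; rewrite /mon_perm cmE /= fsfunE.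
case: ifPn => // /imfsetP iN; case: (finsuppP m (s i)) => // si.
by case: iN; exists (s i) => //; rewrite sK.
Qed.

Fact mdeg_perm s (m m' : mon) :
  bijective s -> (forall i, m' i = m (s i)) -> mdeg m' = mdeg m.
Proof.
move=> [t sK tK] mE; rewrite !mdegE.
rewrite [RHS](perm_big [seq s i | i <- finsupp m']) /=; last first.
  apply: uniq_perm => //; first by rewrite (map_inj_uniq (can_inj sK)).
  move=> i; apply/idP/mapP => [im|[j jm' ->]].
    by exists (t i); rewrite ?tK // mem_finsupp mE tK -mem_finsupp.
  by rewrite mem_finsupp -mE -mem_finsupp.
by rewrite big_map; apply: eq_bigr => i _; rewrite mE.
Qed.

Definition series_mul (f g : mon -> k^o) : mon -> k^o := fun m =>
  \sum_(p \in [set p : mon * mon | mmul p.1 p.2 = m]%classic) f p.1 * g p.2.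

Fact series_mul_symf (f g : symf) : series_mul f g \in @symf_pred k.
Proof.
have [fS [d fd]] := symfP f; have [gS [e ge]] := symfP g.
apply/asboolP; split.
  move=> s m m' [t sK tK] mE; apply/esym; rewrite /series_mul.
  pose P (a : nat -> nat) b (p : mon * mon) := (mon_perm a b p.1, mon_perm a b p.2).
  have PK a b : cancel a b -> cancel b a -> cancel (P a b) (P b a).
    by move=> aK bK [u v]; congr (_, _); apply/eqP/cmP => i /=;
      rewrite !mon_permE ?aK ?bK.
  have sb : bijective s by exists t.
  rewrite (reindex_fsbig (P t s) [set p | mmul p.1 p.2 = m']%classic) /=.
    apply: eq_fsbigr => -[u v] _ /=; congr (_ * _).
      by apply: (fS t); [exists s | move=> i; rewrite mon_permE].
    by apply: (gS t); [exists s | move=> i; rewrite mon_permE].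
  split=> [[u v] /= uvE|p q _ _|[u v] /= uvE].
  - apply/eqP/cmP => i; rewrite cmM !mon_permE // -[i in RHS]tK -mE -uvE.
    by rewrite cmM.
  - exact: (can_inj (PK _ _ tK sK)).
  - exists (P s t (u, v)); last exact: PK.
    by apply/eqP/cmP => i /=; rewrite mE -uvE !cmM !mon_permE.
exists (d + e)%N => m dem; rewrite /series_mul fsbig1 // => -[u v] /= uvE.
have := dem; rewrite -uvE mdegM; case: (ltnP d (mdeg u)) => [/fd -> _|ud].
  by rewrite mul0r.
case: (ltnP e (mdeg v)) => [/ge -> _|ve]; first by rewrite mulr0.
by rewrite ltnNge leq_add.
Qed.
Definition symf_mul (f g : symf) : symf := Symf (series_mul_symf f g).

Fact symf_h_subproof (a : nat) :
  (fun m : mon => (mdeg m == a)%:R : k^o) \in @symf_pred k.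
Proof.
apply/asboolP; split=> [s m m' sb mE|]; first by rewrite (mdeg_perm sb mE).
by exists a => m am; rewrite gtn_eqF.
Qed.
Definition symf_h1 (a : nat) : symf := Symf (symf_h_subproof a).

(* h_0 = 1; see symf_oneE *)
Definition symf_one : symf := symf_h1 0.

Lemma symf_oneE (m : mon) : symf_one m = (m == mone)%:R.
Proof. by rewrite /= mdeg_eq0. Qed.

Definition symf_h (s : seq nat) : symf :=
  foldr symf_mul symf_one [seq symf_h1 a | a <- s].

End SymFun.

(* The structure maps below are introduced by their defining properties:
   [xget x0 P] is an element of P if there is one, and x0 otherwise.  Since the
   h_alpha span the symmetric functions and the X_alpha span Sigma, at most one
   map has each property.  The default value is always the zero map, which
   satisfies neither the unit nor the counit laws. *)

Section Lambda.
Context (k : fieldType).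
Local Notation L := (symf k).

Definition Lambda_mul_spec (m : L -> L -> L) : Prop :=
  bilin m /\ forall al be : composition,
    m (symf_h k al) (symf_h k be) =
      \sum_(maxn (sumn al) (sumn be) <= n < (sumn al + sumn be).+1)
        \sum_(M in heis_mx n al be) symf_h k (mx_part M).

Definition Lambda_comul_spec (D : L -> tens L L) : Prop :=
  [/\ linear D,
      D (symf_one k) = symf_one k ⊗ symf_one k,
      forall f g, D (symf_mul f g) = tmul (@symf_mul k) (D f) (D g)
    & forall a : nat, D (symf_h1 k a) =
        \sum_(i < a.+1) symf_h1 k i ⊗ symf_h1 k (a - i)].

Definition Lambda_counit (f : L) : k := f mone.

Definition Lambda : hopf_data k := {|
  hcarrier := L;
  hmul := xget (fun _ _ => 0) Lambda_mul_spec;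
  hone := symf_one k;
  hcomul := xget (fun _ => 0) Lambda_comul_spec;
  hcounit := Lambda_counit
|}.

End Lambda.

(* Positions are numbered from 1, as in the definition of Des. *)
Definition Des (n : nat) (s : 'S_n) : seq nat :=
  [seq j.+1 | j : 'I_n <- enum 'I_n &
     [exists l : 'I_n, (l == j.+1 :> nat) && (s l < s j)%N]].

Definition psums (al : seq nat) : seq nat :=
  [seq sumn (take i al) | i <- iota 1 (size al).-1].

(* The direct sum over n of the spaces k S_n. *)
Notation symgrp_alg k := {malg k[{n : nat & 'S_n}]}.

Definition X_elt (k : fieldType) (al : composition) : symgrp_alg k :=
  \sum_(s : 'S_(sumn al) | all (mem (psums al)) (Des s))
    << Tagged (fun n => 'S_n) s >>.

Definition Sigma_pred (k : fieldType) : {pred symgrp_alg k} :=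
  fun x => `[< exists s : seq (k * composition),
                 x = \sum_(p <- s) p.1 *: X_elt k p.2 >].

Section Sigma.
Context (k : fieldType).

Fact Sigma_closed : submod_closed (@Sigma_pred k).
Proof.
split; first by apply/asboolP; exists [::]; rewrite big_nil.
move=> a x y /asboolP[s ->] /asboolP[t ->]; apply/asboolP.
exists ([seq (a * p.1, p.2) | p <- s] ++ t).
rewrite big_cat; congr (_ + _); rewrite big_map [LHS]scaler_sumr.
by apply: eq_bigr => p _; rewrite [LHS]scalerA.
Qed.
HB.instance Definition _ :=
  GRing.isSubmodClosed.Build k (symgrp_alg k) (@Sigma_pred k) Sigma_closed.

Record descent_space := DescentSpace {
  dsval :> symgrp_alg k;
  _ : dsval \in @Sigma_pred k
}.
HB.instance Definition _ := [isSub for dsval].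
HB.instance Definition _ := [Choice of descent_space by <:].
HB.instance Definition _ := [SubChoice_isSubLmodule of descent_space by <:].

Fact X_subproof (al : composition) : X_elt k al \in @Sigma_pred k.
Proof.
by apply/asboolP; exists [:: (1, al)]; rewrite big_seq1 scale1r.
Qed.
Definition X (al : composition) : descent_space := DescentSpace (X_subproof al).

Local Notation S := descent_space.

Definition Sigma_mul_spec (m : S -> S -> S) : Prop :=
  bilin m /\ forall al be : composition,
    m (X al) (X be) =
      \sum_(maxn (sumn al) (sumn be) <= n < (sumn al + sumn be).+1)
        \sum_(M in heis_mx n al be) X (mx_comp M).

Definition Sigma_comul_spec (D : S -> tens S S) : Prop :=
  linear D /\ forall al : composition,
    D (X al) =
      \sum_(b : {ffun 'I_(size al) -> 'I_(sumn al).+1} |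
              [forall i, (b i <= nth 0 al i)%N])
        X (hat [seq (b i : nat) | i : 'I_(size al) <- enum 'I_(size al)])
        ⊗ X (hat [seq (nth 0 al i - b i)%N | i : 'I_(size al) <- enum 'I_(size al)]).

(* The projection onto the degree 0 component k S_0 = k. *)
Definition Sigma_counit (x : S) : k :=
  (dsval x)@_(Tagged (fun n => 'S_n) (1%g : 'S_0)).

Definition Sigma : hopf_data k := {|
  hcarrier := S;
  hmul := xget (fun _ _ => 0) Sigma_mul_spec;
  hone := X (hat [::]);
  hcomul := xget (fun _ => 0) Sigma_comul_spec;
  hcounit := Sigma_counit
|}.

Definition pi_spec (f : Sigma -> Lambda k) : Prop :=
  linear f /\ forall al : composition, f (X al) = symf_h k al.

Definition pi_map : Sigma -> Lambda k := xget (fun _ => 0) pi_spec.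

End Sigma.

(* Main.v *)
(* Let X_a, for a finite ordered index set I and a : I -> nat, stand for the basis
   element of the composition obtained from the word of a by omitting zeros.  With
   base points i0, j0 added to the index sets, X_a # X_b is the sum of the X_P over
   all arrays P on J x I with P (j0, i0) = 0 and with the non-base column and row
   sums prescribed by a and b; rows and columns of zeros do not matter.  Hence both
   bracketings of a triple product sum X_P over the same three-dimensional arrays,
   and multiplicativity of the coproduct amounts to splitting an array as a sum of
   two arrays.  The same formulas hold with h_a in place of X_a, so the bialgebra
   axioms are proved once for both Sigma and Lambda.  The coproduct preserves the
   degree, which makes eta eps - id locally nilpotent for convolution: its geometric
   series is the antipode (Takeuchi).

   The structure maps of Sigma exist because the X_alpha are linearly independent:
   evaluate at permutations with a given descent set.  On Lambda, in characteristic
   zero, the h_alpha span: Newton's identities express the power sums p_a, and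
   p_a m_l = mult * m_(a :: l) + (terms supported on monomials in fewer variables)
   yields the monomial functions m_l.  A spanning family of the right cardinality is
   a basis, so the only relations between the h_alpha come from permuting parts, and
   the formulas for # and Delta are invariant under such permutations. *)

Require Import Defs.
From HB Require Import structures.
From mathcomp Require Import all_boot all_order all_algebra all_fingroup.
From mathcomp Require Import finmap.
From mathcomp Require Import boolp classical_sets functions cardinality fsbigop.
From mathcomp Require Import monalg.

Set Implicit Arguments.
Unset Strict Implicit.
Unset Printing Implicit Defensive.

Import GRing.Theory.
Local Open Scope ring_scope.

(** * Linear maps, spanning families and tensors *)

(** The structure maps are picked by choice from their specifications, so nothing is known about
    them until some map meeting each specification has been built. Everything used about them
    afterwards is collected in [heis_basis], which asks the family [B] to span but not to be
    independent: on [Lambda] the compositions index each [h] once per ordering of its parts, so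
    independence would be false there.

    The sums in the definitions run over ordinals attached to a composition, with entries bounded by
    the running index [n]. Neither feature survives iteration, since the terms of a product are
    words indexed by pairs and each has its own size. Arrays therefore live on arbitrary finite
    types with one entry bound [N], and every large enough [N] gives the same sum, so that both
    sides of an identity can share it.

    Characteristic zero enters at a single place, the division by the multiplicity
    [count_mem a (a :: s)]. Newton's identities are solved for the power sum, whose coefficient is
    one. *)

Section LinearFacts.
Context (k : fieldType).
Implicit Types U V W : lmodType k.

Lemma lin0 U V (f : U -> V) : linear f -> f 0 = 0.
Proof. by move=> lf; have := lf (-1) 0 0; rewrite !scaleN1r oppr0 addr0 addNr. Qed.

Lemma linZ U V (f : U -> V) a x : linear f -> f (a *: x) = a *: f x.
Proof. by move=> lf; have := lf a x 0; rewrite (lin0 lf) !addr0. Qed.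

Lemma linD U V (f : U -> V) x y : linear f -> f (x + y) = f x + f y.
Proof. by move=> lf; have := lf 1 x y; rewrite !scale1r. Qed.

Lemma linB U V (f : U -> V) x y : linear f -> f (x - y) = f x - f y.
Proof. by move=> lf; rewrite -scaleN1r linD // linZ // scaleN1r. Qed.

Lemma lin_sum U V (f : U -> V) I (r : seq I) (P : pred I) F : linear f ->
  f (\sum_(i <- r | P i) F i) = \sum_(i <- r | P i) f (F i).
Proof.
by move=> lf; apply: (big_morph f) => [x y|]; [exact: linD | exact: lin0].
Qed.

Lemma lin_comp U V W (f : V -> W) (g : U -> V) :
  linear f -> linear g -> linear (fun x => f (g x)).
Proof. by move=> lf lg a x y; rewrite lg lf. Qed.

Lemma lin_id U : linear (@id U).
Proof. by []. Qed.

Lemma bilin_suml U V W (m : U -> V -> W) I (r : seq I) (P : pred I) F v :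
  bilin m -> m (\sum_(i <- r | P i) F i) v = \sum_(i <- r | P i) m (F i) v.
Proof. by case=> ml _; rewrite (lin_sum _ _ _ (ml v)). Qed.

Lemma bilin_sumr U V W (m : U -> V -> W) I (r : seq I) (P : pred I) F u :
  bilin m -> m u (\sum_(i <- r | P i) F i) = \sum_(i <- r | P i) m u (F i).
Proof. by case=> _ mr; rewrite (lin_sum _ _ _ (mr u)). Qed.

Lemma bilin_comp U V W U' V' (m : U -> V -> W) (f : U' -> U) (g : V' -> V) :
  bilin m -> linear f -> linear g -> bilin (fun x y => m (f x) (g y)).
Proof.
move=> [ml mr] lf lg; split=> [v|u] a x y; first by rewrite lf ml.
by rewrite lg mr.
Qed.

Definition spanning U (I : choiceType) (b : I -> U) :=
  forall u, exists x : {malg k[I]}, u = malg_lift b x.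

Lemma span_ext U V (I : choiceType) (b : I -> U) (f g : U -> V) :
  spanning b -> linear f -> linear g -> (forall i, f (b i) = g (b i)) -> f =1 g.
Proof.
move=> sb lf lg fg u; have [x ->] := sb u.
rewrite /malg_lift (lin_sum _ _ _ lf) (lin_sum _ _ _ lg).
by apply: eq_bigr => i _; rewrite (linZ _ _ lf) (linZ _ _ lg) fg.
Qed.

(** Coordinates of every vector in the family [b] are picked by choice. Since each linear relation
    among the [b i] also holds among the [phi i], the resulting value does not depend on the pick,
    and linearity follows. *)
Lemma span_extend U V (I : choiceType) (b : I -> U) (phi : I -> V) :
  spanning b -> (forall x, malg_lift b x = 0 -> malg_lift phi x = 0) ->
  exists2 F : U -> V, linear F & forall i, F (b i) = phi i.
Proof.
move=> sb b0; have /choice[c cE] := sb.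
have E x y : malg_lift b x = malg_lift b y -> malg_lift phi x = malg_lift phi y.
  move=> exy; apply/eqP; rewrite -subr_eq0 -(linB _ _ (malg_lift_linear phi)).
  by rewrite b0 // (linB _ _ (malg_lift_linear b)) exy subrr.
exists (fun u => malg_lift phi (c u)) => [a x y|i]; last first.
  by rewrite -[RHS](malg_liftU phi); apply: E; rewrite -cE malg_liftU.
rewrite -[RHS](malg_lift_linear phi); apply: E.
by rewrite -cE [RHS](malg_lift_linear b) -!cE.
Qed.

(** One variable at a time: for fixed [i] the row [phi i] extends to a map [F i], and then
    [i |-> F i] is extended with values in the space of all functions [V -> W]. *)
Lemma span_extend2 U V W (I J : choiceType) (b : I -> U) (c : J -> V)
    (phi : I -> J -> W) :
  spanning b -> spanning c ->
  (forall j x, malg_lift b x = 0 -> malg_lift (phi^~ j) x = 0) ->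
  (forall i x, malg_lift c x = 0 -> malg_lift (phi i) x = 0) ->
  exists2 m : U -> V -> W, bilin m & forall i j, m (b i) (c j) = phi i j.
Proof.
move=> sb sc b0 c0.
have /choice[F FP] i : exists F : V -> W,
    linear F /\ forall j, F (c j) = phi i j.
  by have [F] := span_extend sc (c0 i); exists F.
have [|m lm mE] := @span_extend U (V -> W) I b F sb.
  move=> x x0.
  have lE v : malg_lift F x v = malg_lift (F^~ v) x.
    by rewrite /malg_lift fct_sumE; apply: eq_bigr.
  apply/funext => v; rewrite lE; move: v.
  apply: (@span_ext V W J c _ (fun=> 0)) => //.
  - move=> a u v; rewrite /malg_lift scaler_sumr -big_split.
    by apply: eq_bigr => i _; rewrite (FP i).1 scalerDr !scalerA mulrC.
  - by move=> a u v; rewrite scaler0 addr0.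
  - move=> j; rewrite -[RHS](b0 j x x0); apply: eq_bigr => i _.
    by rewrite (FP i).2.
exists m => [|i j]; last by rewrite mE (FP i).2.
split=> [v a x y|u]; first by rewrite lm.
(* The extension lands in arbitrary functions, so linearity in the second variable must be
   recovered: [m u] is a combination of the linear maps [F i]. *)
have [x ->] := sb u; rewrite /malg_lift => a v w.
rewrite (lin_sum _ _ _ lm) !fct_sumE scaler_sumr -big_split.
apply: eq_bigr => i _; rewrite (linZ _ _ lm) mE /= !fctE (FP i).1.
by rewrite scalerDr !scalerA mulrC.
Qed.

End LinearFacts.

(** * Linear maps out of tensor products, determined on pure tensors *)

Section TensorFacts.
Context (k : fieldType).
Implicit Types U V W : lmodType k.

Lemma tens_ext V W U (f g : tens V W -> U) :
  linear f -> linear g -> (forall v w, f (v ⊗ w) = g (v ⊗ w)) -> f =1 g.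
Proof.
move=> lf lg fg t; have [s ->] := tens_span t.
rewrite (lin_sum _ _ _ lf) (lin_sum _ _ _ lg).
by apply: eq_bigr => p _; rewrite (linZ _ _ lf) (linZ _ _ lg) fg.
Qed.

Lemma tpure_sum V W I J (r : seq I) (s : seq J) (P : pred I) (Q : pred J) F G :
  (\sum_(i <- r | P i) F i : V) ⊗ (\sum_(j <- s | Q j) G j : W)
    = \sum_(i <- r | P i) \sum_(j <- s | Q j) (F i ⊗ G j).
Proof.
rewrite (bilin_suml _ _ _ _ (@tpure_bilin k V W)); apply: eq_bigr => i _.
by rewrite (bilin_sumr _ _ _ _ (@tpure_bilin k V W)).
Qed.

Lemma tmap_bilin V W V' W' (f : V -> V') (g : W -> W') :
  linear f -> linear g -> bilin (fun v w => f v ⊗ g w).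
Proof. exact/bilin_comp/tpure_bilin. Qed.

Lemma tmap_linear V W V' W' (f : V -> V') (g : W -> W') :
  linear f -> linear g -> linear (tmap f g).
Proof. by move=> lf lg; apply/tlift_linear/tmap_bilin. Qed.

Lemma tmap_pure V W V' W' (f : V -> V') (g : W -> W') v w :
  linear f -> linear g -> tmap f g (v ⊗ w) = f v ⊗ g w.
Proof. by move=> lf lg; apply/tlift_pure/tmap_bilin. Qed.

(** Needed because [tassoc] and [tmul] are nested lifts: for the outer lift to be meaningful, the
    inner one has to depend linearly on its parameters. *)
Lemma tlift_fun_linear V W U (T : lmodType k) (B : T -> V -> W -> U) :
  (forall t, bilin (B t)) -> (forall v w, linear (fun t => B t v w)) ->
  forall x, linear (fun t => tlift (B t) x).
Proof.
move=> bB lB x a s t; move: x; apply: tens_ext.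
- exact: tlift_linear.
- move=> b x y; rewrite !(tlift_linear (bB _)) !scalerDr !scalerA mulrC.
  by rewrite addrACA.
- by move=> v w; rewrite !(tlift_pure (bB _)) lB.
Qed.

Lemma tassoc_bilin1 U V W w :
  bilin (fun (u : U) (v : V) => u ⊗ (v ⊗ w : tens V W)).
Proof.
exact: (bilin_comp (tpure_bilin U (tens V W)) (@lin_id _ U)
  ((tpure_bilin V W).1 w)).
Qed.

Lemma tassoc_bilin U V W :
  bilin (fun (t : tens U V) (w : W) => tlift (fun u v => u ⊗ (v ⊗ w)) t).
Proof.
split=> [w|t]; first exact/tlift_linear/tassoc_bilin1.
apply: tlift_fun_linear => [w|u v]; first exact: tassoc_bilin1.
by move=> a x y; rewrite (tpure_bilin _ _).2 (tpure_bilin _ _).2.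
Qed.

Lemma tassoc_linear U V W : linear (@tassoc k U V W).
Proof. exact/tlift_linear/tassoc_bilin. Qed.

Lemma tassoc_pure U V W (u : U) (v : V) (w : W) :
  tassoc ((u ⊗ v) ⊗ w) = u ⊗ (v ⊗ w).
Proof.
by rewrite /tassoc (tlift_pure (@tassoc_bilin U V W)) (tlift_pure (tassoc_bilin1 _ _ w)).
Qed.

Lemma tswap_bilin V W : bilin (fun (v : V) (w : W) => w ⊗ v).
Proof. by have [l r] := tpure_bilin W V; split. Qed.

Lemma tswap_linear V W : linear (@tswap k V W).
Proof. exact/tlift_linear/tswap_bilin. Qed.

Lemma tswap_pure V W (v : V) (w : W) : tswap (v ⊗ w) = w ⊗ v.
Proof. exact/(tlift_pure (@tswap_bilin V W)). Qed.

Section Tmul.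
Context (V : lmodType k) (m : V -> V -> V) (bm : bilin m).

Lemma tmul_bilin1 a b : bilin (fun c d => m a c ⊗ m b d).
Proof. by apply: tmap_bilin; exact: bm.2. Qed.

Lemma tmul_bilin2 y :
  bilin (fun a b => tlift (fun c d => m a c ⊗ m b d) y).
Proof.
split=> [b|a]; apply: tlift_fun_linear => [t|c d]; try exact: tmul_bilin1.
  by move=> e x z; rewrite bm.1 (tpure_bilin _ _).1.
by move=> e x z; rewrite bm.1 (tpure_bilin _ _).2.
Qed.

Lemma tmul_bilin : bilin (tmul m).
Proof.
split=> [y|x]; first exact/tlift_linear/tmul_bilin2.
apply: tlift_fun_linear => [y|a b]; first exact: tmul_bilin2.
exact/tlift_linear/tmul_bilin1.
Qed.

Lemma tmul_pure a b c d : tmul m (a ⊗ b) (c ⊗ d) = m a c ⊗ m b d.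
Proof. by rewrite /tmul (tlift_pure (tmul_bilin2 _)) (tlift_pure (tmul_bilin1 a b)). Qed.

End Tmul.
End TensorFacts.

(** * Sums over arrays with prescribed margins *)

Section Words.
Implicit Types I J : finType.

Definition word I (a : I -> nat) : seq nat := [seq a i | i <- enum I].

(** Says that [f] is injective and increasing for the enumeration orders, in the form in which it
    rewrites words. *)
Definition order_emb I' I (f : I' -> I) :=
  [seq i <- enum I | i \in codom f] = [seq f i | i <- enum I'].

Definition pair_map I' I J' J (g : J' -> J) (f : I' -> I) (q : J' * I') : J * I :=
  (g q.1, f q.2).

Lemma pair_map_inj I' I J' J (g : J' -> J) (f : I' -> I) :
  injective g -> injective f -> injective (pair_map g f).
Proof. by move=> gI fI [j i] [j' i'] [/gI-> /fI->]. Qed.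

Lemma codom_pair_map I' I J' J (g : J' -> J) (f : I' -> I) p :
  (p \in codom (pair_map g f)) = (p.1 \in codom g) && (p.2 \in codom f).
Proof.
apply/codomP/andP => [[[j i] ->]|[/codomP[j jE] /codomP[i iE]]].
  by split; exact: codom_f.
by exists (j, i); rewrite /pair_map /= -jE -iE -surjective_pairing.
Qed.

Lemma enum_pair I J :
  enum {: J * I} = [seq (j, i) | j <- enum J, i <- enum I].
Proof. by set s := RHS; rewrite enumT unlock. Qed.

Lemma filter_allpairs (S T : Type) (a : pred S) (b : pred T) s t :
  [seq p <- [seq (x, y) | x <- s, y <- t] | a p.1 && b p.2] =
  [seq (x, y) | x <- [seq x <- s | a x], y <- [seq y <- t | b y]].
Proof.
elim: s => //= x s IH; rewrite filter_cat IH filter_map.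
case: ifP => ax /=; first by congr (map _ _ ++ _); apply: eq_filter => y /=; rewrite ax.
by rewrite (eq_filter (_ : _ =1 pred0)) ?filter_pred0 // => y /=; rewrite ax.
Qed.

Lemma pair_map_order_emb I' I J' J (g : J' -> J) (f : I' -> I) :
  order_emb g -> order_emb f -> order_emb (pair_map g f).
Proof.
move=> go fo; rewrite /order_emb (eq_filter (codom_pair_map g f)) !enum_pair.
rewrite (filter_allpairs (fun j => j \in codom g) (fun i => i \in codom f)).
rewrite go fo allpairs_mapl allpairs_mapr map_allpairs.
by apply: eq_allpairs.
Qed.

Lemma hat_inj s t : [seq a <- s | 0 < a]%N = [seq a <- t | 0 < a]%N ->
  hat s = hat t.
Proof. by move=> st; apply/val_inj. Qed.

Lemma hat_hat s : hat (hat s) = hat s.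
Proof. by apply: hat_inj; rewrite filter_id. Qed.

Lemma hat_comp (al : composition) : hat al = al.
Proof. by apply/val_inj => /=; case: al => s /= /all_filterP. Qed.

Lemma map_pos_filter (T : Type) (a : T -> nat) s :
  [seq x <- [seq a i | i <- s] | 0 < x]%N = [seq a i | i <- s & (0 < a i)%N].
Proof. by rewrite filter_map. Qed.

(** Entries outside the image of [f] are zeros, which [hat] deletes, and [order_emb] keeps the
    others in their order. *)
Lemma hat_word_emb I' I (f : I' -> I) (a : I -> nat) :
  order_emb f -> (forall i, i \notin codom f -> a i = 0%N) ->
  hat (word a) = hat (word (a \o f)).
Proof.
move=> fo a0; apply: hat_inj; rewrite /word [in RHS](map_comp a f) -fo.
rewrite !map_pos_filter -[in RHS]filter_predI.
congr [seq a i | i <- _]; apply: eq_filter => i /=.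
by case: (boolP (i \in codom f)) => [|/a0 ->]; rewrite ?andbT.
Qed.

(** Without monotonicity the reading order is lost. This version serves the functions [h], which
    ignore the order of the parts. *)
Lemma perm_word_emb I' I (f : I' -> I) (a : I -> nat) :
  injective f -> (forall i, i \notin codom f -> a i = 0%N) ->
  perm_eq (hat (word a)) (hat (word (a \o f))).
Proof.
move=> fI a0; rewrite /= /word [in X in perm_eq _ X](map_comp a f).
have -> : [seq x <- [seq a i | i <- enum I] | 0 < x]%N =
    [seq x <- [seq a i | i <- [seq i <- enum I | i \in codom f]] | 0 < x]%N.
  rewrite !map_pos_filter -[in RHS]filter_predI.
  congr [seq a i | i <- _]; apply: eq_filter => i /=.
  by case: (boolP (i \in codom f)) => [|/a0 ->]; rewrite ?andbT.
apply/perm_filter/perm_map/uniq_perm.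
- exact/filter_uniq/enum_uniq.
- by rewrite map_inj_uniq ?enum_uniq.
- by move=> i; rewrite mem_filter mem_enum andbT.
Qed.

Lemma word_ord n s : size s = n -> word (fun i : 'I_n => nth 0%N s i) = s.
Proof.
move=> <-; rewrite /word (map_comp (nth 0%N s) val) val_enum_ord.
exact: mkseq_nth.
Qed.

Lemma word_cons n s : size s = n ->
  word (fun i : 'I_n.+1 => nth 0%N (0%N :: s) i) = 0%N :: s.
Proof. by move=> sn; apply: word_ord; rewrite /= sn. Qed.

End Words.

Section BigEmb.
Implicit Types I J : finType.

Lemma big_codom (V : nmodType) I' I (f : I' -> I) (G : I -> V) :
  injective f -> (forall i, i \notin codom f -> G i = 0) ->
  \sum_i G i = \sum_i' G (f i').
Proof.
move=> fI G0; rewrite (bigID (mem (codom f))) /= [X in _ + X]big1 // addr0.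
rewrite -big_filter -[index_enum I]enumT.
rewrite -[RHS](big_map f xpredT G); apply: perm_big; apply: uniq_perm.
- exact/filter_uniq/enum_uniq.
- by rewrite map_inj_uniq // index_enum_uniq.
- move=> i; rewrite mem_filter mem_enum andbT; apply/codomP/mapP => -[x].
    by move=> ->; exists x; rewrite ?mem_index_enum.
  by move=> _ ->; exists x.
Qed.

Definition emb_ext (V : Type) (v0 : V) I' I (f : I' -> I) (a : I' -> V) (i : I) :=
  if [pick i' | f i' == i] is Some i' then a i' else v0.

Lemma emb_extE (V : Type) (v0 : V) I' I (f : I' -> I) a i' :
  injective f -> emb_ext v0 f a (f i') = a i'.
Proof.
by move=> fI; rewrite /emb_ext; case: pickP => [x /eqP/fI->|/(_ i')/eqP].
Qed.

Lemma emb_ext0 (V : Type) (v0 : V) I' I (f : I' -> I) a i :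
  i \notin codom f -> emb_ext v0 f a i = v0.
Proof.
rewrite /emb_ext; case: pickP => [x /eqP <-|//]; by rewrite codom_f.
Qed.

End BigEmb.

(** * Changing the index set in sums over splittings *)

Section Splits.
Context (V : nmodType).
Implicit Types I J : finType.

(** A splitting vanishes wherever [a] does, so extension by zero and restriction along [f] are
    mutually inverse. The bounds [K] and [K'] only have to dominate [a], which frees the coproduct
    formula from its bound [sumn al]. *)
Lemma sum_splits_emb I' I (f : I' -> I) (K' K : nat) (a : I -> nat)
    (F : (I -> nat) -> V) (F' : (I' -> nat) -> V) :
  injective f -> (forall i, i \notin codom f -> a i = 0%N) ->
  (forall i, a i <= K)%N -> (forall i, a (f i) <= K')%N ->
  (forall b : I -> nat, (forall i, b i <= a i)%N -> F b = F' (b \o f)) ->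
  (forall b b' : I' -> nat, b =1 b' -> F' b = F' b') ->
  \sum_(b : {ffun I -> 'I_K.+1} | [forall i, b i <= a i]%N) F (fun i => b i) =
  \sum_(b : {ffun I' -> 'I_K'.+1} | [forall i, b i <= a (f i)]%N)
     F' (fun i => b i).
Proof.
move=> fI a0 aK aK' FF' F'e.
pose h (b : {ffun I' -> 'I_K'.+1}) : {ffun I -> 'I_K.+1} :=
  [ffun i => inord (emb_ext 0%N f (fun i' => b i' : nat) i)].
pose h' (b : {ffun I -> 'I_K.+1}) : {ffun I' -> 'I_K'.+1} :=
  [ffun i => inord (b (f i))].
have hf (b : {ffun I' -> 'I_K'.+1}) i : [forall i, b i <= a (f i)]%N -> h b (f i) = b i :> nat.
  move=> /forallP ba; rewrite ffunE emb_extE // inordK // ltnS.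
  exact/(leq_trans (ba _))/aK.
have h0 b i : i \notin codom f -> h b i = 0%N :> nat.
  by move=> iN; rewrite ffunE emb_ext0 // inordK.
rewrite (reindex_onto h h') /=; last first.
  move=> b /forallP ba; apply/ffunP => i; apply/val_inj.
  case: (boolP (i \in codom f)) => [/codomP[j ->]|iN]; last first.
    by rewrite /= h0 //; have := ba i; rewrite a0 // leqn0 => /eqP.
  rewrite /= ffunE emb_extE // ffunE.
  by rewrite [in X in inord X]inordK ?inord_val // ltnS (leq_trans (ba _)).
apply: eq_big => [b|b].
  apply/andP/idP => [[/forallP ba /eqP bE]|bE].
    apply/forallP => i; have := ba (f i); rewrite -{2}bE [h' _ _]ffunE.
    by move=> hb; rewrite inordK // ltnS (leq_trans hb).
  have /forallP ba := bE; split.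
    apply/forallP => i; case: (boolP (i \in codom f)) => [/codomP[j ->]|iN].
      by rewrite hf.
    by rewrite h0.
  by apply/eqP/ffunP => i; apply/val_inj; rewrite ffunE hf //= inord_val.
move=> /andP[/forallP ba /eqP bE]; rewrite FF' //; apply: F'e => i /=.
rewrite -{2}bE [h' _ _]ffunE inordK // ltnS.
exact/(leq_trans (ba _))/aK'.
Qed.

End Splits.

(** * Arrays with prescribed margins *)

Section Fillings.
Implicit Types I J : finType.

(* Fillings of a J x I array whose cell (j0, i0) is empty, with prescribed sums
   along the columns i != i0 and the rows j != j0. *)
Definition filling I J (i0 : I) (j0 : J) (a : I -> nat) (b : J -> nat)
    (P : J * I -> nat) : bool :=
  [&& P (j0, i0) == 0,
      [forall i, (i != i0) ==> (\sum_j P (j, i) == a i)]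
    & [forall j, (j != j0) ==> (\sum_i P (j, i) == b j)]]%N.

Lemma fillingP I J (i0 : I) (j0 : J) a b P :
  reflect [/\ P (j0, i0) = 0%N,
              forall i, i != i0 -> (\sum_j P (j, i) = a i)%N
            & forall j, j != j0 -> (\sum_i P (j, i) = b j)%N]
          (filling i0 j0 a b P).
Proof.
apply: (iffP and3P) => [[/eqP p0 /forallP pa /forallP pb]|[p0 pa pb]].
  split=> // [i|j] /negPf n; [have := pa i | have := pb j];
  by rewrite n => /eqP.
split; first exact/eqP.
  by apply/forallP => i; apply/implyP => /pa/eqP.
by apply/forallP => j; apply/implyP => /pb/eqP.
Qed.

Lemma eq_filling I J (i0 : I) (j0 : J) a a' b b' P P' :
  a =1 a' -> b =1 b' -> P =1 P' ->
  filling i0 j0 a b P = filling i0 j0 a' b' P'.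
Proof.
move=> aa bb PP; rewrite /filling PP; congr [&& _, _ & _].
  by apply: eq_forallb => i; rewrite aa (eq_bigr _ (fun j _ => PP (j, i))).
by apply: eq_forallb => j; rewrite bb (eq_bigr _ (fun i _ => PP (j, i))).
Qed.

Lemma leq_sum1 I (F : I -> nat) i : (F i <= \sum_i F i)%N.
Proof. by rewrite (bigD1 i) //= leq_addr. Qed.

Lemma sum_pairE I J (P : J * I -> nat) :
  (\sum_p P p = \sum_j \sum_i P (j, i))%N.
Proof. by rewrite pair_bigA; apply: eq_bigr => -[]. Qed.

Section FillingSums.
Context I J (i0 : I) (j0 : J) (a : I -> nat) (b : J -> nat) (P : J * I -> nat).
Hypothesis fP : filling i0 j0 a b P.

Lemma filling_sum_row :
  (\sum_p P p = \sum_i P (j0, i) + \sum_(j | j != j0) b j)%N.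
Proof.
have [_ _ pb] := fillingP _ _ _ _ _ fP.
rewrite sum_pairE (bigD1 j0) //=; congr addn; exact: eq_bigr.
Qed.

Lemma filling_sum_col :
  (\sum_p P p = \sum_j P (j, i0) + \sum_(i | i != i0) a i)%N.
Proof.
have [_ pa _] := fillingP _ _ _ _ _ fP.
rewrite sum_pairE exchange_big (bigD1 i0) //=; congr addn; exact: eq_bigr.
Qed.

(** The corner being empty, each entry of column [i0] sits in a row with prescribed sum. This is the
    origin of the upper limit [p + q] for [n]. *)
Lemma filling_sum_le :
  (\sum_p P p <= \sum_(i | i != i0) a i + \sum_(j | j != j0) b j)%N.
Proof.
have [p0 pa pb] := fillingP _ _ _ _ _ fP.
rewrite filling_sum_col addnC leq_add2l (bigD1 j0) //= p0 add0n.
by apply: leq_sum => j /pb <-; exact: leq_sum1.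
Qed.

End FillingSums.

Section FillingEmb.
Context (V : nmodType) (I I' J J' : finType) (i0 : I) (i0' : I') (j0 : J) (j0' : J').
Context (f : I' -> I) (g : J' -> J) (a : I -> nat) (b : J -> nat) (N : nat).
Context (F : (J * I -> nat) -> V) (F' : (J' * I' -> nat) -> V).
Hypotheses (fI : injective f) (gI : injective g).
Hypotheses (f0 : f i0' = i0) (g0 : g j0' = j0).
Hypothesis a0 : forall i, i \notin codom f -> a i = 0%N.
Hypothesis b0 : forall j, j \notin codom g -> b j = 0%N.
Hypothesis FF' : forall P : J * I -> nat,
  (forall p, p \notin codom (pair_map g f) -> P p = 0%N) ->
  F P = F' (P \o pair_map g f).
Hypothesis F'e : forall P P', P =1 P' -> F' P = F' P'.

Let pI := pair_map_inj gI fI.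

(** Base points lie in the images, so an entry off the image belongs to a row or column whose sum is
    prescribed to be zero. *)
Lemma filling_off (P : J * I -> nat) : filling i0 j0 a b P ->
  forall p, p \notin codom (pair_map g f) -> P p = 0%N.
Proof.
move=> /fillingP[p0 pa pb] [j i]; rewrite codom_pair_map negb_and /=.
case/orP => [jN|iN].
  have j0N : j != j0 by apply: contraNneq jN => ->; rewrite -g0 codom_f.
  by have := leq_sum1 (fun i => P (j, i)) i; rewrite (pb _ j0N) b0 // leqn0 => /eqP.
have i0N : i != i0 by apply: contraNneq iN => ->; rewrite -f0 codom_f.
by have := leq_sum1 (fun j => P (j, i)) j; rewrite (pa _ i0N) a0 // leqn0 => /eqP.
Qed.

Lemma filling_emb (P : J * I -> nat) :
  (forall p, p \notin codom (pair_map g f) -> P p = 0%N) ->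
  filling i0 j0 a b P = filling i0' j0' (a \o f) (b \o g) (P \o pair_map g f).
Proof.
move=> P0.
have sc i : (\sum_j P (j, f i) = \sum_j' P (g j', f i))%N.
  apply: big_codom => // j jN; apply: P0.
  by rewrite codom_pair_map (negPf jN).
have sr j : (\sum_i P (g j, i) = \sum_i' P (g j, f i'))%N.
  apply: big_codom => // i iN; apply: P0.
  by rewrite codom_pair_map (negPf iN) andbF.
apply/fillingP/fillingP => -[p0 pa pb]; split.
- by rewrite /= /pair_map /= f0 g0.
- by move=> i iN; rewrite /= -sc pa // -f0 (inj_eq fI).
- by move=> j jN; rewrite /= -sr pb // -g0 (inj_eq gI).
- by move: p0; rewrite /= /pair_map /= f0 g0.
- move=> i iN; case: (boolP (i \in codom f)) => [/codomP[x xE]|inf].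
    by rewrite xE sc; apply: pa; move: iN; rewrite xE -f0 (inj_eq fI).
  by rewrite a0 // big1 // => j _; rewrite P0 // codom_pair_map (negPf inf) andbF.
- move=> j jN; case: (boolP (j \in codom g)) => [/codomP[x xE]|jnf].
    by rewrite xE sr; apply: pb; move: jN; rewrite xE -g0 (inj_eq gI).
  by rewrite b0 // big1 // => i _; rewrite P0 // codom_pair_map (negPf jnf).
Qed.

Lemma sum_filling_emb :
  \sum_(P : {ffun J * I -> 'I_N.+1} | filling i0 j0 a b (fun p => P p))
     F (fun p => P p) =
  \sum_(P : {ffun J' * I' -> 'I_N.+1} |
         filling i0' j0' (a \o f) (b \o g) (fun p => P p)) F' (fun p => P p).
Proof.
pose h (P : {ffun J' * I' -> 'I_N.+1}) : {ffun J * I -> 'I_N.+1} :=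
  [ffun p => emb_ext ord0 (pair_map g f) P p].
pose h' (P : {ffun J * I -> 'I_N.+1}) : {ffun J' * I' -> 'I_N.+1} :=
  [ffun p => P (pair_map g f p)].
have hf P q : h P (pair_map g f q) = P q by rewrite ffunE emb_extE.
have h0 P p : p \notin codom (pair_map g f) -> (h P p : nat) = 0%N.
  by move=> pN; rewrite ffunE emb_ext0.
rewrite (reindex_onto h h') /=; last first.
  move=> P Pf; apply/ffunP => p.
  case: (boolP (p \in codom (pair_map g f))) => [/codomP[q ->]|pN].
    by rewrite hf ffunE.
  by apply/val_inj; rewrite /= h0 // (filling_off Pf).
have h'h P : h' (h P) = P by apply/ffunP => q; rewrite ffunE hf.
apply: eq_big => [P|P _].
  rewrite h'h eqxx andbT filling_emb; last exact: h0.
  by apply: eq_filling => // q; rewrite /= hf.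
by rewrite FF'; [apply: F'e => q; rewrite /= hf | exact: h0].
Qed.

End FillingEmb.

(* The total of a filling determines n, so no sum over n remains. *)
Lemma sum_heis_mx (V : nmodType) (al be : composition) (N : nat)
    (F : seq nat -> V) :
  (sumn al + sumn be <= N)%N -> (forall s, F (hat s) = F s) ->
  \sum_(maxn (sumn al) (sumn be) <= n < (sumn al + sumn be).+1)
     \sum_(M in heis_mx n al be) F (mx_comp M) =
  \sum_(P : {ffun 'I_(size be).+1 * 'I_(size al).+1 -> 'I_N.+1} |
         filling ord0 ord0 (fun i : 'I_(size al).+1 => nth 0 (0 :: al) i)%N
           (fun j : 'I_(size be).+1 => nth 0 (0 :: be) j)%N (fun p => P p))
     F (word (fun p => P p)).
Proof.
move=> pqN Fhat; set a := fun i : 'I__ => _; set b := fun j : 'I__ => _.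
pose C (P : {ffun 'I_(size be).+1 * 'I_(size al).+1 -> 'I_N.+1}) :=
  filling ord0 ord0 a b (fun p => P p).
pose tot (P : {ffun 'I_(size be).+1 * 'I_(size al).+1 -> 'I_N.+1}) :=
  (\sum_p P p)%N.
have sumE (s : seq nat) : (\sum_(i < (size s).+1 | i != ord0) nth 0 (0 :: s) i = sumn s)%N.
  rewrite big_mkcond big_ord_recl /= add0n sumnE (big_nth 0%N) big_mkord.
  by apply: eq_bigr => i _.
have sa : (\sum_(i | i != ord0) a i = sumn al)%N by exact: sumE.
have sb : (\sum_(i | i != ord0) b i = sumn be)%N by exact: sumE.
have totr P : C P -> (maxn (sumn al) (sumn be) <= tot P < (sumn al + sumn be).+1)%N.
  move=> CP; rewrite ltnS geq_max; apply/andP; split; last first.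
    by rewrite -sa -sb; exact: filling_sum_le CP.
  rewrite /tot {1}(filling_sum_col CP) (filling_sum_row CP) sa sb.
  by rewrite !leq_addl.
(* Fillings are sorted by their total; [totr] shows that each one is met exactly once in the range
   of [n]. *)
transitivity (\sum_(maxn (sumn al) (sumn be) <= n < (sumn al + sumn be).+1)
   \sum_(P | C P && (tot P == n)) F (word (fun p => P p))); last first.
  rewrite (exchange_big_dep C) /=; last by move=> n P _ /andP[].
  apply: eq_bigr => P CP; rewrite (eq_bigl (fun n => n == tot P)); last first.
    by move=> n; rewrite CP eq_sym.
  by rewrite big_nat1_eq totr.
rewrite big_nat [RHS]big_nat; apply: eq_bigr => n /andP[].
rewrite geq_max ltnS => /andP[pn qn] npq; have nN := leq_trans npq pqN.
(* Only the entry bound changes between the two sides, from [n] to [N]. No information is lost since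
   an entry is at most the total, which is [n]. *)
pose h (M : 'M['I_n.+1]_((size be).+1, (size al).+1)) :
  {ffun 'I_(size be).+1 * 'I_(size al).+1 -> 'I_N.+1} :=
  [ffun p => inord (M p.1 p.2)].
pose h' (P : {ffun 'I_(size be).+1 * 'I_(size al).+1 -> 'I_N.+1}) :
  'M['I_n.+1]_((size be).+1, (size al).+1) := \matrix_(i, j) inord (P (i, j)).
have hE M p : h M p = M p.1 p.2 :> nat.
  by rewrite ffunE inordK // ltnS (leq_trans _ nN) // -ltnS.
have totle (P : {ffun 'I_(size be).+1 * 'I_(size al).+1 -> 'I_N.+1}) p :
    (P p <= tot P)%N by exact: (leq_sum1 (fun p => P p : nat)).
rewrite [RHS](reindex_onto h h') /=; last first.
  move=> P /andP[CP /eqP tP]; apply/ffunP => -[i j]; apply/val_inj.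
  by rewrite /= hE mxE inordK // ltnS -tP totle.
apply: eq_big => [M|M _]; last first.
  rewrite /mx_comp Fhat; congr F; rewrite /word enum_pair map_allpairs.
  by apply: eq_allpairs => i j; rewrite hE.
have -> : h' (h M) == M.
  by apply/eqP/matrixP => i j; rewrite mxE hE inord_val.
rewrite andbT inE.
have tE : tot (h M) = (\sum_i \sum_j (M i j : nat))%N.
  rewrite /tot sum_pairE; apply: eq_bigr => i _; apply: eq_bigr => j _.
  by rewrite hE.
apply/and3P/andP => [[/eqP M0 /forallP Mc /forallP Mr]|[CP /eqP tP]].
  split.
    apply/fillingP; split=> [|i iN|j jN]; first by rewrite hE.
      transitivity (\sum_j (M j i : nat))%N; first by apply: eq_bigr => j _; rewrite hE.
      by rewrite (eqP (Mc i)) /a; case: i iN => [[]].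
    transitivity (\sum_i (M j i : nat))%N; first by apply: eq_bigr => i _; rewrite hE.
    by rewrite (eqP (Mr j)) /b; case: j jN => [[]].
  (* Column 0 contributes [n - sumn al] and the other columns [sumn al]; [pn] makes the subtraction
     exact. *)
  rewrite tE exchange_big (bigD1 ord0) //= (eqP (Mc ord0)) /=.
  rewrite (eq_bigr a); last first.
    by move=> i iN; rewrite (eqP (Mc i)) /a; case: i iN => [[]].
  by rewrite sa subnK.
have /fillingP[P0 Pa Pb] := CP.
split; first by rewrite -(hE M (ord0, ord0)) P0.
  apply/forallP => j; case: (eqVneq j ord0) => [->|jN] /=; last first.
    rewrite (_ : nth _ _ _ = a j); last by rewrite /a; case: j jN => [[]].
    by rewrite -Pa //; apply/eqP/eq_bigr => i _; rewrite hE.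
  (* Conversely the sum of column 0, left free by [filling], is forced by the total being [n]. *)
  rewrite -[X in (X - _)%N]tP /tot (filling_sum_col CP) sa addnK.
  by apply/eqP/eq_bigr => i _; rewrite hE.
apply/forallP => j; case: (eqVneq j ord0) => [->|jN] /=; last first.
  rewrite (_ : nth _ _ _ = b j); last by rewrite /b; case: j jN => [[]].
  by rewrite -Pb //; apply/eqP/eq_bigr => i _; rewrite hE.
rewrite -[X in (X - _)%N]tP /tot (filling_sum_row CP) sb addnK.
by apply/eqP/eq_bigr => i _; rewrite hE.
Qed.

End Fillings.

(** * From arbitrary finite index sets to compositions *)

Section Pointed.
Implicit Types I J : finType.

Lemma seq_emb I (x0 : I) (p : pred I) n (s := [seq i <- enum I | p i])
    (f := fun k : 'I_n => nth x0 s k) : size s = n ->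
  [/\ injective f, order_emb f & codom f =i s].
Proof.
move=> sn; have us : uniq s by exact/filter_uniq/enum_uniq.
have mf : [seq f i | i <- enum 'I_n] = s.
  rewrite /f (map_comp (nth x0 s) val) val_enum_ord -sn; exact: mkseq_nth.
have cf : codom f =i s by move=> i; rewrite -mf.
split=> //; last by rewrite /order_emb mf; apply: eq_in_filter => i _;
  rewrite cf mem_filter mem_enum andbT.
move=> i j /eqP; rewrite /f nth_uniq ?sn // => /eqP; exact: val_inj.
Qed.

Lemma word_filter I (a : I -> nat) :
  hat (word a) = [seq a i | i <- [seq i <- enum I | 0 < a i]%N] :> seq nat.
Proof. exact: map_pos_filter. Qed.

Lemma sumn_hat s : sumn (hat s) = sumn s.
Proof. by rewrite /=; elim: s => //= -[|x] s IH //=; rewrite IH. Qed.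

Lemma sumn_word I (a : I -> nat) : sumn (word a) = (\sum_i a i)%N.
Proof. by rewrite sumnE big_map big_enum. Qed.

(** The map enumerates the support of [a] in order. It replaces an arbitrary index set by the
    ordinal for which the structure maps are specified. *)
Lemma word_support I (a : I -> nat) (al := hat (word a)) :
  exists f : 'I_(size al) -> I, [/\ injective f, order_emb f,
    forall i, i \notin codom f -> a i = 0%N & forall i, a (f i) = nth 0%N al i].
Proof.
have sE : size al = size [seq i <- enum I | 0 < a i]%N.
  by rewrite /al word_filter size_map.
case: (pickP (fun i => 0 < a i)%N) => [x0 _|a0]; last first.
  (* With empty support there may be no element of [I] to use as a default, so the map is defined by
     absurdity on an empty ordinal. *)
  have n0 : size al = 0%N.
    by rewrite sE (eq_filter a0) filter_pred0.
  have no : 'I_0 -> False by case.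
  exists (fun i => False_rect _ (no (cast_ord n0 i))).
  split=> [i|||i]; try by case: (cast_ord n0 i).
    rewrite /order_emb (eq_filter (_ : _ =1 pred0)) ?filter_pred0 => [|i].
      by case: (enum _) => // i; case: (cast_ord n0 i).
    by apply/codomP => -[j]; case: (cast_ord n0 j).
  by move=> i _; have := a0 i; rewrite lt0n => /negbFE/eqP.
have [fI fo fc] := seq_emb x0 (esym sE).
exists (fun i => nth x0 [seq i <- enum I | 0 < a i]%N i); split=> // [i|i].
  by rewrite fc mem_filter mem_enum andbT lt0n negbK => /eqP.
transitivity (nth 0%N [seq a i | i <- [seq i <- enum I | 0 < a i]%N] i).
  by rewrite (nth_map x0) // -sE.
by rewrite -word_filter.
Qed.

(* The base point stands for row or column 0 of a matrix: it comes first, so that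
   words of arrays are read in the order used by mx_comp. *)
Definition pointed I (i0 : I) := exists l, enum I = i0 :: l.

Lemma pointed_ord n : pointed (@ord0 n).
Proof. by exists [seq lift ord0 i | i <- enum 'I_n]; rewrite enum_ordSl. Qed.

Lemma pointed_pair I J i0 j0 : @pointed I i0 -> @pointed J j0 ->
  pointed (j0, i0).
Proof.
move=> [l lE] [m mE]; rewrite /pointed enum_pair lE mE /=.
by eexists; reflexivity.
Qed.

(** The base point is kept although its entry is zero: it becomes row or column 0 of the
    matrices. *)
Lemma pointed_support I (i0 : I) (a : I -> nat) (al := hat (word a)) :
  pointed i0 -> a i0 = 0%N ->
  exists f : 'I_(size al).+1 -> I, [/\ injective f, f ord0 = i0, order_emb f,
    forall i, i \notin codom f -> a i = 0%N
    & forall i, a (f i) = nth 0%N (0%N :: al) i].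
Proof.
move=> [l lE] a0; pose p i := (i == i0) || (0 < a i)%N.
have ul : i0 \notin l by have := enum_uniq I; rewrite lE => /andP[].
have pE : [seq i <- enum I | p i] = i0 :: [seq i <- enum I | 0 < a i]%N.
  rewrite lE /= /p eqxx a0 /=; congr cons; apply: eq_in_filter => i il.
  by case: eqP => // ii0; rewrite -ii0 il in ul.
have sE : (size al).+1 = size [seq i <- enum I | p i].
  by rewrite pE /al word_filter size_map.
have [fI fo fc] := seq_emb i0 (esym sE).
exists (fun i => nth i0 [seq i <- enum I | p i] i); split=> // [|i|i].
- by rewrite pE.
- rewrite fc mem_filter mem_enum andbT negb_or => /andP[_].
  by rewrite lt0n negbK => /eqP.
- transitivity (nth 0%N [seq a i | i <- [seq i <- enum I | p i]] i).
    by rewrite (nth_map i0) // -sE.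
  by rewrite pE map_cons a0 -word_filter.
Qed.

End Pointed.

Section SumOver.
Context (V : nmodType).

(** Used with [y] a larger array and [x] the table of its margins: [y] determines [x], so the sum
    over [x] collapses. *)
Lemma sum_fiber (S T : finType) (C : pred S) (D : S -> pred T) (Q : pred T)
    (g : T -> S) (F : T -> V) :
  (forall x y, C x && D x y = Q y && (x == g y)) ->
  \sum_(x | C x) \sum_(y | D x y) F y = \sum_(y | Q y) F y.
Proof.
move=> E; rewrite (exchange_big_dep Q) /=; last first.
  by move=> x y Cx Dxy; have := E x y; rewrite Cx Dxy => /esym/andP[].
apply: eq_bigr => y Qy; rewrite (eq_bigl (pred1 (g y))); first by rewrite big_pred1_eq.
by move=> x; rewrite E Qy.
Qed.

Lemma sum_exchange (S T : finType) (P : pred S) (Q : S -> pred T)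
    (Q' : pred T) (P' : T -> pred S) (F : S -> T -> V) :
  (forall x y, P x && Q x y = Q' y && P' y x) ->
  \sum_(x | P x) \sum_(y | Q x y) F x y =
  \sum_(y | Q' y) \sum_(x | P' y x) F x y.
Proof.
move=> E; rewrite (exchange_big_dep Q') => [|x y Px Qxy]; last first.
  by have := E x y; rewrite Px Qxy => /esym/andP[].
by apply: eq_bigr => y Q'y; apply: eq_bigl => x; rewrite E Q'y.
Qed.

End SumOver.

(** * Three-dimensional arrays and the two bracketings *)

Section TripleFillings.
Context (V : nmodType) (I J K : finType) (i0 : I) (j0 : J) (k0 : K).
Context (a : I -> nat) (b : J -> nat) (c : K -> nat) (N : nat).
Hypotheses (aN : forall i, (a i <= N)%N) (bN : forall j, (b j <= N)%N)
  (cN : forall k, (c k <= N)%N).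

(** Curried, so that arrays on [K * (J * I)] and on [(K * J) * I] are instances of the same
    predicate. *)
Definition filling3 (P : K -> J -> I -> nat) : bool :=
  `[< [/\ P k0 j0 i0 = 0%N,
          forall i, i != i0 -> (\sum_k \sum_j P k j i = a i)%N,
          forall j, j != j0 -> (\sum_k \sum_i P k j i = b j)%N
        & forall k, k != k0 -> (\sum_j \sum_i P k j i = c k)%N] >].

Lemma sum_filling_l (F : {ffun K * (J * I) -> 'I_N.+1} -> V) :
  \sum_(M : {ffun J * I -> 'I_N.+1} | filling i0 j0 a b (fun p => M p))
    \sum_(P : {ffun K * (J * I) -> 'I_N.+1} |
            filling (j0, i0) k0 (fun p => M p) c (fun p => P p)) F P =
  \sum_(P : {ffun K * (J * I) -> 'I_N.+1} |
            filling3 (fun k j i => P (k, (j, i)))) F P.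
Proof.
(* The intermediate array is recovered by summing out [K], except at [(j0, i0)]: there [filling]
   demands zero, whereas the sum of [P] along that line is unconstrained. Away from it the sum is
   part of some [a i] or [b j], hence at most [N]. *)
pose g (P : {ffun K * (J * I) -> 'I_N.+1}) : {ffun J * I -> 'I_N.+1} :=
  [ffun p => inord (if p == (j0, i0) then 0 else \sum_k P (k, p))%N].
apply: (sum_fiber (g := g)) => M P.
apply/andP/andP => [[/fillingP[M0 Ma Mb] /fillingP[P0 PM Pc]]|].
  split; last first.
    apply/eqP/ffunP => p; rewrite ffunE; apply/val_inj => /=.
    case: eqVneq => [->|pN]; first by rewrite inordK // M0.
    by rewrite PM // inord_val.
  apply/asboolP; split=> // [i iN|j jN|l lN].
  - rewrite exchange_big -Ma //; apply: eq_bigr => j _.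
    by rewrite PM // xpair_eqE negb_and iN orbT.
  - rewrite exchange_big -Mb //; apply: eq_bigr => i _.
    by rewrite PM // xpair_eqE negb_and jN.
  - by rewrite -Pc // sum_pairE.
move=> [/asboolP[P0 Pa Pb Pc] /eqP ->].
have gE j i : (j != j0) || (i != i0) -> g P (j, i) = (\sum_k P (k, (j, i)))%N :> nat.
  move=> ji; rewrite ffunE xpair_eqE -[_ && _]negbK negb_and ji /= inordK // ltnS.
  case/orP: ji => [jN|iN].
    apply: leq_trans (bN j); rewrite -Pb //; apply: leq_sum => l _.
    exact: (leq_sum1 (fun i => P (l, (j, i)) : nat)).
  apply: leq_trans (aN i); rewrite -Pa //; apply: leq_sum => l _.
  exact: (leq_sum1 (fun j => P (l, (j, i)) : nat)).
have g0 : g P (j0, i0) = 0%N :> nat by rewrite ffunE eqxx inordK.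
split; apply/fillingP; split=> //.
- by move=> i iN; rewrite -Pa // exchange_big; apply: eq_bigr => j _; rewrite gE ?iN ?orbT.
- by move=> j jN; rewrite -Pb // exchange_big; apply: eq_bigr => i _; rewrite gE ?jN.
- by move=> [j i]; rewrite xpair_eqE negb_and => /gE.
- by move=> l lN; rewrite -Pc // sum_pairE.
Qed.

Lemma sum_filling_r (F : {ffun (K * J) * I -> 'I_N.+1} -> V) :
  \sum_(M : {ffun K * J -> 'I_N.+1} | filling j0 k0 b c (fun p => M p))
    \sum_(P : {ffun (K * J) * I -> 'I_N.+1} |
            filling i0 (k0, j0) a (fun p => M p) (fun p => P p)) F P =
  \sum_(P : {ffun (K * J) * I -> 'I_N.+1} |
            filling3 (fun k j i => P ((k, j), i))) F P.
Proof.
pose g (P : {ffun (K * J) * I -> 'I_N.+1}) : {ffun K * J -> 'I_N.+1} :=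
  [ffun p => inord (if p == (k0, j0) then 0 else \sum_i P (p, i))%N].
apply: (sum_fiber (g := g)) => M P.
apply/andP/andP => [[/fillingP[M0 Mb Mc] /fillingP[P0 Pa PM]]|].
  split; last first.
    apply/eqP/ffunP => p; rewrite ffunE; apply/val_inj => /=.
    case: eqVneq => [->|pN]; first by rewrite inordK // M0.
    by rewrite PM // inord_val.
  apply/asboolP; split=> // [i iN|j jN|l lN].
  - by rewrite -Pa // sum_pairE.
  - rewrite -Mb //; apply: eq_bigr => l _.
    by rewrite PM // xpair_eqE negb_and jN orbT.
  - rewrite -Mc //; apply: eq_bigr => j _.
    by rewrite PM // xpair_eqE negb_and lN.
move=> [/asboolP[P0 Pa Pb Pc] /eqP ->].
have gE l j : (l != k0) || (j != j0) -> g P (l, j) = (\sum_i P ((l, j), i))%N :> nat.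
  move=> lj; rewrite ffunE xpair_eqE -[_ && _]negbK negb_and lj /= inordK // ltnS.
  case/orP: lj => [lN|jN].
    apply: leq_trans (cN l); rewrite -Pc //.
    exact: (leq_sum1 (fun j => \sum_i P ((l, j), i))%N).
  apply: leq_trans (bN j); rewrite -Pb //.
  exact: (leq_sum1 (fun l => \sum_i P ((l, j), i))%N).
have g0 : g P (k0, j0) = 0%N :> nat by rewrite ffunE eqxx inordK.
split; apply/fillingP; split=> //.
- by move=> j jN; rewrite -Pb //; apply: eq_bigr => l _; rewrite gE ?jN ?orbT.
- by move=> l lN; rewrite -Pc //; apply: eq_bigr => j _; rewrite gE ?lN.
- by move=> i iN; rewrite -Pa // sum_pairE.
- by move=> [l j]; rewrite xpair_eqE negb_and => /gE.
Qed.

(** Both nestings of pairs are enumerated lexicographically, so the arrays are read in the same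
    order. *)
Lemma word_assoc (P : K * (J * I) -> nat) :
  word (fun p : (K * J) * I => P (p.1.1, (p.1.2, p.2))) = word P.
Proof.
rewrite /word !enum_pair !map_allpairs /=; elim: (enum K) => //= x s IH.
rewrite flatten_cat; congr (_ ++ _); last exact: IH.
by rewrite map_allpairs.
Qed.

Lemma sum_filling3_assoc (F : seq nat -> V) :
  \sum_(P : {ffun (K * J) * I -> 'I_N.+1} |
            filling3 (fun k j i => P ((k, j), i))) F (word (fun p => P p)) =
  \sum_(P : {ffun K * (J * I) -> 'I_N.+1} |
            filling3 (fun k j i => P (k, (j, i)))) F (word (fun p => P p)).
Proof.
pose h (P : {ffun K * (J * I) -> 'I_N.+1}) : {ffun (K * J) * I -> 'I_N.+1} :=
  [ffun p => P (p.1.1, (p.1.2, p.2))].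
pose h' (P : {ffun (K * J) * I -> 'I_N.+1}) : {ffun K * (J * I) -> 'I_N.+1} :=
  [ffun p => P ((p.1, p.2.1), p.2.2)].
have hK : cancel h h' by move=> P; apply/ffunP => -[? []] *; rewrite !ffunE.
have h'K : cancel h' h by move=> P; apply/ffunP => -[[]] *; rewrite !ffunE.
rewrite (reindex h) /=; last by exists h' => P _.
apply: eq_big => [P|P _].
  by congr filling3; do 3!apply/funext => ?; rewrite ffunE.
rewrite -word_assoc; congr (F _); apply: eq_map => p.
by rewrite ffunE.
Qed.

End TripleFillings.

(** * Reindexing of iterated splittings *)

Section SplitSums.
Context (V : nmodType).

(** Both sides run over the ways to write [a] as an ordered sum of three functions; the change of
    variable is [b = c + d]. *)
Lemma sum_splits_assoc (I : finType) (a : I -> nat) N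
    (G : (I -> nat) -> (I -> nat) -> (I -> nat) -> V) :
  (forall i, (a i <= N)%N) ->
  \sum_(b : {ffun I -> 'I_N.+1} | [forall i, b i <= a i]%N)
   \sum_(c : {ffun I -> 'I_N.+1} | [forall i, c i <= b i]%N)
     G (fun i => c i) (fun i => b i - c i)%N (fun i => a i - b i)%N =
  \sum_(c : {ffun I -> 'I_N.+1} | [forall i, c i <= a i]%N)
   \sum_(d : {ffun I -> 'I_N.+1} | [forall i, d i <= a i - c i]%N)
     G (fun i => c i) (fun i => d i) (fun i => a i - c i - d i)%N.
Proof.
move=> aN; pose T := {ffun I -> 'I_N.+1}.
rewrite (@sum_exchange _ T T _ _ (fun c => [forall i, c i <= a i]%N)
  (fun c b => [forall i, b i <= a i]%N && [forall i, c i <= b i]%N)); last first.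
  move=> b c; apply/andP/andP => [[ba cb]|[_ /andP[]]] //; split; last exact/andP.
  by apply/forallP => i; exact: leq_trans (forallP cb i) (forallP ba i).
apply: eq_bigr => c /forallP ca.
pose h (d : T) : T := [ffun i => inord (c i + d i)].
pose h' (b : T) : T := [ffun i => inord (b i - c i)].
have h'E (b : T) i : h' b i = (b i - c i)%N :> nat.
  by rewrite ffunE inordK // ltnS (leq_trans (leq_subr _ _)) // -ltnS.
rewrite (reindex_onto h h') /=; last first.
  move=> b /andP[_ /forallP cb]; apply/ffunP => i; apply/val_inj.
  by rewrite /= ffunE h'E subnKC // inordK.
have hE (d : T) i : (d i <= a i - c i)%N -> h d i = (c i + d i)%N :> nat.
  move=> dac; rewrite ffunE inordK // ltnS; apply: leq_trans (aN i).
  by rewrite -(subnKC (ca i)) leq_add2l.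
have K (d : T) : ([forall i, h d i <= a i]%N && [forall i, c i <= h d i]%N &&
    (h' (h d) == d)) = [forall i, d i <= a i - c i]%N.
  apply/idP/idP => [/andP[/andP[/forallP ha _] /eqP hd]|/forallP da].
    by apply/forallP => i; rewrite -{1}hd h'E leq_sub2r.
  apply/andP; split; [apply/andP; split; apply/forallP => i|].
  - by rewrite hE // -(subnKC (ca i)) leq_add2l.
  - by rewrite hE // leq_addr.
  - by apply/eqP/ffunP => i; apply/val_inj; rewrite /= h'E hE // addKn.
apply: eq_big => [//|d]; rewrite K => /forallP da.
by congr (G _ _ _); apply/funext => i; rewrite hE ?addKn ?subnDA.
Qed.

Lemma sum_splits_swap (I : finType) (a : I -> nat) N
    (G : (I -> nat) -> (I -> nat) -> V) :
  (forall i, (a i <= N)%N) ->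
  \sum_(b : {ffun I -> 'I_N.+1} | [forall i, b i <= a i]%N)
    G (fun i => a i - b i)%N (fun i => b i) =
  \sum_(b : {ffun I -> 'I_N.+1} | [forall i, b i <= a i]%N)
    G (fun i => b i) (fun i => a i - b i)%N.
Proof.
move=> aN; pose T := {ffun I -> 'I_N.+1}.
pose h (d : T) : T := [ffun i => inord (a i - d i)].
have hE (d : T) i : h d i = (a i - d i)%N :> nat.
  by rewrite ffunE inordK // ltnS (leq_trans (leq_subr _ _)).
have hK (d : T) : [forall i, d i <= a i]%N -> h (h d) = d.
  by move=> /forallP da; apply/ffunP => i; apply/val_inj; rewrite /= !hE subKn.
rewrite (reindex_onto h h) //=.
apply: eq_big => [d|d].
  apply/andP/idP => [[_ /eqP <-]|da]; first by apply/forallP => i; rewrite hE leq_subr.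
  by rewrite hK // eqxx; split=> //; apply/forallP => i; rewrite hE leq_subr.
move=> /andP[/forallP hd /eqP hh].
have da i : (d i <= a i)%N by rewrite -hh hE leq_subr.
by congr (G _ _); apply/funext => i; rewrite hE ?subKn.
Qed.

Context (I J : finType) (i0 : I) (j0 : J) (a : I -> nat) (b : J -> nat) (N : nat).
Hypothesis abN : (\sum_i a i + \sum_j b j <= N)%N.
Context (G : (J * I -> nat) -> (J * I -> nat) -> V).
Local Notation T := {ffun J * I -> 'I_N.+1}.

(** Substitute [P = Q + R]. The total of a filling is at most the sum of all margins, so [abN]
    guarantees that [Q + R] still fits under the bound [N]. *)
Lemma sum_filling_splits :
  \sum_(P : T | filling i0 j0 a b (fun p => P p))
    \sum_(Q : T | [forall p, Q p <= P p]%N) G (fun p => Q p) (fun p => P p - Q p)%N =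
  \sum_(q : T * T | filling i0 j0 a b (fun p => q.1 p + q.2 p)%N)
    G (fun p => q.1 p) (fun p => q.2 p).
Proof.
pose Q2 (q : T * T) := filling i0 j0 a b (fun p => q.1 p + q.2 p)%N.
pose F (q : T * T) := G (fun p => q.1 p) (fun p => q.2 p).
rewrite (@sum_exchange _ T T _ _ xpredT (fun Q P =>
  filling i0 j0 a b (fun p => P p) && [forall p, Q p <= P p]%N)) //.
rewrite -(pair_big_dep xpredT (fun Q R => Q2 (Q, R)) (fun Q R => F (Q, R))) /=.
apply: eq_bigr => Q _.
pose h (R : T) : T := [ffun p => inord (Q p + R p)].
pose h' (P : T) : T := [ffun p => inord (P p - Q p)].
have h'E (P : T) p : h' P p = (P p - Q p)%N :> nat.
  by rewrite ffunE inordK // ltnS (leq_trans (leq_subr _ _)) // -ltnS.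
rewrite (reindex_onto h h') /=; last first.
  move=> P /andP[_ /forallP QP]; apply/ffunP => p; apply/val_inj.
  by rewrite /= ffunE h'E subnKC // inordK.
have hE (R : T) : Q2 (Q, R) -> forall p, h R p = (Q p + R p)%N :> nat.
  move=> fQR p; rewrite ffunE inordK // ltnS.
  apply: leq_trans (leq_sum1 (fun p => Q p + R p)%N p) _.
  apply: leq_trans (filling_sum_le fQR) _; apply: leq_trans abN.
  by apply: leq_add; [rewrite [leqRHS](bigD1 i0)|rewrite [leqRHS](bigD1 j0)];
    rewrite //= leq_addl.
have KE (R : T) : filling i0 j0 a b (fun p => h R p) &&
    [forall p, Q p <= h R p]%N && (h' (h R) == R) = Q2 (Q, R).
  apply/idP/idP => [/andP[/andP[fh /forallP Qh] /eqP hR]|QR].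
    have e : (fun p => Q p + R p)%N =1 (fun p => h R p : nat).
      by move=> p /=; rewrite -{1}hR h'E subnKC.
    by rewrite /Q2 /= (eq_filling _ _ (fun=> erefl) (fun=> erefl) e).
  apply/andP; split; [apply/andP; split|].
  - by rewrite (eq_filling _ _ (fun=> erefl) (fun=> erefl) (hE R QR)).
  - by apply/forallP => p; rewrite hE // leq_addr.
  - by apply/eqP/ffunP => p; apply/val_inj; rewrite /= h'E hE // addKn.
apply: eq_big => [//|R]; rewrite KE => QR.
by congr (G _ _); apply/funext => p; rewrite hE // addKn.
Qed.

(** The margins of [Q] determine [s] and [t], and [R] has the complementary margins. At the base
    points the margins of [Q] are free, and [a0], [b0] force [s] and [t] to vanish there. The
    right-hand side is that of [sum_filling_splits]; the comparison gives multiplicativity of the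
    coproduct. *)
Lemma sum_splits_fillings : a i0 = 0%N -> b j0 = 0%N ->
  \sum_(s : {ffun I -> 'I_N.+1} | [forall i, s i <= a i]%N)
   \sum_(t : {ffun J -> 'I_N.+1} | [forall j, t j <= b j]%N)
    \sum_(Q : T | filling i0 j0 (fun i => s i) (fun j => t j) (fun p => Q p))
     \sum_(R : T | filling i0 j0 (fun i => a i - s i)%N (fun j => b j - t j)%N
                      (fun p => R p))
      G (fun p => Q p) (fun p => R p) =
  \sum_(q : T * T | filling i0 j0 a b (fun p => q.1 p + q.2 p)%N)
    G (fun p => q.1 p) (fun p => q.2 p).
Proof.
move=> a0 b0.
have aN i : (a i <= N)%N.
  by apply: leq_trans abN; rewrite (leq_trans (leq_sum1 _ i)) // leq_addr.
have bN j : (b j <= N)%N.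
  by apply: leq_trans abN; rewrite (leq_trans (leq_sum1 _ j)) // leq_addl.
pose Q2 (q : T * T) := filling i0 j0 a b (fun p => q.1 p + q.2 p)%N.
pose F (q : T * T) := G (fun p => q.1 p) (fun p => q.2 p).
pose S := {ffun I -> 'I_N.+1}; pose S' := {ffun J -> 'I_N.+1}.
pose C (s : S * S') := [forall i, s.1 i <= a i]%N && [forall j, s.2 j <= b j]%N.
pose D (s : S * S') (q : T * T) :=
  filling i0 j0 (fun i => s.1 i) (fun j => s.2 j) (fun p => q.1 p) &&
  filling i0 j0 (fun i => a i - s.1 i)%N (fun j => b j - s.2 j)%N (fun p => q.2 p).
transitivity (\sum_(s | C s) \sum_(q | D s q) F q).
  rewrite -(pair_big (fun s : S => [forall i, s i <= a i]%N)
    (fun s' : S' => [forall j, s' j <= b j]%N)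
    (fun s s' => \sum_(q | D (s, s') q) F q)) /=.
  apply: eq_bigr => s _; apply: eq_bigr => s' _.
  by rewrite pair_big; apply: eq_bigr.
pose g (q : T * T) : S * S' :=
  ([ffun i => inord (if i == i0 then 0 else \sum_j q.1 (j, i))%N],
   [ffun j => inord (if j == j0 then 0 else \sum_i q.1 (j, i))%N]).
apply: (sum_fiber (g := g)) => -[s s'] [Q R]; rewrite /C /D /Q2 /=.
apply/andP/andP => [[/andP[/forallP sa /forallP sb]]|].
  move=> /andP[/fillingP[Q0 Qa Qb] /fillingP[R0 Ra Rb]]; split.
    apply/fillingP; split=> [|i iN|j jN]; first by rewrite Q0 R0.
      by rewrite big_split /= Qa // Ra // subnKC.
    by rewrite big_split /= Qb // Rb // subnKC.
  rewrite /g /= xpair_eqE; apply/andP; split; apply/eqP/ffunP => i;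
    apply/val_inj; rewrite ffunE /=; case: eqVneq => [->|iN].
  - by rewrite inordK //; apply/eqP; rewrite -leqn0 -a0 sa.
  - by rewrite Qa // inord_val.
  - by rewrite inordK //; apply/eqP; rewrite -leqn0 -b0 sb.
  - by rewrite Qb // inord_val.
move=> [/fillingP[/eqP]]; rewrite addn_eq0 => /andP[/eqP Q0 /eqP R0] QRa QRb.
have sQa i : i != i0 -> (\sum_j Q (j, i) + \sum_j R (j, i) = a i)%N.
  by move=> iN; rewrite -QRa // big_split.
have sQb j : j != j0 -> (\sum_i Q (j, i) + \sum_i R (j, i) = b j)%N.
  by move=> jN; rewrite -QRb // big_split.
move=> /eqP[-> ->]; set s1 := finfun _; set s2 := finfun _.
have s10 : s1 i0 = 0%N :> nat by rewrite ffunE eqxx inordK.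
have s20 : s2 j0 = 0%N :> nat by rewrite ffunE eqxx inordK.
have s1E i : i != i0 -> s1 i = (\sum_j Q (j, i))%N :> nat.
  move=> iN; rewrite ffunE (negPf iN) inordK // ltnS.
  by apply: leq_trans (aN i); rewrite -sQa // leq_addr.
have s2E j : j != j0 -> s2 j = (\sum_i Q (j, i))%N :> nat.
  move=> jN; rewrite ffunE (negPf jN) inordK // ltnS.
  by apply: leq_trans (bN j); rewrite -sQb // leq_addr.
split; apply/andP; split.
- apply/forallP => i; case: (eqVneq i i0) => [->|iN]; first by rewrite s10.
  by rewrite s1E // -sQa // leq_addr.
- apply/forallP => j; case: (eqVneq j j0) => [->|jN]; first by rewrite s20.
  by rewrite s2E // -sQb // leq_addr.
- by apply/fillingP; split=> // [i /s1E ->|j /s2E ->].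
- apply/fillingP; split=> // [i iN|j jN].
    by rewrite s1E // -sQa // addKn.
  by rewrite s2E // -sQb // addKn.
Qed.

End SplitSums.

(** * Bialgebra axioms *)

(* B s stands for X_{hat s} or h_s, so that B may be applied to the word of
   entries of any array. *)
Record heis_basis (k : fieldType) (H : hopf_data k) (B : seq nat -> H) : Prop :=
  HeisBasis {
    hb_hat : forall s, B (hat s) = B s;
    hb_span : spanning (fun al : composition => B al);
    hb_mul : bilin (@hmul k H);
    hb_mulE : forall al be : composition, hmul (B al) (B be) =
      \sum_(maxn (sumn al) (sumn be) <= n < (sumn al + sumn be).+1)
        \sum_(M in heis_mx n al be) B (mx_comp M);
    hb_one : hone H = B [::];
    hb_comul : linear (@hcomul k H);
    hb_comulE : forall al : composition, hcomul (B al) =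
      \sum_(b : {ffun 'I_(size al) -> 'I_(sumn al).+1} |
              [forall i, (b i <= nth 0 al i)%N])
        B (word (fun i => b i)) ⊗
        B (word (fun i : 'I_(size al) => nth 0 al i - b i)%N);
    hb_counit : scalar (@hcounit k H);
    hb_counitE : forall s, hcounit (B s) = (sumn s == 0%N)%:R
  }.

Section HeisBialgebra.
Context (k : fieldType) (H : hopf_data k) (B : seq nat -> H).
Hypothesis hB : heis_basis B.
Local Notation "x '**' y" := (@hmul k H x y) (at level 40).

Lemma B_eq_hat s t : hat s = hat t -> B s = B t.
Proof. by move=> st; rewrite -(hb_hat hB) st (hb_hat hB). Qed.

Lemma B_word_emb (I I' : finType) (f : I' -> I) (a : I -> nat) :
  order_emb f -> (forall i, i \notin codom f -> a i = 0%N) ->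
  B (word a) = B (word (a \o f)).
Proof. by move=> fo a0; apply/B_eq_hat/hat_word_emb. Qed.

Lemma B_cons0 s : B (0%N :: s) = B s.
Proof. by apply/B_eq_hat/hat_inj. Qed.

Lemma eq_B_word (I : finType) (a a' : I -> nat) :
  a =1 a' -> B (word a) = B (word a').
Proof. by move=> aa; congr B; apply: eq_map. Qed.

(** The leading zero supplies the base point [ord0] and is invisible to [B]. *)
Definition headed (s : seq nat) (i : 'I_(size s).+1) : nat := nth 0%N (0%N :: s) i.

Lemma B_headed s : B (word (@headed s)) = B s.
Proof. by rewrite /headed word_cons // B_cons0. Qed.

(** The product formula for words on any pointed index sets. It can be iterated, because the words
    on the right are indexed by the pointed set [J * I]. *)
Lemma mul_words (I J : finType) (i0 : I) (j0 : J) (a : I -> nat) (b : J -> nat) N :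
  pointed i0 -> pointed j0 -> a i0 = 0%N -> b j0 = 0%N ->
  (\sum_i a i + \sum_j b j <= N)%N ->
  B (word a) ** B (word b) =
  \sum_(P : {ffun J * I -> 'I_N.+1} | filling i0 j0 a b (fun p => P p))
    B (word (fun p => P p)).
Proof.
move=> pi pj a0 b0 abN.
have [f [fI f0 fo fz fE]] := pointed_support pi a0.
have [g [gI g0 go gz gE]] := pointed_support pj b0.
rewrite -(hb_hat hB (word a)) -(hb_hat hB (word b)) (hb_mulE hB).
rewrite (sum_heis_mx (N := N)); last 2 first.
- by rewrite !sumn_hat !sumn_word.
- exact: hb_hat.
rewrite (sum_filling_emb _ (F := fun P => B (word P))
  (F' := fun P => B (word P)) fI gI f0 g0 fz gz).
- by apply: eq_bigl => P; apply: eq_filling => // x; rewrite /= ?fE ?gE.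
- by move=> P P0; apply: B_word_emb => //; exact: pair_map_order_emb.
- by move=> P P'; exact: eq_B_word.
Qed.

Lemma comul_word (I : finType) (a : I -> nat) N : (forall i, a i <= N)%N ->
  hcomul (B (word a)) =
  \sum_(b : {ffun I -> 'I_N.+1} | [forall i, b i <= a i]%N)
    B (word (fun i => b i)) ⊗ B (word (fun i => a i - b i)%N).
Proof.
move=> aN; have [f [fI fo fz fE]] := word_support a.
rewrite -(hb_hat hB (word a)) (hb_comulE hB); set al := hat (word a).
pose F (b : I -> nat) := B (word b) ⊗ B (word (fun i => a i - b i)%N).
pose F' (b : 'I_(size al) -> nat) :=
  B (word b) ⊗ B (word (fun i : 'I_(size al) => nth 0 al i - b i)%N).
rewrite (@sum_splits_emb _ _ I f (sumn al) N a F F') //.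
- by apply: eq_bigl => b; apply: eq_forallb => i; rewrite fE.
- move=> i; rewrite sumn_hat sumn_word; exact: leq_sum1.
- move=> b ba; rewrite /F /F'; congr (_ ⊗ _).
    apply: B_word_emb => // i iN; apply/eqP.
    by rewrite -leqn0 -(fz _ iN).
  rewrite (B_word_emb fo) => [|i iN]; last by rewrite fz.
  by apply: eq_B_word => i /=; rewrite fE.
- move=> b b' bb; rewrite /F' (eq_B_word bb); congr (_ ⊗ _).
  by apply: eq_B_word => i; rewrite bb.
Qed.

Lemma span_ext1 (V : lmodType k) (f g : H -> V) : linear f -> linear g ->
  (forall al : composition, f (B al) = g (B al)) -> f =1 g.
Proof. exact/span_ext/(hb_span hB). Qed.

Let bm := hb_mul hB.
Let ld := hb_comul hB.

Lemma headed_sum s : (\sum_i @headed s i = sumn s)%N.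
Proof. by rewrite -sumn_word /headed word_cons. Qed.

Lemma headed_le s i : (@headed s i <= sumn s)%N.
Proof. by rewrite -headed_sum; exact: leq_sum1. Qed.

Lemma heis_mulA : associative (@hmul k H).
Proof.
suff E (al be ga : composition) :
    B al ** (B be ** B ga) = (B al ** B be) ** B ga.
  move=> x y z; move: x; apply: span_ext1 => [||al].
  - exact: bm.1.
  - exact: (lin_comp (bm.1 z) (bm.1 y)).
  move: y; apply: span_ext1 => [||be].
  - exact: (lin_comp (bm.2 (B al)) (bm.1 z)).
  - exact: (lin_comp (bm.1 z) (bm.2 (B al))).
  move: z; apply: span_ext1 => [||ga] //; last exact: bm.2.
  exact: (lin_comp (bm.2 (B al)) (bm.2 (B be))).
rewrite -(B_headed al) -(B_headed be) -(B_headed ga).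
set a := @headed al; set b := @headed be; set c := @headed ga.
pose N := (sumn al + sumn be + sumn ga)%N.
have aN i : (a i <= N)%N by rewrite (leq_trans (headed_le i)) // /N -addnA leq_addr.
have bN i : (b i <= N)%N by rewrite (leq_trans (headed_le i)) // /N addnAC leq_addl.
have cN i : (c i <= N)%N by rewrite (leq_trans (headed_le i)) // /N leq_addl.
have p1 n := pointed_ord n.
have E1 : (\sum_i a i + \sum_j b j <= N)%N.
  by rewrite !headed_sum /N leq_addr.
have E2 : (\sum_i b i + \sum_j c j <= N)%N.
  by rewrite !headed_sum /N -addnA leq_addl.
have le1 (I : finType) (i0 : I) (e : I -> nat) :
    (\sum_(i | i != i0) e i <= \sum_i e i)%N.
  by rewrite [leqRHS](bigD1 i0) //= leq_addl.
rewrite (mul_words (p1 _) (p1 _) _ _ E1) // (mul_words (p1 _) (p1 _) _ _ E2) //.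
rewrite (bilin_suml _ _ _ _ bm) (bilin_sumr _ _ _ _ bm).
(* In [mul_words] the right factor indexes the rows, so this bracketing produces arrays on
   [(ga * be) * al] and the other one arrays on [ga * (be * al)]. *)
transitivity (\sum_(M : {ffun 'I_(size ga).+1 * 'I_(size be).+1 -> 'I_N.+1} |
     filling ord0 ord0 b c (fun p => M p))
   \sum_(P : {ffun ('I_(size ga).+1 * 'I_(size be).+1) * 'I_(size al).+1 -> 'I_N.+1} |
     filling ord0 (ord0, ord0) a (fun p => M p) (fun p => P p))
     B (word (fun p => P p))).
  apply: eq_bigr => M fM; apply: mul_words => //.
  - exact: pointed_pair.
  - by case/fillingP: fM.
  - apply: (@leq_trans (sumn al + (sumn be + sumn ga))%N); last by rewrite addnA.
    rewrite headed_sum leq_add2l.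
    apply: leq_trans (filling_sum_le fM) _.
    by rewrite -(headed_sum be) -(headed_sum ga) leq_add // le1.
transitivity (\sum_(M : {ffun 'I_(size be).+1 * 'I_(size al).+1 -> 'I_N.+1} |
     filling ord0 ord0 a b (fun p => M p))
   \sum_(P : {ffun 'I_(size ga).+1 * ('I_(size be).+1 * 'I_(size al).+1) -> 'I_N.+1} |
     filling (ord0, ord0) ord0 (fun p => M p) c (fun p => P p))
     B (word (fun p => P p))); last first.
  apply: eq_bigr => M fM; symmetry; apply: mul_words => //.
  - exact: pointed_pair.
  - by case/fillingP: fM.
  - apply: (@leq_trans (sumn al + sumn be + sumn ga)%N) => //.
    rewrite headed_sum leq_add2r.
    apply: leq_trans (filling_sum_le fM) _.
    by rewrite -(headed_sum be) -(headed_sum al) leq_add // le1.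
by rewrite sum_filling_r // sum_filling_l // sum_filling3_assoc.
Qed.

Lemma B_one : B (word (@headed [::])) = hone H.
Proof. by rewrite B_headed (hb_one hB). Qed.

Lemma sumn0_one s : sumn s = 0%N -> B s = hone H.
Proof.
move=> s0; rewrite (hb_one hB); apply/B_eq_hat/hat_inj.
by elim: s s0 => //= -[|x] s IH // /IH.
Qed.

Lemma enum_ord1 : enum 'I_1 = [:: ord0].
Proof. by rewrite enum_ordSl; case: (enum 'I_0) => // -[]. Qed.

(** The index set of the unit is the base point alone, so the array is a single column, determined
    by its row sums and its empty corner. *)
Lemma heis_mul1l : left_id (hone H) (@hmul k H).
Proof.
apply: span_ext1 => [||al]; [exact: bm.2|exact: lin_id|].
rewrite -(B_headed al) -B_one; set a := @headed al; pose N := sumn al.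
rewrite (mul_words (pointed_ord _) (pointed_ord _) (N := N)) //; last first.
  by rewrite big_ord1 headed_sum.
pose P0 : {ffun 'I_(size al).+1 * 'I_1 -> 'I_N.+1} := [ffun p => inord (a p.1)].
have PE p : P0 p = a p.1 :> nat by rewrite ffunE inordK // ltnS headed_le.
rewrite (big_pred1 P0) => [|P].
  rewrite (eq_B_word PE) /word enum_pair enum_ord1 allpairs1r -map_comp.
  by congr B; apply: eq_map.
apply/fillingP/eqP => [[p0 _ pb]|->].
  apply/ffunP => -[i j]; apply/val_inj; rewrite /= PE (ord1 j) /=.
  case: (eqVneq i ord0) => [->|/pb <-]; first exact: p0.
  by rewrite big_ord1.
split; first by rewrite PE.
  by move=> i; rewrite (ord1 i) eqxx.
by move=> i iN; rewrite big_ord1 PE.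
Qed.

Lemma heis_mul1r : right_id (hone H) (@hmul k H).
Proof.
apply: span_ext1 => [||al]; [exact: bm.1|exact: lin_id|].
rewrite -(B_headed al) -B_one; set a := @headed al; pose N := sumn al.
rewrite (mul_words (pointed_ord _) (pointed_ord _) (N := N)) //; last first.
  by rewrite big_ord1 headed_sum addn0.
pose P0 : {ffun 'I_1 * 'I_(size al).+1 -> 'I_N.+1} := [ffun p => inord (a p.2)].
have PE p : P0 p = a p.2 :> nat by rewrite ffunE inordK // ltnS headed_le.
rewrite (big_pred1 P0) => [|P].
  rewrite (eq_B_word PE) /word enum_pair enum_ord1 allpairs1l -map_comp.
  by congr B; apply: eq_map.
apply/fillingP/eqP => [[p0 pb _]|->].
  apply/ffunP => -[j i]; apply/val_inj; rewrite /= PE (ord1 j) /=.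
  case: (eqVneq i ord0) => [->|/pb <-]; first exact: p0.
  by rewrite big_ord1.
split; first by rewrite PE.
  by move=> i iN; rewrite big_ord1 PE.
by move=> i; rewrite (ord1 i) eqxx.
Qed.

Lemma heis_comul1 : hcomul (hone H) = hone H ⊗ hone H.
Proof.
rewrite -{1}B_one (comul_word (N := 0)) => [|i]; last first.
  by rewrite (leq_trans (headed_le i)).
rewrite (big_pred1 [ffun=> ord0]) => [|b].
  by congr (_ ⊗ _); rewrite -B_one; apply: eq_B_word => i; rewrite (ord1 i) ffunE.
apply/forallP/eqP => [_|->] ; first by apply/ffunP => i; rewrite [b i]ord1 ffunE.
by move=> i; rewrite ffunE.
Qed.

(** A factor of degree zero is the unit. Otherwise every array has total at least [sumn al], which
    is positive, and the counit kills all terms. *)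
Lemma heis_counitM x y : hcounit (x ** y) = hcounit x * hcounit y.
Proof.
have lc : linear (@hcounit k H : H -> k^o) := hb_counit hB.
move: x; apply: (@span_ext1 k^o) => [||al].
- exact: (@lin_comp _ _ _ k^o _ _ lc (bm.1 y)).
- by move=> a u v; rewrite lc mulrDl; congr (_ + _); exact/esym/mulrA.
move: y; apply: (@span_ext1 k^o) => [||be].
- exact: (@lin_comp _ _ _ k^o _ _ lc (bm.2 (B al))).
- by move=> a u v; rewrite lc mulrDr; congr (_ + _); exact: mulrCA.
have e1 : hcounit (hone H) = 1 by rewrite (hb_one hB) (hb_counitE hB).
have [a0|aN] := eqVneq (sumn al) 0%N.
  by rewrite (sumn0_one a0) heis_mul1l e1 mul1r.
have [b0|bN] := eqVneq (sumn be) 0%N.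
  by rewrite (sumn0_one b0) heis_mul1r e1 mulr1.
rewrite !(hb_counitE hB) (negPf aN) mul0r -(B_headed al) -(B_headed be).
rewrite (mul_words (pointed_ord _) (pointed_ord _) _ _ (leqnn _)) //.
rewrite (lin_sum _ _ _ lc) big1 // => P fP.
rewrite (hb_counitE hB) sumn_word (filling_sum_col fP) addn_eq0.
suff -> : (\sum_(i | i != ord0) @headed al i)%N = sumn al by rewrite (negPf aN) andbF.
by rewrite -headed_sum [RHS](bigD1 ord0).
Qed.

Lemma heis_comulA x :
  tassoc (tmap (@hcomul k H) id (hcomul x)) = tmap id (@hcomul k H) (hcomul x).
Proof.
have li := @lin_id k H; have t1 := tmap_linear ld li; have t2 := tmap_linear li ld.
move: x; apply: span_ext1 => [||al].
- exact: (lin_comp (@tassoc_linear _ _ _ _) (lin_comp t1 ld)).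
- exact: (lin_comp t2 ld).
rewrite -(B_headed al); set a := @headed al; pose N := sumn al.
have aN i : (a i <= N)%N := headed_le i.
rewrite (comul_word aN) !(lin_sum _ _ _ t1) (lin_sum _ _ _ t2).
rewrite (lin_sum _ _ _ (@tassoc_linear _ _ _ _)).
transitivity (\sum_(b : {ffun 'I_(size al).+1 -> 'I_N.+1} | [forall i, b i <= a i]%N)
  \sum_(c : {ffun 'I_(size al).+1 -> 'I_N.+1} | [forall i, c i <= b i]%N)
   B (word (fun i => c i)) ⊗
     (B (word (fun i => b i - c i)%N) ⊗ B (word (fun i => a i - b i)%N))).
  apply: eq_bigr => b _; rewrite tmap_pure // (comul_word (N := N)) => [|i]; last first.
    by rewrite -ltnS.
  rewrite (bilin_suml _ _ _ _ (tpure_bilin _ _)).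
  rewrite (lin_sum _ _ _ (@tassoc_linear _ _ _ _)).
  by apply: eq_bigr => c _; rewrite tassoc_pure.
transitivity (\sum_(c : {ffun 'I_(size al).+1 -> 'I_N.+1} | [forall i, c i <= a i]%N)
  \sum_(d : {ffun 'I_(size al).+1 -> 'I_N.+1} | [forall i, d i <= a i - c i]%N)
   B (word (fun i => c i)) ⊗
     (B (word (fun i => d i)) ⊗ B (word (fun i => a i - c i - d i)%N))); last first.
  apply: eq_bigr => b _; rewrite tmap_pure // (comul_word (N := N)) => [|i]; last first.
    by rewrite (leq_trans (leq_subr _ _)).
  by rewrite (bilin_sumr _ _ _ _ (tpure_bilin _ _)).
exact: (@sum_splits_assoc _ _ a N (fun c d e =>
  B (word c) ⊗ (B (word d) ⊗ B (word e)))).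
Qed.

Lemma heis_cocomm : cocommutative H.
Proof.
apply: span_ext1 => [||al].
- exact: (lin_comp (@tswap_linear _ _ _) ld).
- exact: ld.
rewrite -(B_headed al); set a := @headed al; pose N := sumn al.
have aN i : (a i <= N)%N := headed_le i.
rewrite (comul_word aN) (lin_sum _ _ _ (@tswap_linear _ _ _)).
rewrite -(@sum_splits_swap _ _ a N (fun c d => B (word c) ⊗ B (word d))) //.
by apply: eq_bigr => b _; rewrite tswap_pure.
Qed.

Lemma counit_bilin_l : bilin (fun x y : H => hcounit x *: y).
Proof.
split=> [v a x y|u a x y]; first by rewrite (hb_counit hB) scalerDl scalerA.
by rewrite scalerDr !scalerA mulrC.
Qed.

Lemma counit_bilin_r : bilin (fun x y : H => hcounit y *: x).
Proof. by have [l r] := counit_bilin_l; split. Qed.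

Lemma heis_counit_l x : tlift (fun a b : H => hcounit a *: b) (hcomul x) = x.
Proof.
have tl := tlift_linear counit_bilin_l.
move: x; apply: span_ext1 => [||al]; [exact: (lin_comp tl ld)|exact: lin_id|].
rewrite -(B_headed al); set a := @headed al; pose N := sumn al.
have aN i : (a i <= N)%N := headed_le i.
(* Only the splitting with [b = 0] survives the counit. *)
rewrite (comul_word aN) (lin_sum _ _ _ tl) (bigD1 [ffun=> ord0]) /=; last first.
  by apply/forallP => i; rewrite ffunE.
rewrite (tlift_pure counit_bilin_l) (hb_counitE hB) sumn_word.
rewrite big1 => [|i _]; last by rewrite ffunE.
rewrite scale1r big1 ?addr0 => [|b /andP[_ bN]].
  by apply: eq_B_word => i; rewrite ffunE subn0.
rewrite (tlift_pure counit_bilin_l) (hb_counitE hB) sumn_word.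
case: eqP => [b0|]; last by rewrite scale0r.
case/eqP: bN; apply/ffunP => i; apply/val_inj; rewrite ffunE /=.
by apply/eqP; rewrite -leqn0 -b0; exact: (leq_sum1 (fun i => b i : nat)).
Qed.

(** Follows from the left law by cocommutativity. *)
Lemma heis_counit_r x : tlift (fun a b : H => hcounit b *: a) (hcomul x) = x.
Proof.
rewrite -[RHS]heis_counit_l -[in RHS]heis_cocomm; move: (hcomul x).
apply: tens_ext => [||u v]; first exact/tlift_linear/counit_bilin_r.
  exact: (lin_comp (tlift_linear counit_bilin_l) (@tswap_linear _ _ _)).
by rewrite tswap_pure (tlift_pure counit_bilin_l) (tlift_pure counit_bilin_r).
Qed.

Lemma heis_comulM x y :
  hcomul (x ** y) = tmul (@hmul k H) (hcomul x) (hcomul y).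
Proof.
have bt := tmul_bilin bm.
move: x; apply: span_ext1 => [||al].
- exact: (lin_comp ld (bm.1 y)).
- exact: (lin_comp (bt.1 _) ld).
move: y; apply: span_ext1 => [||be].
- exact: (lin_comp ld (bm.2 (B al))).
- exact: (lin_comp (bt.2 _) ld).
rewrite -(B_headed al) -(B_headed be); set a := @headed al; set b := @headed be.
pose N := (sumn al + sumn be)%N.
have abN : (\sum_i a i + \sum_j b j <= N)%N by rewrite !headed_sum.
have aN i : (a i <= N)%N by rewrite (leq_trans (headed_le i)) // leq_addr.
have bN i : (b i <= N)%N by rewrite (leq_trans (headed_le i)) // leq_addl.
rewrite (mul_words (pointed_ord _) (pointed_ord _) _ _ abN) //.
rewrite (lin_sum _ _ _ ld) (comul_word aN) (comul_word bN).
pose G (u v : 'I_(size be).+1 * 'I_(size al).+1 -> nat) := B (word u) ⊗ B (word v).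
transitivity (\sum_(P : {ffun 'I_(size be).+1 * 'I_(size al).+1 -> 'I_N.+1} |
    filling ord0 ord0 a b (fun p => P p))
  \sum_(Q : {ffun 'I_(size be).+1 * 'I_(size al).+1 -> 'I_N.+1} |
    [forall p, Q p <= P p]%N) G (fun p => Q p) (fun p => P p - Q p)%N).
  by apply: eq_bigr => P _; apply: comul_word => p; rewrite -ltnS.
(* Both sides become the sum over pairs of arrays whose sum is a filling with margins [a] and
   [b]. *)
rewrite (sum_filling_splits ord0 ord0 abN G).
rewrite -(@sum_splits_fillings _ _ _ ord0 ord0 a b N abN G) // (bilin_suml _ _ _ _ bt).
apply: eq_bigr => s /forallP sa; rewrite (bilin_sumr _ _ _ _ bt).
apply: eq_bigr => t /forallP tb; rewrite (tmul_pure bm).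
have le1 (K : finType) (u v : K -> nat) : (forall x, (u x <= v x)%N) ->
    (\sum_x u x <= \sum_x v x)%N by move=> uv; apply: leq_sum => x _.
have s0 : s ord0 = 0%N :> nat by apply/eqP; rewrite -leqn0 (sa ord0).
have t0 : t ord0 = 0%N :> nat by apply/eqP; rewrite -leqn0 (tb ord0).
rewrite (mul_words (pointed_ord _) (pointed_ord _) (N := N)) //; last first.
  by apply: leq_trans abN; apply: leq_add; apply: le1.
rewrite (mul_words (pointed_ord _) (pointed_ord _) (N := N)) //; last first.
  by apply: leq_trans abN; apply: leq_add; apply: le1 => x; exact: leq_subr.
by rewrite tpure_sum.
Qed.

Lemma heis_counit1 : hcounit (hone H) = 1.
Proof. by rewrite (hb_one hB) (hb_counitE hB). Qed.

Lemma heis_bialgebra : is_bialgebra H.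
Proof.
split.
- exact: bm.
- exact: heis_mulA.
- exact: heis_mul1l.
- exact: heis_mul1r.
- exact: ld.
- exact: (hb_counit hB).
- exact: heis_comulA.
- exact: heis_counit_l.
- exact: heis_counit_r.
- exact: heis_comulM.
- exact: heis_comul1.
- exact: heis_counitM.
- exact: heis_counit1.
Qed.

End HeisBialgebra.

(** * Antipodes *)

Section Convolution.
Context (k : fieldType) (H : hopf_data k) (bH : is_bialgebra H).
Context (A : lmodType k) (m : A -> A -> A) (one : A).
Hypotheses (bm : bilin m) (mA : associative m) (m1l : left_id one m)
  (m1r : right_id one m).
Implicit Types f g h : H -> A.

Let ld := hcomul_linear bH.

(** Convolution of maps from [H] to an algebra [A]. The target is kept general because comparing
    antipodes along a morphism uses maps between two different bialgebras. *)
Definition conv f g (x : H) : A := tlift (fun a b => m (f a) (g b)) (hcomul x).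

Definition conv1 (x : H) : A := hcounit x *: one.

Lemma conv_bilin f g : linear f -> linear g -> bilin (fun a b => m (f a) (g b)).
Proof. exact: bilin_comp. Qed.

Lemma conv_linear f g : linear f -> linear g -> linear (conv f g).
Proof. by move=> lf lg; exact: (lin_comp (tlift_linear (conv_bilin lf lg)) ld). Qed.

Lemma conv1_linear : linear conv1.
Proof. by move=> a x y; rewrite /conv1 (hcounit_linear bH) scalerDl scalerA. Qed.

Lemma conv_tmap f g x : linear f -> linear g ->
  tlift m (tmap f g (hcomul x)) = conv f g x.
Proof.
move=> lf lg; rewrite /conv; move: (hcomul x); apply: tens_ext => [||a b].
- exact: (lin_comp (tlift_linear bm) (tmap_linear lf lg)).
- exact: (tlift_linear (conv_bilin lf lg)).
- by rewrite tmap_pure // (tlift_pure bm) (tlift_pure (conv_bilin lf lg)).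
Qed.

(** Both sides evaluate one trilinear expression on an iterated coproduct of [x], and
    coassociativity identifies the two iterated coproducts. *)
Lemma convA f g h : linear f -> linear g -> linear h ->
  conv f (conv g h) =1 conv (conv f g) h.
Proof.
move=> lf lg lh x.
have bgh := conv_bilin lg lh; have bfg := conv_bilin lf lg.
pose P (c : H) (t : tens H H) := m (f c) (tlift (fun d b => m (g d) (h b)) t).
have bP : bilin P by apply: (bilin_comp bm lf); exact: tlift_linear.
have lP := tlift_linear bP.
have lgh := conv_linear lg lh; have lfg := conv_linear lf lg.
have E1 : tlift P (tmap id (@hcomul k H) (hcomul x)) = conv f (conv g h) x.
  rewrite [in RHS]/conv; move: (hcomul x); apply: tens_ext => [||a b].
  - exact: (lin_comp lP (tmap_linear (@lin_id _ H) ld)).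
  - exact: (tlift_linear (conv_bilin lf lgh)).
  - by rewrite tmap_pure // (tlift_pure bP) (tlift_pure (conv_bilin lf lgh)).
rewrite -E1 -(hcomulA bH) /conv; move: (hcomul x); apply: tens_ext => [||a b].
- apply: (lin_comp lP); apply: (lin_comp (@tassoc_linear _ _ _ _)).
  exact: (tmap_linear ld).
- exact: (tlift_linear (conv_bilin lfg lh)).
rewrite tmap_pure // (tlift_pure (conv_bilin lfg lh)) /conv.
have lb : linear (fun u : tens H H => u ⊗ b) := (tpure_bilin _ _).1 b.
move: (hcomul a); apply: tens_ext => [||c d].
- exact: (lin_comp lP (lin_comp (@tassoc_linear _ _ _ _) lb)).
- exact: (lin_comp (bm.1 (h b)) (tlift_linear bfg)).
- by rewrite tassoc_pure (tlift_pure bP) /P (tlift_pure bgh) (tlift_pure bfg) mA.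
Qed.

Lemma conv1l f : linear f -> conv conv1 f =1 f.
Proof.
move=> lf x; rewrite /conv -[RHS](congr1 f (hcounit_l bH x)).
have bc : bilin (fun x y : H => hcounit x *: y).
  split=> [v a u w|u a v w]; first by rewrite (hcounit_linear bH) scalerDl scalerA.
  by rewrite scalerDr !scalerA mulrC.
have bf := conv_bilin conv1_linear lf.
move: (hcomul x); apply: tens_ext => [||a b].
- exact: tlift_linear.
- exact: (lin_comp lf (tlift_linear bc)).
- by rewrite (tlift_pure bf) (tlift_pure bc) (linZ _ _ lf) (linZ _ _ (bm.1 _)) m1l.
Qed.

Lemma conv1r f : linear f -> conv f conv1 =1 f.
Proof.
move=> lf x; rewrite /conv -[RHS](congr1 f (hcounit_r bH x)).
have bc : bilin (fun x y : H => hcounit y *: x).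
  split=> [v a u w|u a v w]; last by rewrite (hcounit_linear bH) scalerDl scalerA.
  by rewrite scalerDr !scalerA mulrC.
have bf := conv_bilin lf conv1_linear.
move: (hcomul x); apply: tens_ext => [||a b].
- exact: tlift_linear.
- exact: (lin_comp lf (tlift_linear bc)).
- by rewrite (tlift_pure bf) (tlift_pure bc) (linZ _ _ lf) (linZ _ _ (bm.2 _)) m1r.
Qed.

End Convolution.

(** * The antipode as a geometric series *)

Section Takeuchi.
Context (k : fieldType) (H : hopf_data k) (bH : is_bialgebra H).
Local Notation m := (@hmul k H).
Local Notation one := (hone H).
Local Notation cv := (conv m).

Let bm := hmul_bilin bH.
Let mA := hmulA bH.
Let m1l := hmul1l bH.
Let m1r := hmul1r bH.
Let l1 : linear (@conv1 k H H one) := conv1_linear bH one.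

(* The antipode is the sum of the convolution powers of this map. *)
Definition takeuchi_term : H -> H := fun x => conv1 one x - x.

Fixpoint conv_pow n : H -> H :=
  if n is n'.+1 then cv takeuchi_term (conv_pow n') else conv1 one.

Hypothesis nilp : forall x, exists N, forall n, (N <= n)%N -> conv_pow n x = 0.

Lemma takeuchi_term_linear : linear takeuchi_term.
Proof.
by move=> a x y; rewrite /takeuchi_term l1 scalerBr opprD addrACA.
Qed.

Let lu := takeuchi_term_linear.

Lemma conv_pow_linear n : linear (conv_pow n).
Proof. by elim: n => [|n IH] /=; [exact: l1|exact: (conv_linear bH bm)]. Qed.

Let lp := conv_pow_linear.

(** [conv_pow] adds factors on the left; the left antipode law needs them on the right. *)
Lemma conv_powSr n : conv_pow n.+1 =1 cv (conv_pow n) takeuchi_term.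
Proof.
elim: n => [|n IH] x.
  by rewrite /= (conv1r bH bm m1r) // (conv1l bH bm m1l).
rewrite -[conv_pow n.+2]/(cv takeuchi_term (conv_pow n.+1)).
rewrite -[in RHS]/(cv takeuchi_term (conv_pow n)) -(convA bH bm mA) //.
by congr (tlift _ _); do 2!apply/funext => ?; rewrite -IH.
Qed.

Lemma takeuchi_antipode : exists S : H -> H, is_antipode S.
Proof.
have [N NP] := choice nilp.
pose S x := \sum_(i < N x) conv_pow i x.
(* The truncation [N x] depends on [x]. Any later truncation gives the same value, so finitely many
   vectors can share one. *)
have SE x M : (N x <= M)%N -> S x = \sum_(i < M) conv_pow i x.
  move=> NM; rewrite /S -!(big_mkord xpredT (fun i => conv_pow i x)).
  rewrite [RHS](@big_cat_nat _ _ _ (N x)) //= [X in _ + X]big_nat_cond.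
  by rewrite [X in _ + X]big1 ?addr0 // => i /andP[/andP[/NP]].
have lS : linear S.
  move=> a x y; pose M := maxn (N (a *: x + y)) (maxn (N x) (N y)).
  rewrite !(SE _ M) ?leq_max ?leqnn ?orbT // scaler_sumr -big_split.
  by apply: eq_bigr => i _; rewrite lp.
(* A tensor is a finite sum of pure tensors, so a single truncation of [S] is valid for all of them
   at once. *)
have approx (c : (H -> H) -> H -> H -> H)
    (cl : forall f, linear f -> bilin (c f))
    (cS : forall x y, exists M0, forall M, (M0 <= M)%N ->
       c S x y = \sum_(i < M) c (conv_pow i) x y) (t : tens H H) :
   exists M0, forall M, (M0 <= M)%N ->
     tlift (c S) t = \sum_(i < M) tlift (c (conv_pow i)) t.
  have [s ->] := tens_span t; elim: s => [|p s [M0 IH]].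
    exists 0%N => M _; rewrite big_nil (lin0 (tlift_linear (cl S lS))).
    by rewrite big1 // => i _; rewrite (lin0 (tlift_linear (cl _ (lp i)))).
  have [M1 M1P] := cS p.2.1 p.2.2; exists (maxn M0 M1) => M.
  rewrite geq_max => /andP[M0M M1M].
  rewrite big_cons (tlift_linear (cl S lS)) (tlift_pure (cl S lS)).
  rewrite (IH M) // (M1P M) // scaler_sumr -big_split; apply: eq_bigr => i _ /=.
  by rewrite (tlift_linear (cl _ (lp i))) (tlift_pure (cl _ (lp i))).
have idE x : x = conv1 one x - takeuchi_term x.
  by rewrite /takeuchi_term opprB addrCA subrr addr0.
exists S; split=> // x; rewrite (conv_tmap bm) //.
- have bS (f : H -> H) : linear f -> bilin (fun a b => m (f a) (takeuchi_term b)).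
    by move=> lf; exact: (conv_bilin bm lf lu).
  have [|M0 M0P] := @approx (fun f a b => m (f a) (takeuchi_term b)) bS _ (hcomul x).
    by move=> y z; exists (N y) => M NM; rewrite (SE y M NM) (bilin_suml _ _ _ _ bm).
  (* As [id] is the convolution unit minus [takeuchi_term], convolving with it is a difference of
     two terms. *)
  have E : cv S id x = cv S (conv1 one) x - cv S takeuchi_term x.
    rewrite /conv; move: (hcomul x); apply: tens_ext => [||a b].
    + exact/tlift_linear/(conv_bilin bm lS (@lin_id _ _)).
    + move=> a u v; rewrite (tlift_linear (conv_bilin bm lS l1)).
      by rewrite (tlift_linear (conv_bilin bm lS lu)) scalerBr opprD addrACA.
    + rewrite (tlift_pure (conv_bilin bm lS (@lin_id _ _))).
      rewrite (tlift_pure (conv_bilin bm lS l1)) (tlift_pure (conv_bilin bm lS lu)).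
      by rewrite -(linB _ _ (bm.2 _)) -idE.
  rewrite E (conv1r bH bm m1r) //.
  (* Past both bounds the difference telescopes: the powers [0] to [M] minus the powers [1] to [M]
     leave the unit. *)
  pose M := maxn M0 (N x).
  rewrite [cv S _ x](M0P M) ?leq_maxl // (SE _ M.+1) ?leqW ?leq_maxr //.
  rewrite big_ord_recl; apply/eqP; rewrite subr_eq; apply/eqP.
  congr (_ + _); apply: eq_bigr => i _.
  by rewrite -[RHS]/(cv (conv_pow i) takeuchi_term x) -conv_powSr.
- have bS (f : H -> H) : linear f -> bilin (fun a b => m (takeuchi_term a) (f b)).
    by move=> lf; exact: (conv_bilin bm lu lf).
  have [|M0 M0P] := @approx (fun f a b => m (takeuchi_term a) (f b)) bS _ (hcomul x).
    by move=> y z; exists (N z) => M NM; rewrite (SE z M NM) (bilin_sumr _ _ _ _ bm).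
  have E : cv id S x = cv (conv1 one) S x - cv takeuchi_term S x.
    rewrite /conv; move: (hcomul x); apply: tens_ext => [||a b].
    + exact/tlift_linear/(conv_bilin bm (@lin_id _ _) lS).
    + move=> a u v; rewrite (tlift_linear (conv_bilin bm l1 lS)).
      by rewrite (tlift_linear (conv_bilin bm lu lS)) scalerBr opprD addrACA.
    + rewrite (tlift_pure (conv_bilin bm (@lin_id _ _) lS)).
      rewrite (tlift_pure (conv_bilin bm l1 lS)) (tlift_pure (conv_bilin bm lu lS)).
      by rewrite -(linB _ _ (bm.1 _)) -idE.
  rewrite E (conv1l bH bm m1l) //.
  pose M := maxn M0 (N x).
  rewrite [cv _ S x](M0P M) ?leq_maxl // (SE _ M.+1) ?leqW ?leq_maxr //.
  rewrite big_ord_recl; apply/eqP; rewrite subr_eq; apply/eqP.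
  by congr (_ + _); apply: eq_bigr.
Qed.

End Takeuchi.

(** * Bialgebra morphisms preserve antipodes *)

Section HopfMorphism.
Context (k : fieldType) (H K : hopf_data k) (bH : is_bialgebra H) (bK : is_bialgebra K).

(** In the convolution algebra of maps from [H] to [K], the composite of [f] after [S] is a left
    inverse of [f] and that of [T] after [f] a right inverse; by associativity they agree. *)
Lemma bialgebra_morph_antipode (f : H -> K) (S : H -> H) (T : K -> K) :
  linear f -> (forall x y, f (hmul x y) = hmul (f x) (f y)) ->
  f (hone H) = hone K ->
  (forall x, hcomul (f x) = tmap f f (hcomul x)) ->
  (forall x, hcounit (f x) = hcounit x) ->
  is_antipode S -> is_antipode T -> forall x, f (S x) = T (f x).
Proof.
move=> lf fM f1 fD fe [lS Sl _] [lT _ Tr] x.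
have bm := hmul_bilin bK; have bmH := hmul_bilin bH.
have lfS := lin_comp lf lS; have lTf := lin_comp lT lf.
have Ef : conv (@hmul k K) (fun y => f (S y)) f =1 @conv1 k H K (hone K).
  move=> y; rewrite /conv1 -f1 -(linZ _ _ lf) -Sl (conv_tmap bmH) // /conv.
  move: (hcomul y); apply: tens_ext => [||a b].
  - exact/tlift_linear/(conv_bilin bm lfS lf).
  - exact/(lin_comp lf)/tlift_linear/(conv_bilin bmH lS (@lin_id _ _)).
  - rewrite (tlift_pure (conv_bilin bm lfS lf)).
    by rewrite (tlift_pure (conv_bilin bmH lS (@lin_id _ _))) fM.
have Fe : conv (@hmul k K) f (fun y => T (f y)) =1 @conv1 k H K (hone K).
  move=> y; rewrite /conv1 -fe -Tr (conv_tmap bm) // /conv fD.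
  move: (hcomul y); apply: tens_ext => [||a b].
  - exact/tlift_linear/(conv_bilin bm lf lTf).
  - apply: lin_comp; last exact: tmap_linear.
    exact/tlift_linear/(conv_bilin bm (@lin_id _ _) lT).
  - rewrite (tlift_pure (conv_bilin bm lf lTf)) tmap_pure //.
    by rewrite (tlift_pure (conv_bilin bm (@lin_id _ _) lT)).
rewrite -(conv1r bH bm (hmul1r bK) lfS x) -(conv1l bH bm (hmul1l bK) lTf x).
rewrite -[in LHS](funext Fe) -[in RHS](funext Ef).
exact: (convA bH bm (hmulA bK) lfS lf lTf).
Qed.

End HopfMorphism.

Lemma sum_sub_lt (I : finType) (a b : I -> nat) :
  (forall i, (b i <= a i)%N) -> (\sum_i b i != 0)%N ->
  (\sum_i (a i - b i) < \sum_i a i)%N.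
Proof.
move=> ba b0; rewrite [X in (_ < X)%N](_ : _ = \sum_i (a i - b i) + \sum_i b i)%N.
  by rewrite -[X in (X < _)%N]addn0 ltn_add2l lt0n.
by rewrite -big_split; apply: eq_bigr => i _; rewrite /= subnK.
Qed.

Section HeisHopf.
Context (k : fieldType) (H : hopf_data k) (B : seq nat -> H).
Hypothesis hB : heis_basis B.
Let bH := heis_bialgebra hB.

Lemma heis_nilpotent x : exists N, forall n, (N <= n)%N -> conv_pow n x = 0 :> H.
Proof.
have lp n := conv_pow_linear bH n.
have [s ->] := hb_span hB x; rewrite /malg_lift.
elim: (enum_fset _) => [|al r [N IH]] /=.
  exists 0%N => n _; rewrite big_nil; exact: lin0.
exists (maxn N (sumn al).+1) => n; rewrite geq_max => /andP[Nn an].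
rewrite big_cons (linD _ _ (lp n)) IH // addr0 (linZ _ _ (lp n)).
(* Each convolution factor consumes at least one degree: [takeuchi_term] kills the unit, so the
   other tensor factor has strictly smaller degree. *)
suff E m t : (sumn t < m)%N -> conv_pow m (B t) = 0 :> H by rewrite E ?scaler0.
elim: m t => // m IHm t tm; rewrite /= /conv -(B_headed hB).
have bl := conv_bilin (hmul_bilin bH) (takeuchi_term_linear bH) (lp m).
rewrite (comul_word hB (@headed_le t)) (lin_sum _ _ _ (tlift_linear bl)) big1 // => b.
move=> /forallP bt; rewrite (tlift_pure bl).
have [b0|bN] := eqVneq (\sum_i b i)%N 0%N.
  rewrite (sumn0_one hB) ?sumn_word // /takeuchi_term /conv1 (hcounit1 bH) scale1r.
  by rewrite subrr (lin0 ((hmul_bilin bH).1 _)).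
rewrite IHm ?(lin0 ((hmul_bilin bH).2 _)) //.
rewrite -ltnS; apply: leq_trans tm; rewrite ltnS sumn_word.
by apply: leq_trans (sum_sub_lt bt bN) _; rewrite headed_sum.
Qed.

Lemma heis_hopf : is_hopf H.
Proof. by split; [exact: bH|apply: (takeuchi_antipode bH); exact: heis_nilpotent]. Qed.

End HeisHopf.

(** * The basis of Sigma *)

Section PartialSums.

Lemma comp_gt0 (al : composition) i : (i < size al)%N -> (0 < nth 0 al i)%N.
Proof. by case: al => s /= /all_nthP; apply. Qed.

Lemma comp_nil (al : composition) : (al == [::] :> seq nat) = (sumn al == 0%N).
Proof.
by case: al => -[//|x s] /= /andP[x0 _]; rewrite addn_eq0 -leqn0 leqNgt x0.
Qed.

Lemma sumn_takeS s i : sumn (take i.+1 s) = (sumn (take i s) + nth 0 s i)%N.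
Proof.
elim: s i => [|x s IH] [|i] //=; first by rewrite take0 addn0.
by rewrite IH addnA.
Qed.

Lemma sumn_take_ltn (al : composition) i j : (i < j <= size al)%N ->
  (sumn (take i al) < sumn (take j al))%N.
Proof.
case/andP; elim: j => // j IH; rewrite ltnS leq_eqVlt => /orP[/eqP ->|ij] js.
  by rewrite sumn_takeS -[X in (X < _)%N]addn0 ltn_add2l comp_gt0.
apply: leq_trans (IH ij (ltnW js)) _.
by rewrite sumn_takeS leq_addr.
Qed.

Lemma size_psums al : size (psums al) = (size al).-1.
Proof. by rewrite size_map size_iota. Qed.

Lemma nth_psums al i : (i.+1 < size al)%N ->
  nth 0%N (psums al) i = sumn (take i.+1 al).
Proof.
move=> ia; have ia' : (i < (size al).-1)%N by rewrite -ltnS; case: (size al) ia.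
by rewrite (nth_map 0%N) ?size_iota // nth_iota.
Qed.

Lemma psums_sorted (al : composition) : sorted ltn (psums al).
Proof.
apply/(sortedP 0%N) => i; rewrite size_psums => ia.
have ia' : (i.+2 < size al)%N by case: (size al) ia.
rewrite !nth_psums // ?(ltnW ia') //; apply: sumn_take_ltn.
by rewrite ltnSn ltnW.
Qed.

Lemma psums_bounds (al : composition) j :
  j \in psums al -> (0 < j < sumn al)%N.
Proof.
case/mapP => i; rewrite mem_iota => /andP[i0 ia] ->.
have {}ia : (i < size al)%N.
  case: (size al) ia => [|m]; last by rewrite add1n.
  by rewrite addn0 ltnNge i0.
apply/andP; split.
  by have := @sumn_take_ltn al 0 i; rewrite take0 i0 (ltnW ia); apply.
by have := @sumn_take_ltn al i (size al); rewrite take_size ia leqnn; apply.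
Qed.

Lemma psums_inj (al be : composition) :
  sumn al = sumn be -> psums al = psums be -> al = be.
Proof.
move=> ab pab; have sab : size al = size be.
  have := congr1 size pab; rewrite !size_psums.
  (* The empty composition and a one-part composition both have empty [psums]; the equality of sums
     tells them apart. *)
  have /eqP := comp_nil al; have := comp_nil be; rewrite ab => <-.
  by case: al be {ab pab} => [[|x s] ?] [[|y t] ?] //= _ [->].
apply/val_inj/(@eq_from_nth _ 0%N) => //= i ia.
have T j : (j <= size al)%N -> sumn (take j al) = sumn (take j be).
  case: j => [|j]; first by rewrite !take0.
  rewrite leq_eqVlt => /orP[/eqP jE|ja].
    by rewrite jE take_size sab take_size.
  by rewrite -!nth_psums ?pab // -sab.
have := T i.+1 ia; rewrite !sumn_takeS T ?(ltnW ia) //.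
exact: addnI.
Qed.

(** The triangularity behind independence: a refinement of [be] with no more parts than [be] is [be]
    itself. *)
Lemma psums_sub (al be : composition) : sumn al = sumn be ->
  {subset psums be <= psums al} -> (size al <= size be)%N -> al = be.
Proof.
move=> ab sub sz; apply: psums_inj => //.
have ub : uniq (psums be) := sorted_uniq ltn_trans ltnn (psums_sorted be).
have sz' : (size (psums al) <= size (psums be))%N.
  by rewrite !size_psums -!subn1 leq_sub2r.
have [_ e] := uniq_min_size ub sub sz'.
apply: (irr_sorted_eq ltn_trans ltnn) => //; try exact: psums_sorted.
Qed.

End PartialSums.

(** * A permutation whose descent set is given *)

Section DescentSet.
Context (be : composition).
Let n := sumn be.

(** Number of the run containing position [p]. Positions count from 0 here, so a partial sum [s] is
    the first position of a new run. *)
Definition block (p : 'I_n) := count (fun s => s <= p)%N (psums be).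

(* The blocks are increasing and each takes smaller values than the previous one. *)
Definition val_lt (q p : 'I_n) :=
  (block p < block q)%N || ((block q == block p) && (q < p)%N).

Lemma val_lt_irr p : val_lt p p = false.
Proof. by rewrite /val_lt ltnn eqxx ltnn. Qed.

Lemma val_lt_trans : transitive val_lt.
Proof.
move=> y x z /orP[xy|/andP[/eqP xy lxy]] /orP[yz|/andP[/eqP yz lyz]];
  apply/orP; [left|left|left|right].
- exact: ltn_trans xy.
- by rewrite -yz.
- by rewrite xy.
- by rewrite xy yz eqxx (ltn_trans lxy).
Qed.

Lemma val_lt_total p q : p != q -> val_lt p q || val_lt q p.
Proof.
by rewrite /val_lt -val_eqE neq_ltn /=; case: (ltngtP (block p) (block q)).
Qed.

Lemma rank_subproof p : (#|[set q | val_lt q p]| < n)%N.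
Proof.
rewrite -[X in (_ < X)%N]card_ord; apply/proper_card/properP.
by split; [by apply/fintype.subsetP|exists p; rewrite ?inE ?val_lt_irr].
Qed.

Definition rank p := Ordinal (rank_subproof p).

Lemma rank_mono p q : val_lt q p -> (rank q < rank p)%N.
Proof.
move=> qp; apply: proper_card; apply/properP; split.
  by apply/fintype.subsetP => r; rewrite !inE => /val_lt_trans; apply.
by exists q; rewrite !inE // val_lt_irr.
Qed.

Lemma rank_ltE p q : (rank q < rank p)%N = val_lt q p.
Proof.
apply/idP/idP => [qp|]; last exact: rank_mono.
have [e|/val_lt_total /orP[pq|//]] := eqVneq p q; first by rewrite e ltnn in qp.
by have := ltn_trans qp (rank_mono pq); rewrite ltnn.
Qed.

Lemma rank_inj : injective rank.
Proof.
move=> p q pq; apply/eqP; apply: contraT => /val_lt_total.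
by rewrite -!rank_ltE pq ltnn.
Qed.

Definition desc_perm : 'S_n := perm rank_inj.

(** Values increase within a run and drop when the run changes, which happens between the 0-based
    positions [i - 1] and [i] exactly when [i] is a partial sum. *)
Lemma Des_desc_perm : Des desc_perm =i psums be.
Proof.
move=> i; apply/mapP/idP => [[j]|iS].
  rewrite mem_filter => /andP[/existsP[l /andP[/eqP lj]]].
  rewrite !permE rank_ltE => /orP[bl|/andP[_]]; last by rewrite lj ltnNge leqnSn.
  move=> _ ->; apply: contraLR bl => jN; rewrite -leqNgt.
  rewrite /block (@eq_in_count _ (fun s => s <= l)%N (fun s => s <= j)%N) // => s sS.
  by rewrite lj leq_eqVlt ltnS; case: eqVneq sS => // ->; rewrite (negPf jN).
have /andP[i0 iN] := psums_bounds iS.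
have jN : (i.-1 < n)%N by rewrite (leq_ltn_trans (leq_pred _)).
exists (Ordinal jN); last by rewrite /= prednK.
rewrite mem_filter mem_enum andbT; apply/existsP; exists (Ordinal iN).
rewrite /= prednK // eqxx !permE rank_ltE /val_lt.
suff -> : (block (Ordinal jN) < block (Ordinal iN))%N by [].
rewrite /block -!size_filter.
have -> : [seq s <- psums be | (s <= i.-1)%N] =
    [seq s <- [seq s <- psums be | (s <= i)%N] | s != i].
  rewrite -filter_predI; apply: eq_filter => s /=.
  by rewrite -ltnS prednK // ltn_neqAle.
rewrite [X in (X < _)%N]size_filter -[X in (_ < X)%N](count_predC (pred1 i)).
rewrite -[X in (X < _)%N]add0n ltn_add2r -has_count; apply/hasP; exists i => //=.
by rewrite mem_filter leqnn.
Qed.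

End DescentSet.

Section SigmaBasis.
Context (k : fieldType).

Lemma mcoeff_X_elt al n (s : 'S_n) :
  (X_elt k al)@_(Tagged (fun n => 'S_n) s)
    = ((sumn al == n) && all (mem (psums al)) (Des s))%:R.
Proof.
rewrite /X_elt raddf_sum /=.
case: eqP => [e|ne]; last first.
  rewrite big1 // => t _; rewrite mcoeffU.
  by case: eqP => // /(congr1 tag) /= /ne.
case: n / e s => s; rewrite big_mkcond (bigD1 s) //= big1 => [|t ts].
  by rewrite addr0; case: ifP => //; rewrite mcoeffU eqxx.
by rewrite mcoeffU eq_Tagged /= (negPf ts) if_same.
Qed.

Lemma dsval_linear : linear (@dsval k).
Proof. exact: (linearP (val : descent_space k -> _)). Qed.

Lemma dsval_coeff_linear z : linear (fun v : descent_space k => (dsval v)@_z : k^o).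
Proof. by move=> a u v; rewrite dsval_linear mcoeffD mcoeffZ. Qed.

Lemma dsval_coeffZ z a (v : descent_space k) :
  (dsval (a *: v))@_z = a * (dsval v)@_z.
Proof. exact: (linZ _ _ (dsval_coeff_linear z)). Qed.

Lemma X_indep (x : {malg k[composition]}) : malg_lift (@X k) x = 0 -> x = 0.
Proof.
move=> x0; apply/malgP => al0; rewrite mcoeff0.
(* Descending induction on the number of parts. Evaluation at [desc_perm be] sees only those [al]
   whose partial sums contain those of [be]; besides [be] itself they are longer, and their
   coefficients already vanish. *)
have [m] := ubnP (\max_(al <- msupp x) size al - size al0)%N.
elim: m al0 => // m IH be bem.
have : (dsval (malg_lift (@X k) x))@_(Tagged (fun n => 'S_n) (desc_perm be)) = 0.
  by rewrite x0; exact: mcoeff0.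
rewrite /malg_lift (lin_sum _ _ _ (dsval_coeff_linear _)).
have [bx|] := boolP (be \in msupp x); last by move=> /mcoeff_outdom.
rewrite (big_fsetD1 be) // dsval_coeffZ mcoeff_X_elt eqxx (eq_all_r (Des_desc_perm be)).
have -> : all (mem (psums be)) (psums be) by apply/allP.
rewrite mulr1 big1_seq => [|al /andP[_]]; first by move=> e; rewrite -[LHS]addr0 -[RHS]e.
rewrite in_fsetD1 => /andP[alN ax].
rewrite dsval_coeffZ mcoeff_X_elt.
rewrite (eq_all_r (Des_desc_perm be)).
have [ab|] := eqVneq (sumn al) (sumn be); last by rewrite mulr0.
have [/allP sub|] := boolP (all _ _); last by rewrite mulr0.
have [le|lt] := leqP (size al) (size be).
  by rewrite (psums_sub ab sub le) eqxx in alN.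
rewrite IH ?mul0r //; rewrite -ltnS; apply: leq_trans bem; rewrite ltnS ltn_sub2l //.
apply: leq_trans lt _.
by rewrite (big_rem al) //= leq_maxl.
Qed.

Lemma X_span : spanning (@X k).
Proof.
move=> u; case: u => x /[dup] /asboolP[s sE] xS.
exists (\sum_(p <- s) p.1 *: << p.2 >>).
rewrite (lin_sum _ _ _ (malg_lift_linear _)); apply/val_inj.
rewrite [LHS]sE [RHS](lin_sum _ _ _ dsval_linear); apply: eq_bigr => p _.
by rewrite (linZ _ _ (malg_lift_linear _)) malg_liftU (linZ _ _ dsval_linear).
Qed.

Lemma Sigma_counitE al : Sigma_counit (X k al) = (sumn al == 0%N)%:R.
Proof.
rewrite /Sigma_counit mcoeff_X_elt /Des.
by case: (enum 'I_0) => [|[]] //=; rewrite andbT.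
Qed.

Lemma X_lift0 (V : lmodType k) (phi : composition -> V) x :
  malg_lift (@X k) x = 0 -> malg_lift phi x = 0.
Proof. by move=> /X_indep ->; exact: (lin0 (malg_lift_linear phi)). Qed.

Lemma Sigma_mulP : Sigma_mul_spec (@hmul k (Sigma k)).
Proof.
apply: xgetPex.
have [m bm mE] := @span_extend2 k _ _ _ _ _ (@X k) (@X k) (fun al be : composition =>
  \sum_(maxn (sumn al) (sumn be) <= n < (sumn al + sumn be).+1)
        \sum_(M in heis_mx n al be) X k (mx_comp M)) X_span X_span
  (fun _ => @X_lift0 _ _) (fun _ => @X_lift0 _ _).
by exists m.
Qed.

Lemma Sigma_comulP : Sigma_comul_spec (@hcomul k (Sigma k)).
Proof.
apply: xgetPex.
have [D lD DE] := span_extend X_span (@X_lift0 _ (fun al : composition =>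
      \sum_(b : {ffun 'I_(size al) -> 'I_(sumn al).+1} |
              [forall i, (b i <= nth 0 al i)%N])
        X k (hat [seq (b i : nat) | i : 'I_(size al) <- enum 'I_(size al)])
        ⊗ X k (hat [seq (nth 0 al i - b i)%N | i : 'I_(size al) <- enum 'I_(size al)]))).
by exists D.
Qed.

Lemma Sigma_basis : @heis_basis k (Sigma k) (fun s => X k (hat s)).
Proof.
split.
- by move=> s; rewrite hat_hat.
- move=> u; have [x ->] := X_span u; exists x; apply: eq_bigr => al _.
  by rewrite hat_comp.
- exact: Sigma_mulP.1.
- move=> al be; rewrite !hat_comp Sigma_mulP.2; apply: eq_bigr => n _.
  by apply: eq_bigr => M _; rewrite hat_comp.
- by [].
- exact: Sigma_comulP.1.
- by move=> al; rewrite hat_comp Sigma_comulP.2.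
- exact: dsval_coeff_linear.
- by move=> s; rewrite [LHS]Sigma_counitE sumn_hat.
Qed.

End SigmaBasis.

Local Notation mon := {cmonom nat}.

(** * The ring of symmetric functions *)

Section MonomialDivisors.
Implicit Types m u v : mon.

(** Turns the sum over a classical set in [series_mul] into an honest finite sum. A divisor is given
    by exponents at most [mdeg m] on the support of [m], and the cofactor is then determined. *)
Lemma finite_divs m : finite_set [set p : mon * mon | mmul p.1 p.2 = m]%classic.
Proof.
pose K := (\max_(i <- finsupp m) i)%N.
pose mk (a : {ffun 'I_K.+1 -> 'I_(mdeg m).+1}) : mon :=
  [cmonom nat_of_ord (a (inord i)) | i in finsupp m]%M.
apply: (@sub_finite_set _ _ [set (mk a, divcm m (mk a)) | a in setT]%classic).
  move=> [u v] /= uv.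
  have uvE i : m i = (u i + v i)%N by rewrite -uv cmM.
  have um i : (u i <= mdeg m)%N.
    have [im|] := boolP (i \in finsupp m).
      by rewrite mdegE (big_fsetD1 i) //= {1}uvE -addnA leq_addr.
    by rewrite -cmE_eq0 uvE addn_eq0 => /andP[/eqP -> _].
  exists [ffun i : 'I_K.+1 => inord (u i)] => //.
  have mkE : mk [ffun i : 'I_K.+1 => inord (u i)] = u.
    apply/eqP/cmP => i; rewrite cmE fsfunE.
    have [im|] := boolP (i \in finsupp m); last first.
      by rewrite -cmE_eq0 uvE addn_eq0 => /andP[/eqP -> _].
    have iK : (i <= K)%N by rewrite /K (big_fsetD1 i) //= leq_maxl.
    by rewrite ffunE !inordK ?ltnS.
  rewrite mkE; congr (_, _); apply/eqP/cmP => i.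
  by rewrite divcmE uvE addKn.
exact/finite_image/finite_finset.
Qed.

Definition divs m : {fset mon * mon} :=
  fset_set [set p : mon * mon | mmul p.1 p.2 = m]%classic.

Lemma mem_divs m p : (p \in divs m) = (mmul p.1 p.2 == m).
Proof.
rewrite in_fset_set; last exact: finite_divs.
by apply/idP/eqP => [/set_mem|] //; exact: mem_set.
Qed.

End MonomialDivisors.

Section SymfRing.
Context (k : fieldType).
Implicit Types f g h : symf k.

Lemma symf_eq f g : (forall m, f m = g m) -> f = g.
Proof. by move=> fg; apply/val_inj/funext. Qed.

Lemma symf_mulE f g m :
  symf_mul f g m = \sum_(p <- divs m) f p.1 * g p.2.
Proof. by rewrite /= /series_mul fsbig_finite //; exact: finite_divs. Qed.

Lemma symfD f g m : (f + g) m = f m + g m.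
Proof. by []. Qed.

Lemma symfZ a f m : (a *: f) m = a * f m.
Proof. by []. Qed.

Lemma symf_mulC : commutative (@symf_mul k).
Proof.
move=> f g; apply/symf_eq => m; rewrite !symf_mulE.
rewrite (perm_big [seq (p.2, p.1) | p <- divs m]) /=.
  by rewrite big_map; apply: eq_bigr => p _; rewrite mulrC.
apply: uniq_perm; first exact: fset_uniq.
  by rewrite map_inj_uniq ?fset_uniq // => -[a b] [c d] [-> ->].
move=> [a b]; apply/idP/mapP => [|[[c d] cd [-> ->]]].
  by rewrite mem_divs => ab; exists (b, a); rewrite // mem_divs mulmC.
by move: cd; rewrite !mem_divs mulmC.
Qed.

Lemma symf_mulA : associative (@symf_mul k).
Proof.
move=> f g h; apply/symf_eq => m.
pose F (t : mon * mon * mon) : k := f t.1.1 * g t.1.2 * h t.2.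
transitivity (\sum_(t <- [seq (p.1, q.1, q.2) | p <- divs m, q <- divs p.2]) F t).
  rewrite big_allpairs_dep symf_mulE; apply: eq_bigr => p _.
  rewrite symf_mulE mulr_sumr; apply: eq_bigr => q _.
  by rewrite /F mulrA.
transitivity (\sum_(t <- [seq (q.1, q.2, p.2) | p <- divs m, q <- divs p.1]) F t); last first.
  rewrite big_allpairs_dep symf_mulE; apply: eq_bigr => p _.
  by rewrite symf_mulE mulr_suml; apply: eq_bigr.
apply: perm_big; apply: uniq_perm.
(* The outer factorization is recovered from the triple, since [p.2] is the product of the two inner
   factors. *)
- apply: allpairs_uniq_dep => [|p _|]; try exact: fset_uniq.
  move=> -[[a b] [c d]] [[a' b'] [c' d']].
  move=> /allpairsPdep[[x y] [[z t] [_ + [? ? ? ?]]]].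
  move=> + /allpairsPdep[[x' y'] [[z' t'] [_ + [? ? ? ?]]]] /= [? ? ?]; subst.
  by rewrite !mem_divs /= => /eqP <- /eqP <-.
- apply: allpairs_uniq_dep => [|p _|]; try exact: fset_uniq.
  move=> -[[a b] [c d]] [[a' b'] [c' d']].
  move=> /allpairsPdep[[x y] [[z t] [_ + [? ? ? ?]]]].
  move=> + /allpairsPdep[[x' y'] [[z' t'] [_ + [? ? ? ?]]]] /= [? ? ?]; subst.
  by rewrite !mem_divs /= => /eqP <- /eqP <-.
- move=> [[a b] c]; apply/allpairsPdep/allpairsPdep.
    move=> [[x y] [[z t] []]]; rewrite !mem_divs /= => /eqP xy /eqP zt [-> -> ->].
    exists (mmul x z, t), (x, z); split; rewrite ?mem_divs //=.
    by rewrite -mulmA zt xy.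
  move=> [[x y] [[z t] []]]; rewrite !mem_divs /= => /eqP xy /eqP zt [-> -> ->].
  exists (z, mmul t y), (t, y); split; rewrite ?mem_divs //=.
  by rewrite mulmA zt xy.
Qed.

Lemma symf_mul1 : left_id (symf_one k) (@symf_mul k).
Proof.
move=> f; apply/symf_eq => m; rewrite symf_mulE (big_fsetD1 (mone, m)) /=; last first.
  by rewrite mem_divs mul1m.
rewrite mdeg1 eqxx mul1r big1_seq ?addr0 // => -[u v] /=.
rewrite in_fsetD1 mem_divs => /andP[uv /eqP uvm].
rewrite mdeg_eq0; case: eqP => [u1|]; last by rewrite mul0r.
by rewrite u1 -uvm u1 mul1m eqxx in uv.
Qed.

Lemma symf_mulDl : left_distributive (@symf_mul k) +%R.
Proof.
move=> f g h; apply/symf_eq => m; rewrite symfD !symf_mulE -big_split.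
by apply: eq_bigr => p _; exact: mulrDl.
Qed.

(** Makes [\prod] available, so that invariance of [symf_h] under permuting the parts is that of
    commutative products. *)
HB.instance Definition _ := GRing.Zmodule_isComPzRing.Build (symf k)
  symf_mulA symf_mulC symf_mul1 symf_mulDl.

Lemma symf_mulZl a f g : a *: f * g = a *: (f * g).
Proof.
apply/symf_eq => m; rewrite symfZ !symf_mulE mulr_sumr.
by apply: eq_bigr => p _; rewrite symfZ mulrA.
Qed.

Lemma symf_mul_bilin : bilin (@symf_mul k).
Proof.
split=> [v|u] a x y.
  by rewrite symf_mulDl; congr (_ + _); exact: symf_mulZl.
rewrite symf_mulC symf_mulDl [symf_mul y u]symf_mulC; congr (_ + _).
by rewrite [symf_mul u x]symf_mulC; exact: symf_mulZl.
Qed.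

Lemma symf_hE s : symf_h k s = \prod_(a <- s) symf_h1 k a.
Proof. by elim: s => [|a s IH]; rewrite ?big_nil // big_cons -IH. Qed.

Lemma symf_h_cat s t : symf_h k (s ++ t) = symf_mul (symf_h k s) (symf_h k t).
Proof. by rewrite !symf_hE big_cat. Qed.

Lemma symf_h_perm s t : perm_eq s t -> symf_h k s = symf_h k t.
Proof. by move=> st; rewrite !symf_hE (perm_big _ st). Qed.

Lemma symf_h_hat s : symf_h k (hat s) = symf_h k s.
Proof.
rewrite !symf_hE big_filter [RHS](bigID (fun a => 0 < a)%N) /=.
rewrite [X in _ = _ * X]big1 ?mulr1 // => a; rewrite -leqNgt leqn0 => /eqP ->.
by [].
Qed.

Lemma symf_mul_mone f g : symf_mul f g mone = f mone * g mone.
Proof.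
rewrite symf_mulE (big_fsetD1 (mone, mone)) /=; last by rewrite mem_divs mul1m.
rewrite big1_seq ?addr0 // => -[u v] /=; rewrite in_fsetD1 mem_divs cmM_eq1 /=.
case/andP => uv /andP[/eqP u1 /eqP v1].
by rewrite u1 v1 eqxx in uv.
Qed.

Lemma symf_h_mone s : symf_h k s mone = (sumn s == 0%N)%:R.
Proof.
elim: s => [|a s IH]; first by rewrite /= mdeg1.
rewrite [symf_h k _]/(symf_mul _ _) symf_mul_mone IH /= mdeg1 eq_sym addn_eq0.
by rewrite -natrM mulnb.
Qed.

Lemma symf_h_deg s m : mdeg m != sumn s -> symf_h k s m = 0.
Proof.
elim: s m => [|a s IH] m; first by rewrite /= => /negPf ->.
rewrite [symf_h k _]/(symf_mul _ _) symf_mulE => ms.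
rewrite big1_seq // => -[u v] /=; rewrite mem_divs => /eqP uv.
case: eqP => [ua|]; last by rewrite mul0r.
rewrite [X in _ * X]IH ?mulr0 //; apply: contraNneq ms => vs.
by rewrite -uv /= mdegM ua vs.
Qed.

End SymfRing.

(** * Monomials up to permutation of the variables *)

Section Exponents.
Implicit Types m u v : mon.

Definition exps m : seq nat := [seq m i | i <- finsupp m].

Lemma exps_pos m : all (ltn 0) (exps m).
Proof. by apply/allP => x /mapP[i]; rewrite -cmE_neq0 -lt0n => im ->. Qed.

Lemma sumn_exps m : sumn (exps m) = mdeg m.
Proof. by rewrite sumnE big_map mdegE. Qed.

Lemma size_exps m : size (exps m) = size (finsupp m).
Proof. exact: size_map. Qed.

Lemma mexp_le_deg m i : (m i <= mdeg m)%N.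
Proof.
have [im|] := boolP (i \in finsupp m); last by rewrite -cmE_eq0 => /eqP ->.
by rewrite mdegE (big_fsetD1 i) //= leq_addr.
Qed.

Lemma perm_exps_widen m (D : {fset nat}) : (finsupp m `<=` D)%fset ->
  perm_eq [seq m i | i <- D] (exps m ++ nseq (size D - size (finsupp m)) 0%N).
Proof.
move=> mD; have e : perm_eq (finsupp m) [seq i <- D | i \in finsupp m].
  apply: uniq_perm; rewrite ?filter_uniq ?fset_uniq // => i.
  by rewrite mem_filter andb_idr // => /(fsubsetP mD).
have <- : [seq m i | i <- D & i \notin finsupp m] =
    nseq (size D - size (finsupp m)) 0%N.
  have -> : (size D - size (finsupp m))%N = count (predC (mem (finsupp m))) D.
    by rewrite (perm_size e) size_filter -(count_predC (mem (finsupp m)) D) addKn.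
  elim: (enum_fset D) => //= i s IH; case: ifP => //= im.
  by rewrite IH; congr (_ :: _); apply/eqP; rewrite cmE_eq0.
rewrite perm_sym; apply: perm_trans (perm_cat (perm_map m e) (perm_refl _)) _.
by rewrite -map_cat; apply/perm_map/permEl/perm_filterC.
Qed.

Lemma exps_perm m m' s : bijective s -> (forall i, m' i = m (s i)) ->
  perm_eq (exps m') (exps m).
Proof.
move=> [t sK tK] mE; rewrite /exps (eq_map mE) (map_comp m s).
apply/perm_map/uniq_perm.
- by rewrite (map_inj_uniq (can_inj sK)) fset_uniq.
- exact: fset_uniq.
- move=> i; apply/mapP/idP => [[j jm ->]|im].
    by rewrite -cmE_neq0 -mE cmE_neq0.
  by exists (t i); rewrite ?tK // -cmE_neq0 mE tK cmE_neq0.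
Qed.

(** The converse of [exps_perm]: orbits of monomials are exponent multisets. Padded with zeros, both
    exponent lists run over the union [D] of the supports; a permutation of [D] matching them is
    extended by the identity. *)
Lemma perm_exps_bij m m' : perm_eq (exps m) (exps m') ->
  exists2 s : nat -> nat, bijective s & forall i, m' i = m (s i).
Proof.
move=> mm; pose D := (finsupp m `|` finsupp m')%fset.
have p : perm_eq [seq m' i | i <- D] [seq m i | i <- D].
  rewrite (permPl (perm_exps_widen (fsubsetUr _ _))).
  rewrite perm_sym (permPl (perm_exps_widen (fsubsetUl _ _))).
  by rewrite -!size_exps (perm_size mm) perm_cat2r.
have [Is pI mE] := perm_iotaP 0%N p; rewrite size_map in pI.
have uI : uniq Is by rewrite (perm_uniq pI) iota_uniq.
have sI : size Is = size D by rewrite (perm_size pI) size_iota.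
have memI i : (i \in Is) = (i < size D)%N by rewrite (perm_mem pI) mem_iota.
pose s i := if i \in D then nth 0%N D (nth 0%N Is (index i D)) else i.
pose t i := if i \in D then nth 0%N D (index (index i D) Is) else i.
have uD := fset_uniq D.
have sK : cancel s t.
  move=> i; rewrite /s; case: ifP => iD; last by rewrite /t iD.
  have iI : (nth 0%N Is (index i D) < size D)%N.
    by rewrite -memI mem_nth // sI index_mem.
  by rewrite /t mem_nth // index_uniq // index_uniq ?sI ?index_mem // nth_index.
have tK : cancel t s.
  move=> i; rewrite /t; case: ifP => iD; last by rewrite /s iD.
  have iI : (index (index i D) Is < size D)%N.
    by rewrite -sI index_mem memI index_mem.
  by rewrite /s mem_nth // index_uniq // nth_index ?nth_index // memI index_mem.
exists s; first by exists t.
move=> i; rewrite /s; case: ifP => iD; last first.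
  move: iD; rewrite in_fsetU => /negbT; rewrite negb_or -!cmE_eq0.
  by case/andP => /eqP -> /eqP ->.
have iS : (index i D < size D)%N by rewrite index_mem.
rewrite -{1}(nth_index 0%N iD) -(nth_map 0%N 0%N m') // mE.
have iI : (nth 0%N Is (index i D) < size D)%N by rewrite -memI mem_nth // sI.
by rewrite (nth_map 0%N) ?sI // (nth_map 0%N).
Qed.

Definition mono (s : seq nat) : mon :=
  [cmonom nth 0%N s i | i in [fset i in iota 0 (size s)]%fset]%M.

Lemma monoE s i : mono s i = nth 0%N s i.
Proof.
rewrite cmE fsfunE in_fset /= mem_iota add0n.
by case: ltnP => // si; rewrite nth_default.
Qed.

Lemma exps_mono s : all (ltn 0) s -> perm_eq (exps (mono s)) s.
Proof.
move=> /(all_nthP 0%N) s0.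
have -> : exps (mono s) = [seq nth 0%N s i | i <- finsupp (mono s)].
  by apply: eq_map => i; rewrite monoE.
rewrite -[X in perm_eq _ X](mkseq_nth 0%N s); apply/perm_map/uniq_perm.
- exact: fset_uniq.
- exact: iota_uniq.
- move=> i; rewrite -cmE_neq0 monoE mem_iota add0n /=.
  case: (ltnP i (size s)) => [/s0|si]; last by rewrite nth_default.
  by rewrite -lt0n.
Qed.

Definition mpow i a : mon := [cmonom a | _ in fset1 i]%M.

Lemma mpowE i a j : mpow i a j = if j == i then a else 0%N.
Proof. by rewrite cmE fsfunE in_fset1. Qed.

Lemma mdeg_mpow i a : mdeg (mpow i a) = a.
Proof.
rewrite (@mdegEw _ _ (fset1 i)); first by rewrite big_seq_fset1 mpowE eqxx.
apply/fsubsetP => j; rewrite -cmE_neq0 mpowE in_fset1.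
by case: (j == i).
Qed.

Lemma mpow_divK m i a : (a <= m i)%N -> mmul (mpow i a) (divcm m (mpow i a)) = m.
Proof.
move=> am; apply/eqP/cmP => j; rewrite cmM divcmE mpowE.
by case: eqP => [->|_]; rewrite ?subnKC // add0n subn0.
Qed.

Lemma exps_sing u a : (0 < a)%N -> exps u = [:: a] -> exists i, u = mpow i a.
Proof.
rewrite /exps => a0 ue.
case ie : (enum_fset (finsupp u)) ue => [|i [|//]] // [ua]; exists i.
apply/eqP/cmP => j; rewrite mpowE; case: eqP => [->//|/eqP ji].
apply/eqP; rewrite cmE_eq0; apply/negP.
by rewrite -[_ \in _]/(j \in enum_fset _) ie inE (negPf ji).
Qed.

Lemma exps_mpow i a : (0 < a)%N -> exps (mpow i a) = [:: a].
Proof.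
move=> a0; rewrite /exps; have -> : finsupp (mpow i a) = fset1 i.
  apply/fsetP => j; rewrite -cmE_neq0 mpowE in_fset1.
  by case: (j == i); rewrite // -lt0n.
have e : perm_eq (fset1 i) [:: i].
  by apply: uniq_perm; rewrite ?fset_uniq // => j; rewrite in_fset1 inE.
by rewrite (perm_small_eq _ e) //= mpowE eqxx.
Qed.

End Exponents.

Section MonomialSymf.
Context (k : fieldType).
Implicit Types (m : mon) (f g : symf k).

Lemma symf_exps f m m' : perm_eq (exps m) (exps m') -> f m = f m'.
Proof.
move=> /perm_exps_bij[s sb mE].
by rewrite ((symfP f).1 s m m' sb mE).
Qed.

Fact msym_subproof (s : seq nat) :
  (fun m : mon => (perm_eq (exps m) s)%:R : k^o) \in @symf_pred k.
Proof.
apply/asboolP; split=> [t m m' tb mE|].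
  by rewrite (permPl (exps_perm tb mE)).
exists (sumn s) => m ms; case: (boolP (perm_eq _ _)) => // /perm_sumn ms'.
by rewrite -ms' sumn_exps ltnn in ms.
Qed.

Definition msym s : symf k := Symf (msym_subproof s).

Lemma msymE s m : msym s m = (perm_eq (exps m) s)%:R.
Proof. by []. Qed.

(* msym [:: a] is the power sum of degree a. *)
Lemma symf_mul_power a f m : (0 < a)%N ->
  symf_mul (msym [:: a]) f m =
  \sum_(i <- finsupp m | (a <= m i)%N) f (divcm m (mpow i a)).
Proof.
move=> a0; rewrite symf_mulE.
rewrite (eq_bigr (fun p => if perm_eq (exps p.1) [:: a] then f p.2 else 0)); last first.
  by move=> p _; rewrite msymE; case: ifP; rewrite ?mul1r ?mul0r.
rewrite -big_mkcond -big_filter -[RHS]big_filter.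
(* The divisors of [m] of type [[:: a]] are the powers [x_i^a] with [a <= m i]. *)
rewrite -(big_map (fun i => (mpow i a, divcm m (mpow i a))) xpredT (fun p => f p.2)).
apply: perm_big; apply: uniq_perm.
- exact/filter_uniq/fset_uniq.
- rewrite map_inj_in_uniq ?filter_uniq ?fset_uniq // => i j _ _ [] /eqP/cmP/(_ i) + _.
  by rewrite !mpowE eqxx; case: eqP => // _ a0'; rewrite a0' in a0.
move=> [u v]; rewrite mem_filter mem_divs /=; apply/andP/mapP.
  move=> [/(@perm_small_eq _ _ [:: a] isT)/(exps_sing a0)[i ->] /eqP uv].
  have mi : m i = (a + v i)%N by rewrite -uv cmM mpowE eqxx.
  exists i; first by rewrite mem_filter mi leq_addr -cmE_neq0 mi -lt0n addn_gt0 a0.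
  congr (_, _); apply/eqP/cmP => j.
  by rewrite divcmE -uv cmM addKn.
move=> [i]; rewrite mem_filter => /andP[ai im] [-> ->].
by rewrite exps_mpow // mpow_divK.
Qed.

Lemma mdeg_div_mpow m i a : (a <= m i)%N ->
  mdeg (divcm m (mpow i a)) = (mdeg m - a)%N.
Proof. by move=> am; rewrite -{2}(mpow_divK am) mdegM mdeg_mpow addKn. Qed.

Lemma sum_leq_nat a b : (\sum_(1 <= i < a.+1) (i <= b) = minn a b)%N.
Proof.
elim: a => [|a IH]; first by rewrite big_geq // min0n.
rewrite big_nat_recr //= IH; case: (leqP a.+1 b) => ab.
  by rewrite (minn_idPl (ltnW ab)) addn1.
by rewrite addn0 (minn_idPr _).
Qed.

(** At a monomial [m] of degree [a] the right side counts pairs [(i, j)] with [1 <= i <= m j], of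
    which there are [mdeg m = a]. In other degrees both sides vanish. *)
Lemma symf_newton a :
  a%:R *: symf_h1 k a = \sum_(1 <= i < a.+1) symf_mul (msym [:: i]) (symf_h1 k (a - i)).
Proof.
apply/symf_eq => m.
have evl : linear (fun f : symf k => f m : k^o) by [].
rewrite (lin_sum _ _ _ evl) symfZ.
transitivity (\sum_(1 <= i < a.+1) \sum_(j <- finsupp m)
    ((mdeg m == a) && (i <= m j)%N)%:R : k); last first.
  rewrite !big_nat; apply: eq_bigr => i /andP[i1 ia]; rewrite symf_mul_power //.
  rewrite [RHS]big_mkcond; apply: eq_bigr => j _.
  case: leqP => [im|_]; last by rewrite andbF.
  rewrite andbT /= mdeg_div_mpow //; congr (_%:R); congr (nat_of_bool _).
  have id : (i <= mdeg m)%N := leq_trans im (mexp_le_deg m j).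
  by rewrite -[RHS](eqn_add2r i) !subnK.
rewrite /=; case: eqP => [ma|_]; last first.
  by rewrite mulr0 big1 // => i _; rewrite big1.
rewrite mulr1 exchange_big /= -{1}ma mdegE natr_sum; apply: eq_bigr => j _.
rewrite -natr_sum sum_leq_nat (minn_idPr _) // -ma; exact: mexp_le_deg.
Qed.

(** With more variables in [m] than parts in [s], dividing by [x_i^a] must eliminate [x_i]
    altogether. Hence [m i = a], and the admissible [i] are counted by the multiplicity of [a]. *)
Lemma msym_recursion a s m : (0 < a)%N -> (size s < size (exps m))%N ->
  symf_mul (msym [:: a]) (msym s) m = (count_mem a (a :: s))%:R * msym (a :: s) m.
Proof.
move=> a0 sm; rewrite symf_mul_power //.
transitivity (\sum_(i <- finsupp m) ((m i == a) && perm_eq (exps m) (a :: s))%:R : k).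
  rewrite big_mkcond !big_seq; apply: eq_bigr => i im; rewrite msymE.
  have supp j : j != i -> (j \in finsupp (divcm m (mpow i a))) = (j \in finsupp m).
    by move=> ji; rewrite -!cmE_neq0 divcmE mpowE (negPf ji) subn0.
  case: ltngtP => ami //=.
    (* If [a < m i] the variable survives, and the quotient still has too many variables for [s]. *)
    suff sE : size (exps (divcm m (mpow i a))) = size (exps m).
      by case: (boolP (perm_eq _ _)) => // /perm_size; rewrite sE => e; rewrite e ltnn in sm.
    rewrite !size_exps; congr size; congr enum_fset; apply/fsetP => j.
    have [->|/supp//] := eqVneq j i.
    by rewrite im -cmE_neq0 divcmE mpowE eqxx -lt0n subn_gt0.
  have : perm_eq (a :: exps (divcm m (mpow i a))) (exps m).
    have e : perm_eq (finsupp m) (i :: finsupp (divcm m (mpow i a))).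
      apply: uniq_perm => [||j]; first exact: fset_uniq.
        by rewrite /= fset_uniq andbT -cmE_eq0 divcmE mpowE eqxx ami subnn.
      by rewrite inE; case: eqVneq => [->|/supp ->].
    rewrite perm_sym /exps (permPl (perm_map m e)) /= -ami perm_cons.
    rewrite (_ : [seq m j | j <- _] =
        [seq divcm m (mpow i a) j | j <- finsupp (divcm m (mpow i a))]) //.
    apply/eq_in_map => j; rewrite -[_ \in _]/(j \in finsupp _) -cmE_neq0.
    rewrite divcmE mpowE; have [->|_] := eqVneq j i; last by rewrite subn0.
    by rewrite ami subnn.
  move=> e; congr (nat_of_bool _)%:R.
  by rewrite -(permPl e) perm_cons.
rewrite msymE; case: (boolP (perm_eq _ _)) => mas; last first.
  by rewrite mulr0 big1 // => i _; rewrite andbF.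
rewrite mulr1 -(seq.permP mas) /exps count_map -sum1_count natr_sum [RHS]big_mkcond /=.
by apply: eq_bigr => i _; rewrite andbT; case: ifP.
Qed.

End MonomialSymf.

Section Partitions.

Definition is_part (s : seq nat) := sorted geq s && all (ltn 0) s.

(** Partitions of all sums up to [d]. They have at most [d] parts, none exceeding [d], so padding by
    zeros makes each a [d]-tuple. *)
Definition partitions d : seq (seq nat) :=
  undup [seq s <- [seq sort geq [seq x <- map val t | 0 < x]%N
                    | t : d.-tuple 'I_d.+1 <- enum {: d.-tuple 'I_d.+1}]
         | sumn s <= d]%N.

Lemma geq_total : total geq.
Proof. by move=> x y; exact: leq_total. Qed.

Lemma geq_trans : transitive geq.
Proof. by move=> y x z /= xy yz; exact: leq_trans yz xy. Qed.

Lemma geq_anti : antisymmetric geq.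
Proof. by move=> x y; rewrite andbC; exact: anti_leq. Qed.

Lemma sort_part s : all (ltn 0) s -> is_part (sort geq s).
Proof. by move=> s0; rewrite /is_part sort_sorted ?all_sort //; exact: geq_total. Qed.

Lemma sumn_sort s : sumn (sort geq s) = sumn s.
Proof. by apply: perm_sumn; rewrite perm_sort. Qed.

Lemma part_perm s t : is_part s -> perm_eq s t -> sort geq t = s.
Proof.
move=> /andP[ss _] st; apply: (sorted_eq geq_trans geq_anti) => //.
  exact/sort_sorted/geq_total.
by rewrite perm_sort perm_sym.
Qed.

Lemma size_leq_sumn s : all (ltn 0) s -> (size s <= sumn s)%N.
Proof.
elim: s => //= x s IH /andP[x0 /IH ss].
by rewrite -add1n leq_add.
Qed.

Lemma mem_partitions d s : (s \in partitions d) = is_part s && (sumn s <= d)%N.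
Proof.
rewrite mem_undup mem_filter andbC; have [sd|_] := leqP; last by rewrite !andbF.
rewrite !andbT; apply/mapP/idP => [[t _ ->]|sp].
  exact/sort_part/filter_all.
have [/andP[ss s0] zs] := (sp, size_leq_sumn (proj2 (andP sp))).
pose u := s ++ nseq (d - size s) 0%N.
have su : size u = d.
  by rewrite size_cat size_nseq subnKC // (leq_trans zs).
have ud : all (fun x => x <= d)%N u.
  apply/allP => x; rewrite mem_cat => /orP[xs|/nseqP[-> _]] //.
  by apply: leq_trans sd; rewrite sumnE (big_rem x) //= leq_addr.
exists [tuple inord (nth 0%N u i) | i < d]; first by rewrite mem_enum.
have -> : map val [tuple (inord (nth 0%N u i) : 'I_d.+1) | i < d] = u.
  rewrite /= -map_comp -[RHS](mkseq_nth 0%N) su /mkseq -val_enum_ord -map_comp.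
  apply: eq_map => i /=; rewrite inordK // ltnS.
  by apply: (allP ud); rewrite mem_nth // su.
rewrite /u filter_cat (all_filterP s0) (@eq_in_filter _ _ pred0) => [|x /nseqP[-> _]//].
rewrite filter_pred0 cats0; apply/esym/part_perm => //.
Qed.

Lemma uniq_partitions d : uniq (partitions d).
Proof. exact: undup_uniq. Qed.

End Partitions.

(** * The functions [h] span, and their relations *)

Section SymfSpan.
Context (k : fieldType) (chark0 : [pchar k]%R =i pred0).
Implicit Types (m : mon) (f g : symf k).

Definition in_span f := exists x : {malg k[composition]},
  f = malg_lift (fun al : composition => symf_h k al) x.

Lemma in_span_lin a f g : in_span f -> in_span g -> in_span (a *: f + g).
Proof.
move=> [x ->] [y ->]; exists (a *: x + y); exact/esym/malg_lift_linear.
Qed.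

Lemma in_span0 : in_span 0.
Proof. by exists 0; rewrite (lin0 (malg_lift_linear _)). Qed.

Lemma in_spanZ a f : in_span f -> in_span (a *: f).
Proof. by move=> sf; rewrite -[_ *: _]addr0; exact: in_span_lin in_span0. Qed.

Lemma in_spanD f g : in_span f -> in_span g -> in_span (f + g).
Proof. by move=> sf sg; rewrite -[f]scale1r; exact: in_span_lin. Qed.

Lemma in_spanB f g : in_span f -> in_span g -> in_span (f - g).
Proof. by move=> sf sg; rewrite addrC -scaleN1r; exact: in_span_lin. Qed.

Lemma in_span_sum (I : eqType) (r : seq I) (F : I -> symf k) :
  (forall i, i \in r -> in_span (F i)) -> in_span (\sum_(i <- r) F i).
Proof.
move=> sF; rewrite big_seq; apply: big_ind => //; [exact: in_span0|exact: in_spanD].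
Qed.

Lemma in_span_h s : in_span (symf_h k s).
Proof. by exists << hat s >>; rewrite malg_liftU symf_h_hat. Qed.

Lemma in_span_mul f g : in_span f -> in_span g -> in_span (symf_mul f g).
Proof.
have bm := symf_mul_bilin k.
move=> [x ->] [y ->]; rewrite /malg_lift (bilin_suml _ _ _ _ bm).
apply: in_span_sum => al _; rewrite (bilin_sumr _ _ _ _ bm).
apply: in_span_sum => be _; rewrite (linZ _ _ (bm.1 _)) (linZ _ _ (bm.2 _)).
by rewrite -symf_h_cat; do 2!apply: in_spanZ; exact: in_span_h.
Qed.

Lemma symf_h1E a : symf_h1 k a = symf_h k [:: a].
Proof. by rewrite symf_hE big_seq1. Qed.

(** In Newton's identity the term [i = a] is the power sum times [h_0 = 1], so solving for it
    requires no division. *)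
Lemma in_span_power a : (0 < a)%N -> in_span (msym k [:: a]).
Proof.
elim/ltn_ind: a => a IH a0.
have := symf_newton k a; rewrite big_nat_recr //= subnn.
have -> : symf_mul (msym k [:: a]) (symf_h1 k 0) = msym k [:: a].
  by rewrite symf_mulC; exact: symf_mul1.
move/esym/(canRL (addKr _)) => ->; rewrite addrC.
apply: in_spanB; first by rewrite symf_h1E; apply/in_spanZ/in_span_h.
apply: in_span_sum => i; rewrite mem_index_iota => /andP[i0 ia].
by apply: in_span_mul; [exact: IH|rewrite symf_h1E; exact: in_span_h].
Qed.

Lemma natr_neq0 n : (0 < n)%N -> n%:R != 0 :> k.
Proof. by move=> n0; rewrite (pcharf0P k).1 // -lt0n. Qed.

(** Induction on the number of variables: the top layer of [f] is removed with monomial functions,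
    and what remains involves fewer variables. *)
Lemma in_span_supp r f : (forall m, (r < size (exps m))%N -> f m = 0) -> in_span f.
Proof.
elim: r f => [|r IH] f f0.
  rewrite (_ : f = (f mone : k) *: symf_h k [::]); first exact/in_spanZ/in_span_h.
  apply/symf_eq => m; rewrite symfZ /=.
  case: eqP => [/eqP|/eqP mN]; first by rewrite mdeg_eq0 => /eqP ->; rewrite mulr1.
  rewrite mulr0 f0 // lt0n; apply: contraNneq mN => /size0nil e.
  by rewrite -sumn_exps e.
(* [msym s] and the error term [g] both have at most [r] variables, so they are in the span by
   induction. Dividing by the multiplicity is where characteristic zero is used. *)
have base (s : seq nat) : size s = r.+1 -> all (ltn 0) s -> in_span (msym k s).
  case: s => // a s [sr] /= /andP[a0 s0].
  have c0 : (count_mem a (a :: s))%:R != 0 :> k by rewrite natr_neq0 //= eqxx.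
  pose g := symf_mul (msym k [:: a]) (msym k s) -
            (count_mem a (a :: s))%:R *: msym k (a :: s).
  have sg : in_span g.
    apply: IH => m rm; rewrite -sr in rm.
    rewrite -[LHS]/(symf_mul (msym k [:: a]) (msym k s) m -
      (count_mem a (a :: s))%:R * msym k (a :: s) m).
    by rewrite msym_recursion // subrr.
  have ss : in_span (msym k s).
    apply: IH => m rm; rewrite msymE; case: (boolP (perm_eq _ _)) => // /perm_size.
    by rewrite sr => e; rewrite e ltnn in rm.
  rewrite -[msym k _]scale1r -(mulVf c0) -scalerA; apply: in_spanZ.
  rewrite -[_ *: _](subKr (symf_mul (msym k [:: a]) (msym k s))).
  by apply: in_spanB => //; apply: in_span_mul => //; exact: in_span_power.
have [_ [d fd]] := symfP f.
(* Bounded degree leaves finitely many types with exactly [r.+1] variables, and [mono] supplies the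
   value of [f] on each. *)
pose L := [seq s <- partitions d | size s == r.+1].
pose g := f - \sum_(s <- L) (f (mono s) : k) *: msym k s.
have evl m : linear (fun f : symf k => f m : k^o) by [].
have gE m : g m = (f m : k) - \sum_(s <- L) (f (mono s) : k) * (msym k s m : k) :> k.
  by rewrite [LHS](linB _ _ (evl m)) (lin_sum _ _ _ (evl m)).
rewrite -[f](subrK (\sum_(s <- L) (f (mono s) : k) *: msym k s)); apply: in_spanD.
  apply: IH => m rm; rewrite gE.
  pose t := sort geq (exps m).
  have tm : perm_eq (exps m) t by rewrite perm_sym perm_sort.
  have tp : is_part t by exact/sort_part/exps_pos.
  have other s : is_part s -> s != t -> msym k s m = 0.
    move=> sp st; rewrite msymE; case: (boolP (perm_eq _ _)) => // ms.
    by rewrite -(part_perm sp (_ : perm_eq s (exps m))) ?eqxx // perm_sym in st.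
  have [tL|tN] := boolP (t \in L).
    rewrite (bigD1_seq t) ?filter_uniq ?uniq_partitions //.
    rewrite big1_seq => [|s /andP[st]]; last first.
      rewrite mem_filter mem_partitions => /and3P[_ sp _].
      by rewrite other ?mulr0.
    rewrite /= addr0 tm mulr1 (@symf_exps _ f (mono t) m) ?subrr //.
    by rewrite (perm_trans (exps_mono _)) 1?perm_sym //; case/andP: tp.
  have fm0 : f m = 0.
    have [dm|md] := ltnP d (mdeg m); first exact: fd.
    apply: f0; rewrite ltn_neqAle rm andbT; apply: contraNneq tN => e.
    by rewrite mem_filter size_sort -e eqxx mem_partitions tp sumn_sort sumn_exps.
  rewrite fm0 sub0r big1_seq ?oppr0 // => s /andP[_].
  rewrite mem_filter mem_partitions => /and3P[sz sp sd].
  rewrite other ?mulr0 //; apply: contraNneq tN => <-.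
  by rewrite mem_filter sz mem_partitions sp.
apply: in_span_sum => s; rewrite mem_filter mem_partitions => /and3P[/eqP sr /andP[_ s0] _].
exact/in_spanZ/base.
Qed.

Lemma h_span : spanning (fun al : composition => symf_h k al).
Proof.
move=> f; have [_ [d fd]] := symfP f; apply: (@in_span_supp d) => m dm.
by apply: fd; apply: leq_trans dm _; rewrite -sumn_exps; exact/size_leq_sumn/exps_pos.
Qed.

Lemma mdeg_mono s : all (ltn 0) s -> mdeg (mono s) = sumn s.
Proof. by move=> s0; rewrite -sumn_exps (perm_sumn (exps_mono s0)). Qed.

(* The square matrix of the values of the h_l at the monomials of type l', for
   partitions l and l' of size at most d, has full row space since the h_l span
   all symmetric functions; hence it is invertible. *)
Section Independence.
Variable d : nat.
Let l := partitions d.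
Let n := size l.
Let L (i : 'I_n) := nth [::] l i.

Let LP i : is_part (L i) && (sumn (L i) <= d)%N.
Proof. by rewrite -mem_partitions mem_nth. Qed.

Let L_inj (i j : 'I_n) : (L i == L j) = (i == j).
Proof. by rewrite nth_uniq ?uniq_partitions. Qed.

Definition hmx : 'M[k]_n := \matrix_(i, j) symf_h k (L i) (mono (L j)).

(** Collects the coefficients of all orderings of the same partition, which share one function
    [h]. *)
Definition part_coef (x : {malg k[composition]}) : 'rV[k]_n :=
  \row_i \sum_(al <- msupp x | sort geq al == L i) x@_al.

Lemma part_index (s : seq nat) : all (ltn 0) s -> (sumn s <= d)%N ->
  exists i, L i = sort geq s.
Proof.
move=> s0 sd; have sl : sort geq s \in l.
  by rewrite mem_partitions sort_part // sumn_sort.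
have il : (index (sort geq s) l < n)%N by rewrite index_mem.
by exists (Ordinal il); rewrite /L /= nth_index.
Qed.

Lemma part_coef_hmx x j :
  malg_lift (fun al : composition => symf_h k al) x (mono (L j)) =
  (part_coef x *m hmx) ord0 j.
Proof.
have evl m : linear (fun f : symf k => f m : k^o) by [].
rewrite /malg_lift (lin_sum _ _ _ (evl _)) mxE.
transitivity (\sum_i \sum_(al <- msupp x | sort geq al == L i)
    x@_al * symf_h k (L i) (mono (L j))); last first.
  by apply: eq_bigr => i _; rewrite !mxE mulr_suml.
rewrite (exchange_big_dep xpredT) //=; apply: eq_bigr => al _.
have al0 : all (ltn 0) al by case: (al).
have [ad|da] := leqP (sumn al) d.
  have [i iE] := part_index al0 ad.
  rewrite (big_pred1 i) => [|i']; last by rewrite /= -iE L_inj eq_sym.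
  by rewrite iE (@symf_h_perm _ (sort geq al) al) // perm_sort.
rewrite big1 => [|i /eqP e]; last first.
  by have := LP i; rewrite -e sumn_sort leqNgt da andbF.
rewrite -[LHS]/(x@_al * symf_h k al (mono (L j))) symf_h_deg ?mulr0 //.
have /andP[/andP[_ j0] jd] := LP j.
by rewrite mdeg_mono // ltn_eqF // (leq_ltn_trans jd).
Qed.

Lemma hmx_unit : hmx \in unitmx.
Proof.
rewrite -row_full_unit -sub1mx; apply/row_subP => i.
(* The values of [msym k (L i)] at the chosen monomials form the unit row [i]. Written through the
   [h], this row lies in the row space. *)
have [x xE] := h_span (msym k (L i)).
apply/submxP; exists (part_coef x); apply/rowP => j.
rewrite -part_coef_hmx -xE !mxE msymE eq_sym -L_inj.
have /andP[/andP[sj j0] _] := LP j; have /andP[ip _] := LP i.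
rewrite (permPl (exps_mono j0)); congr (nat_of_bool _)%:R.
apply/eqP/idP => [-> //|ji]; have /andP[jp _] := LP j.
by have := part_perm jp ji; rewrite (part_perm ip (perm_refl _)) => ->.
Qed.

End Independence.

(** Invertibility of [hmx] makes the collected coefficients of a relation vanish, with [d] large
    enough for its support. A [phi] that ignores the order of the parts sees only these. *)
Lemma h_lift0 (V : lmodType k) (phi : composition -> V) x :
  (forall al be : composition, perm_eq al be -> phi al = phi be) ->
  malg_lift (fun al : composition => symf_h k al) x = 0 -> malg_lift phi x = 0.
Proof.
move=> phip x0; pose d := \max_(al <- msupp x) sumn al.
have D0 : part_coef d x = 0.
  apply: (row_free_inj (_ : row_free (hmx d))); first by rewrite row_free_unit hmx_unit.
  by apply/rowP => j; rewrite /= mul0mx [RHS]mxE -part_coef_hmx x0.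
transitivity (\sum_(i < size (partitions d))
    part_coef d x ord0 i *: phi (hat (nth [::] (partitions d) i))).
  transitivity (\sum_(i < size (partitions d))
   \sum_(al <- msupp x | sort geq al == nth [::] (partitions d) i)
    x@_al *: phi al); last first.
    apply: eq_bigr => i _; rewrite mxE scaler_suml; apply: eq_bigr => al /eqP e.
    congr (_ *: _); apply: phip; rewrite -e /=.
    rewrite perm_sym (all_filterP _) ?perm_sort // all_sort.
    by case: (al).
  rewrite (exchange_big_dep xpredT) //= /malg_lift !big_seq; apply: eq_bigr => al alx.
  have al0 : all (ltn 0) al by case: (al).
  have ad : (sumn al <= d)%N by rewrite /d (big_rem al) //= leq_maxl.
  have [i iE] := part_index al0 ad.
  rewrite (big_pred1 i) // => i' /=.
  by rewrite -iE nth_uniq ?uniq_partitions // eq_sym.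
by rewrite D0 big1 // => i _; rewrite mxE scale0r.
Qed.

End SymfSpan.

(** * The structure maps of Lambda *)

Section HeisPerm.
Context (V : nmodType) (F : seq nat -> V).
Hypotheses (Fhat : forall s, F (hat s) = F s)
  (Fperm : forall s t, perm_eq s t -> F s = F t).

Lemma perm_headed s s' : perm_eq s' s ->
  exists f : 'I_(size s').+1 -> 'I_(size s).+1,
    [/\ injective f, f ord0 = ord0, forall i, i \in codom f
      & forall i, @headed s (f i) = @headed s' i].
Proof.
move=> p; have [Is pI s'E] := perm_iotaP 0%N p.
pose js := 0%N :: [seq i.+1 | i <- Is].
have pj : perm_eq js (iota 0 (size s).+1).
  rewrite /js /= perm_cons (iotaDl 1 0) perm_map //.
have sj : size js = (size s').+1 by rewrite /= size_map s'E size_map.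
have uj : uniq js by rewrite (perm_uniq pj) iota_uniq.
have lj (i : 'I_(size s').+1) : (nth 0%N js i < (size s).+1)%N.
  by have := mem_nth 0%N (_ : (i < size js)%N); rewrite sj (perm_mem pj) mem_iota; apply.
have key j : (j < (size s').+1)%N ->
    nth 0%N (0%N :: s) (nth 0%N js j) = nth 0%N (0%N :: s') j.
  case: j => [|j] //=; rewrite ltnS s'E size_map => jI.
  by rewrite !(nth_map 0%N).
exists (fun i => inord (nth 0%N js i)); split=> [i j /(congr1 val)/=||i|i].
- by rewrite !inordK // => /eqP; rewrite nth_uniq ?sj // => /eqP/val_inj.
- by apply/val_inj; rewrite /= inordK.
- have ij : nat_of_ord i \in js by rewrite (perm_mem pj) mem_iota /=.
  have ii : (index (nat_of_ord i) js < (size s').+1)%N by rewrite -sj index_mem.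
  apply/codomP; exists (Ordinal ii); apply/val_inj => /=.
  by rewrite inordK nth_index.
- by rewrite /headed inordK // key.
Qed.

(** Permuting parts permutes the rows and columns other than 0, so each array keeps its multiset of
    entries. *)
Lemma heis_sum_perm (al al' be be' : composition) :
  perm_eq al' al -> perm_eq be' be ->
  \sum_(maxn (sumn al) (sumn be) <= n < (sumn al + sumn be).+1)
     \sum_(M in heis_mx n al be) F (mx_comp M) =
  \sum_(maxn (sumn al') (sumn be') <= n < (sumn al' + sumn be').+1)
     \sum_(M in heis_mx n al' be') F (mx_comp M).
Proof.
move=> pa pb; have [f [fI f0 fc fE]] := perm_headed pa.
have [g [gI g0 gc gE]] := perm_headed pb.
rewrite (sum_heis_mx (N := sumn al + sumn be)) //.
rewrite (sum_heis_mx (N := sumn al + sumn be)) ?(perm_sumn pa) ?(perm_sumn pb) //.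
rewrite (sum_filling_emb _ (F := fun P => F (word P))
  (F' := fun P => F (word P)) fI gI f0 g0).
- by apply: eq_bigl => P; apply: eq_filling.
- by move=> i; rewrite fc.
- by move=> j; rewrite gc.
- move=> P P0; rewrite -Fhat -[RHS]Fhat; apply: Fperm.
  by apply: perm_word_emb => //; exact: pair_map_inj.
- by move=> P P' PP; congr F; apply: eq_map.
Qed.

End HeisPerm.

(** * The tensor square as a commutative ring *)

Section TensorRing.
Context (k : fieldType) (V : lmodType k) (m : V -> V -> V) (one : V).
Hypotheses (bm : bilin m) (mA : associative m) (mC : commutative m)
  (m1 : left_id one m).

Let bt := tmul_bilin bm.

Lemma tmulC : commutative (tmul m).
Proof.
move=> x y; move: x; apply: tens_ext => [||a b]; [exact: bt.1|exact: bt.2|].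
move: y; apply: tens_ext => [||c d]; [exact: bt.2|exact: bt.1|].
by rewrite !(tmul_pure bm) (mC a) (mC b).
Qed.

Lemma tmulA : associative (tmul m).
Proof.
move=> x y z; move: x; apply: tens_ext => [||a b].
- exact: bt.1.
- exact: (lin_comp (bt.1 z) (bt.1 y)).
move: y; apply: tens_ext => [||c d].
- exact: (lin_comp (bt.2 _) (bt.1 z)).
- exact: (lin_comp (bt.1 z) (bt.2 _)).
move: z; apply: tens_ext => [||e f].
- exact: (lin_comp (bt.2 _) (bt.2 _)).
- exact: bt.2.
by rewrite !(tmul_pure bm) !mA.
Qed.

Lemma tmul1 : left_id (one ⊗ one) (tmul m).
Proof.
apply: tens_ext => [||a b]; [exact: bt.2|exact: lin_id|].
by rewrite (tmul_pure bm) !m1.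
Qed.

Lemma tmulDl : left_distributive (tmul m) +%R.
Proof. by move=> x y z; rewrite (linD _ _ (bt.1 z)). Qed.

End TensorRing.

Section LambdaBasis.
Context (k : fieldType).

Definition symf_tens := tens (symf k) (symf k).
HB.instance Definition _ := GRing.Lmodule.on symf_tens.
HB.instance Definition _ := GRing.Zmodule_isComPzRing.Build symf_tens
  (tmulA (symf_mul_bilin k) (@symf_mulA k)) (tmulC (symf_mul_bilin k) (@symf_mulC k))
  (tmul1 (symf_mul_bilin k) (@symf_mul1 k)) (tmulDl (symf_mul_bilin k)).

Definition comul_h1 (a : nat) : symf_tens :=
  \sum_(i < a.+1) symf_h1 k i ⊗ symf_h1 k (a - i).

(** The value of the coproduct at [symf_h k s] forced by multiplicativity; as a commutative product
    it ignores the order of [s]. *)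
Definition comul_h (s : seq nat) : symf_tens := \prod_(a <- s) comul_h1 a.

Lemma comul_h_perm s t : perm_eq s t -> comul_h s = comul_h t.
Proof. by move=> st; rewrite /comul_h (perm_big _ st). Qed.

Lemma comul_h_hat s : comul_h (hat s) = comul_h s.
Proof.
rewrite /comul_h big_filter [RHS](bigID (fun a => 0 < a)%N) /=.
rewrite [X in _ = _ * X]big1 ?mulr1 // => a; rewrite -leqNgt leqn0 => /eqP ->.
by rewrite /comul_h1 big_ord1.
Qed.

Lemma prod_tpure (I : Type) (r : seq I) (f g : I -> symf k) :
  \prod_(i <- r) (f i ⊗ g i : symf_tens) =
  (\prod_(i <- r) f i : symf k) ⊗ (\prod_(i <- r) g i : symf k).
Proof.
elim: r => [|i r IH]; first by rewrite !big_nil.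
by rewrite !big_cons IH; exact: (tmul_pure (symf_mul_bilin k)).
Qed.

Lemma symf_h_word (I : finType) (b : I -> nat) :
  symf_h k (word b) = \prod_i symf_h1 k (b i).
Proof. by rewrite symf_hE big_map big_enum. Qed.

Lemma comul_hE (al : composition) : comul_h al =
  \sum_(b : {ffun 'I_(size al) -> 'I_(sumn al).+1} | [forall i, (b i <= nth 0 al i)%N])
    symf_h k (word (fun i => b i)) ⊗
    symf_h k (word (fun i : 'I_(size al) => nth 0 al i - b i)%N).
Proof.
rewrite /comul_h (big_nth 0%N) big_mkord.
pose F (i : 'I_(size al)) (j : 'I_(sumn al).+1) : symf_tens :=
  symf_h1 k j ⊗ symf_h1 k (nth 0%N al i - j).
rewrite (eq_bigr (fun i : 'I_(size al) =>
  \sum_(j : 'I_(sumn al).+1 | (j <= nth 0 al i)%N) F i j)) => [|i _].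
  rewrite bigA_distr_big_dep; apply: eq_big => [b|b _].
    by apply/familyP/forallP => h i; exact: h.
  by rewrite prod_tpure !symf_h_word.
have ia : (nth 0 al i <= sumn al)%N.
  by rewrite sumnE (big_nth 0%N) big_mkord (bigD1 i) //= leq_addr.
pose G j : symf_tens := symf_h1 k j ⊗ symf_h1 k (nth 0%N al i - j).
(* Each factor has its own range of [j]; widening them all to [sumn al] allows the product to be
   distributed over functions into one ordinal. *)
transitivity (\sum_(0 <= j < (nth 0 al i).+1) G j); first by rewrite big_mkord.
by rewrite (@big_nat_widen _ _ _ _ _ (sumn al).+1) // big_mkord.
Qed.

Context (chark0 : [pchar k]%R =i pred0).

Lemma symf_h_mx_part n s r (M : 'M['I_n]_(s, r)) :
  symf_h k (mx_part M) = symf_h k (mx_comp M).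
Proof. by apply: symf_h_perm; rewrite perm_sort. Qed.

Lemma Lambda_mulP : Lambda_mul_spec (@hmul k (Lambda k)).
Proof.
apply: xgetPex; pose phi (al be : composition) : symf k :=
  \sum_(maxn (sumn al) (sumn be) <= n < (sumn al + sumn be).+1)
    \sum_(M in heis_mx n al be) symf_h k (mx_comp M).
have phip := heis_sum_perm (@symf_h_hat k) (@symf_h_perm k).
have sh := h_span chark0.
have [||m bm mE] := @span_extend2 k _ _ _ _ _ _ _ phi sh sh.
- move=> be x; apply: (h_lift0 chark0) => al al' p.
  by apply: phip; rewrite // perm_sym.
- move=> al x; apply: (h_lift0 chark0) => be be' p.
  by apply: phip; rewrite // perm_sym.
exists m; split=> // al be; rewrite mE; apply: eq_bigr => n _.
by apply: eq_bigr => M _; rewrite symf_h_mx_part.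
Qed.

Lemma Lambda_comulP : Lambda_comul_spec (@hcomul k (Lambda k)).
Proof.
apply: xgetPex; have sh := h_span chark0.
have [D lD DE] := @span_extend k _ (tens (symf k) (symf k)) _ _
  (fun al : composition => comul_h al) sh
  (fun x => h_lift0 chark0 (fun al be => @comul_h_perm al be)).
have DhE s : D (symf_h k s) = comul_h s.
  by rewrite -symf_h_hat DE comul_h_hat.
have bt := tmul_bilin (symf_mul_bilin k); have bs := symf_mul_bilin k.
exists D; split=> // [|f g|a].
- by rewrite -[symf_one k]/(symf_h k [::]) DhE /comul_h big_nil.
- move: f; apply: (span_ext sh) => [||al].
  + exact: (lin_comp lD (bs.1 g)).
  + exact: (lin_comp (bt.1 _) lD).
  move: g; apply: (span_ext sh) => [||be].
  + exact: (lin_comp lD (bs.2 _)).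
  + exact: (lin_comp (bt.2 _) lD).
  by rewrite -symf_h_cat !DhE /comul_h big_cat.
- by rewrite symf_h1E DhE /comul_h big_seq1.
Qed.

Lemma Lambda_basis : @heis_basis k (Lambda k) (symf_h k).
Proof.
have [lD D1 DM Dh] := Lambda_comulP.
split.
- exact: symf_h_hat.
- exact: h_span.
- exact: Lambda_mulP.1.
- move=> al be; rewrite Lambda_mulP.2; apply: eq_bigr => n _.
  by apply: eq_bigr => M _; rewrite symf_h_mx_part.
- by [].
- exact: lD.
(* The chosen coproduct is known only through its specification, so its values at products are
   rebuilt one part at a time. *)
- move=> al; rewrite -comul_hE; elim: (parts al) => [|a s IH].
    by rewrite /comul_h big_nil.
  by rewrite [symf_h k _]/(symf_mul _ _) DM Dh IH /comul_h big_cons.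
- by [].
- exact: symf_h_mone.
Qed.

Lemma pi_mapP : Defs.pi_spec (@pi_map k).
Proof.
apply: xgetPex.
have [f lf fE] := span_extend (@X_span k) (@X_lift0 k _ (fun al : composition => symf_h k al)).
by exists f.
Qed.

End LambdaBasis.

Theorem corollary9p3 (k : fieldType) (chark0 : [pchar k]%R =i pred0) :
  (is_hopf (Lambda k) /\ cocommutative (Lambda k)) /\
  is_hopf_morphism (@pi_map k).
Proof.
have hL := Lambda_basis chark0; have hS := Sigma_basis k.
have HL := heis_hopf hL; have HS := heis_hopf hS.
split; first by split; [exact: HL|exact: (heis_cocomm hL)].
have [lp pE] := pi_mapP k.
have piX al : pi_map (X k al) = symf_h k al by exact: pE.
have sX : @spanning k (Sigma k) _ (@X k) := @X_span k.
have bmS := hb_mul hS; have bmL := hb_mul hL.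
have lDS := hb_comul hS; have lDL := hb_comul hL.
(* On basis elements both products sum over the same matrices, so [pi_map] matches them term by
   term. *)
have piM (x y : Sigma k) : pi_map (hmul x y) = hmul (pi_map x) (pi_map y).
  move: x; apply: (span_ext sX) => [||al].
  - exact: (lin_comp lp (bmS.1 y)).
  - exact: (lin_comp (bmL.1 _) lp).
  move: y; apply: (span_ext sX) => [||be].
  - exact: (lin_comp lp (bmS.2 _)).
  - exact: (lin_comp (bmL.2 _) lp).
  rewrite !piX (Sigma_mulP k).2 (hb_mulE hL) (lin_sum _ _ _ lp).
  apply: eq_bigr => n _; rewrite (lin_sum _ _ _ lp); apply: eq_bigr => M _.
  exact: piX.
have pi1 : pi_map (hone (Sigma k)) = hone (Lambda k) by exact: piX.
have piD (x : Sigma k) : hcomul (pi_map x) = tmap (@pi_map k) (@pi_map k) (hcomul x).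
  have lt := tmap_linear lp lp.
  move: x; apply: (span_ext sX) => [||al].
  - exact: (lin_comp lDL lp).
  - exact: (lin_comp lt lDS).
  rewrite piX (hb_comulE hL) (Sigma_comulP k).2 (lin_sum _ _ _ lt).
  apply: eq_bigr => b _; apply/esym; apply: (etrans (tmap_pure _ _ lp lp)).
  (* The coproduct of [Sigma] omits zero parts; on the [Lambda] side this changes nothing because
     [h_0 = 1]. *)
  by congr (_ ⊗ _); apply: (etrans (piX _)); exact: symf_h_hat.
have pie (x : Sigma k) : hcounit (pi_map x) = hcounit x.
  move: x; apply: (@span_ext k (Sigma k) k^o _ _ _ _ sX) => [||al].
  - exact: (@lin_comp _ _ _ k^o _ _ (hb_counit hL) lp).
  - exact: (hb_counit hS).
  by rewrite piX (hb_counitE hL) [RHS]Sigma_counitE.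
split=> //.
move=> S T; exact: (bialgebra_morph_antipode (heis_bialgebra hS)
  (heis_bialgebra hL) lp piM pi1 piD pie).
Qed.
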